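(* Let $p\in(1,\infty)$, $\frac1p+\frac1{p'}=1$, $\alpha\in(-\frac1p,\frac1{p'})$, let $X,U,Y$ be Banach spaces and let $x_0\in X$. Let $F:X\to B(Y,U)$ be a Lipschitz-continuous operator-valued function. Let $A,B,C$ be linear operators such that $-A_0:=-(A-BF(x_0)C)$ generates an analytic semigroup $T(\cdot)$ in $X$ and such that $B$ and $C$ are finite-time $L^p$-admissible of type $\alpha$ for $A_0$. Assume in addition that $Z\hookrightarrow X$ is a Banach space such that the system corresponding to $(A_0,B,\mathrm{Id}_Z)$ is finite-time $L^p$-wellposed of type $\alpha$, and that $C\in B(Z,Y)$. Then there exists $\tau=\tau(x_0)>0$ such that the closed loop system $$x'(t)+Ax(t)=Bu(t),\quad x(0)=x_0,\quad y(t)=Cx(t),\quad u(t)=F(x(t))\,y(t)\qquad(t\in[0,\tau])$$ has a unique mild solution $x\in C([0,\tau],X)\cap L^p_\alpha([0,\tau],Z)$.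
   Context: A mild solution on $[0,\tau]$ is a solution $x$ of the integral equation $$x=T(\cdot)x_0+T(\cdot)*B\bigl(F(x)-F(x_0)\bigr)Cx\quad\text{on }[0,\tau],$$ where $*$ is convolution on $[0,\tau]$, $(T(\cdot)*Bf)(t)=\int_0^tT(t-s)Bf(s)\,ds$, with $T(\cdot)$ extended as below. For an integer $k\ge1$, and $\lambda_0$ such that $-\lambda_0$ lies in the resolvent set of $A_0$, $X_k$ is $\mathcal D(A_0^k)$ with norm $\|(\lambda_0+A_0)^k\cdot\|_X$ and $X_{-k}$ is the completion of $X$ for $\|(\lambda_0+A_0)^{-k}\cdot\|_X$; $T(\cdot)$ extends to a strongly continuous semigroup $T_{-k}(\cdot)$ on $X_{-k}$. For an interval $I\subseteq(0,\infty)$, $L^p_\alpha(I,E)=\{f:I\to E:\ t\mapsto t^\alpha f(t)\in L^p(I,E)\}$ with norm $\|t^\alpha f\|_{L^p(I,E)}$ (and $[0,\tau]$ may replace $(0,\tau)$). An observation operator $C\in B(X_k,Y)$ (for some $k$) is finite-time $L^p$-admissible of type $\alpha>-\frac1p$ for $A_0$ if for every $\tau>0$ there is $M_\tau$ with $\|CT(\cdot)x\|_{L^p_\alpha([0,\tau],Y)}\le M_\tau\|x\|_X$ for all $x\in X_k$. A control operator $B\in B(U,X_{-k})$ is finite-time $L^p$-admissible of type $\alpha<\frac1{p'}$ for $A_0$ if for every $\tau>0$ there is $K_\tau$ with $\|T_{-k}B*u\|_{L^\infty((0,\tau),X)}\le K_\tau\|u\|_{L^p_\alpha((0,\tau),U)}$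 for all $u\in L^p_\alpha((0,\tau),U)$. A system $(A_0,B,\widetilde C)$ with observation operator $\widetilde C\in B(X_k,\widetilde Y)$ is finite-time $L^p$-wellposed of type $\alpha$ if $B$ and $\widetilde C$ are finite-time $L^p$-admissible of type $\alpha$ for $A_0$ and, on $I=[0,\tau]$, the map $u\mapsto\widetilde CT_{-k}(\cdot)B*u$ is bounded $L^p_\alpha(I,U)\to L^p_\alpha(I,\widetilde Y)$ (this does not depend on $\tau>0$). For $(A_0,B,\mathrm{Id}_Z)$ the observation operator is the identity regarded as an operator into $\widetilde Y=Z$. *)

(* Defs.v *)
From HB Require Import structures.
From mathcomp Require Import all_boot all_order all_algebra.
From mathcomp Require Import all_classical all_reals all_analysis.
From mathcomp Require Import complex.
Set Implicit Arguments.
Unset Strict Implicit.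
Unset Printing Implicit Defensive.
Import Order.TTheory GRing.Theory Num.Theory.
Import numFieldNormedType.Exports.
Local Open Scope classical_set_scope.
Local Open Scope ring_scope.
Local Open Scope complex_scope.

(* Banach spaces are complex; MathComp's norm on a normedModType R[i] is
   R[i]-valued, and nrm is the same norm read in R. *)
Definition nrm (R : realType) (V : normedModType R[i]) (x : V) : R :=
  complex.Re `|x|.

Definition bounded_op (R : realType) (V W : normedModType R[i]) (f : V -> W) :=
  exists M : R, forall x, nrm (f x) <= M * nrm x.

Definition opnorm (R : realType) (V W : normedModType R[i]) (f : V -> W) : R :=
  inf [set M : R | 0 <= M /\ forall x, nrm (f x) <= M * nrm x].

Section Bochner.
Context {R : realType}.
Local Notation mu := (@lebesgue_measure R).

Section DefBochner.
Context {E : normedModType R[i]}.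

Record simple_fun := SimpleFun {
  sf_size : nat;
  sf_set : 'I_sf_size -> set R;
  sf_val : 'I_sf_size -> E;
  sf_measurable : forall i, measurable (sf_set i);
  sf_finite : forall i, (mu (sf_set i) < +oo)%E }.

Definition sf_eval (s : simple_fun) (t : R) : E :=
  \sum_(i < sf_size s) (\1_(sf_set i) t : R)%:C *: sf_val i.

Definition sf_integral (D : set R) (s : simple_fun) : E :=
  \sum_(i < sf_size s) (fine (mu (sf_set i `&` D)))%:C *: sf_val i.

Definition ae_limit (D : set R) (s : nat -> simple_fun) (f : R -> E) :=
  {ae mu, forall t, D t -> sf_eval (s n) t @[n --> \oo] --> f t}.

Definition strongly_measurable (D : set R) (f : R -> E) :=
  exists s, ae_limit D s f.

(* f is Bochner integrable on D, with integral v. *)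
Definition bochner_integral (D : set R) (f : R -> E) (v : E) :=
  exists s : nat -> simple_fun,
    [/\ ae_limit D s f,
        (\int[mu]_(t in D) (nrm (f t - sf_eval (s n) t))%:E)%E
           @[n --> \oo] --> 0%E
      & sf_integral D (s n) @[n --> \oo] --> v].

Definition Lp_norm (p : \bar R) (I : set R) (f : R -> E) : \bar R :=
  Lnorm mu p ((fun t => (nrm (f t))%:E) \_ I).

Definition in_Lp (p : \bar R) (I : set R) (f : R -> E) :=
  strongly_measurable I f /\ (Lp_norm p I f < +oo)%E.

Definition Lpw_norm (p a : R) (I : set R) (f : R -> E) : \bar R :=
  Lp_norm p%:E I (fun t => (t `^ a)%:C *: f t).

Definition in_Lpw (p a : R) (I : set R) (f : R -> E) :=
  in_Lp p%:E I (fun t => (t `^ a)%:C *: f t).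

End DefBochner.
End Bochner.

(* Unbounded operators: op_fun is only meaningful on the subspace op_dom. *)
Record unbounded_op (R : realType) (V W : lmodType R[i]) := UnboundedOp {
  op_dom : set V;
  op_fun :> V -> W;
  op_dom0 : op_dom 0;
  op_dom_lin : forall a u v, op_dom u -> op_dom v -> op_dom (a *: u + v);
  op_lin : forall a u v, op_dom u -> op_dom v ->
    op_fun (a *: u + v) = a *: op_fun u + op_fun v }.

(* The identity of Z, seen as an operator from X to Z with domain Z, for Z
   embedded in X by iota. *)
Section IdOp.
Variables (R : realType) (Z X : lmodType R[i]) (iota : {linear Z -> X}).
Hypothesis iota_inj : injective iota.

Definition id_fun (x : X) : Z := xget 0 [set z | iota z = x].

Lemma id_funK z : id_fun (iota z) = z.
Proof.
rewrite /id_fun; case: xgetP => [z' _ /= /iota_inj //|/(_ z)].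
by move=> /(_ erefl).
Qed.

Fact id_op_dom0 : range iota 0.
Proof. by exists 0 => //; rewrite linear0. Qed.

Fact id_op_dom_lin a u v :
  range iota u -> range iota v -> range iota (a *: u + v).
Proof.
by move=> [y _ <-] [z _ <-]; exists (a *: y + z) => //; rewrite linearP.
Qed.

Fact id_op_lin a u v : range iota u -> range iota v ->
  id_fun (a *: u + v) = a *: id_fun u + id_fun v.
Proof. by move=> [y _ <-] [z _ <-]; rewrite -linearP !id_funK. Qed.

Definition id_op : unbounded_op X Z :=
  UnboundedOp id_op_dom0 id_op_dom_lin id_op_lin.
End IdOp.

Section Semigroups.
Context {R : realType} {X : completeNormedModType R[i]}.
Implicit Types (T : R -> {linear X -> X}) (A : unbounded_op X X).

(* Only the values T t for t >= 0 matter. *)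
Definition C0_semigroup T :=
  [/\ forall t, 0 <= t -> bounded_op (T t),
      forall x, T 0 x = x,
      forall s t x, 0 <= s -> 0 <= t -> T (s + t) x = T s (T t x)
    & forall x, T t x @[t --> 0^'+] --> x].

Definition neg_generates A T := forall x y,
  op_dom A x /\ - A x = y <->
  (h^-1)%:C *: (T h x - x) @[h --> 0^'+] --> y.

Definition sector (th : R) : set R[i]^o :=
  [set z | 0 < complex.Re z /\ `|complex.Im z| < tan th * complex.Re z].

Definition analytic_semigroup T :=
  C0_semigroup T /\
  exists (th : R) (S : R[i]^o -> {linear X -> X}),
    [/\ 0 < th < pi / 2,
        forall t x, 0 < t -> S t%:C x = T t x,
        forall z, sector th z -> bounded_op (S z) &
    [/\ forall z w x, sector th z -> sector th w -> S (z + w) x = S z (S w x),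
        forall x z, sector th z -> derivable (fun w => S w x) z 1
      & forall th' x, 0 < th' < th ->
          S z x @[z --> within (sector th') (nbhs 0)] --> x]].

Definition resolvent_set A : set R[i] :=
  [set l | exists S : {linear X -> X},
    [/\ bounded_op S,
        forall x, op_dom A (S x) /\ l *: S x - A (S x) = x
      & forall x, op_dom A x -> S (l *: x - A x) = x]].

Fixpoint pow_dom A (k : nat) : set X :=
  if k is k'.+1 then [set x | pow_dom A k' x /\ op_dom A (iter k' A x)]
  else setT.

(* (l + A)^k, meaningful on pow_dom A k *)
Definition shift_pow A (l : R[i]) (k : nat) (x : X) : X :=
  iter k (fun y => l *: y + A y) x.

(* j : X -> E exhibits E as the completion X_{-k} of X for the norm
   |(l + A)^{-k} y|; here y = (l + A)^k x, and y ranges over all of X when -l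
   is in the resolvent set of A. *)
Definition extrapolation_space A (l : R[i]) (k : nat)
    (E : completeNormedModType R[i]) (j : {linear X -> E}) :=
  (forall x, pow_dom A k x -> nrm (j (shift_pow A l k x)) = nrm x) /\
  dense (range j).

Definition extends_semigroup (E : completeNormedModType R[i])
    (j : {linear X -> E}) T (Tk : R -> {linear E -> E}) :=
  forall t x, 0 <= t -> Tk t (j x) = j (T t x).

End Semigroups.

Section Admissibility.
Context {R : realType} {X U E : completeNormedModType R[i]}.
Local Notation mu := (@lebesgue_measure R).
Variables (p a : R).
Variables (A0 : unbounded_op X X) (l0 : R[i]) (T : R -> {linear X -> X}).
(* E = X_{-k}, with embedding j and extended semigroup Tk *)
Variables (j : {linear X -> E}) (Tk : R -> {linear E -> E}).
Variable (B : {linear U -> E}).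

(* v is the value at t of the convolution of Tk and B u. *)
Definition conv_at (u : R -> U) (t : R) (v : E) :=
  bochner_integral `[0, t] (fun s => Tk (t - s) (B (u s))) v.

Section Observation.
Context {Y : completeNormedModType R[i]}.
Variable (C : unbounded_op X Y).

(* C is in B(X_k, Y). *)
Definition bounded_on_pow (k : nat) :=
  pow_dom A0 k `<=` op_dom C /\
  exists M : R, forall x, pow_dom A0 k x ->
    nrm (C x) <= M * nrm (shift_pow A0 l0 k x).

Definition obs_admissible :=
  exists k : nat, [/\ (0 < k)%N, bounded_on_pow k &
    forall tau : R, 0 < tau -> exists M : R, forall x, pow_dom A0 k x ->
      in_Lpw p a `[0, tau] (fun t => C (T t x)) /\
      (Lpw_norm p a `[0%R, tau] (fun t => C (T t x)) <= (M * nrm x)%:E)%E].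

End Observation.

Definition ctrl_admissible :=
  bounded_op B /\
  forall tau : R, 0 < tau -> exists K : R, forall u : R -> U,
    in_Lpw p a `]0, tau[ u ->
    exists w : R -> X,
      [/\ {ae mu, forall t, `]0, tau[%classic t -> conv_at u t (j (w t))},
          in_Lp +oo%E `]0, tau[ w
        & (Lp_norm +oo `]0%R, tau[ w <= K%:E * Lpw_norm p a `]0%R, tau[ u)%E].

(* w is the convolution of Tk and B u, with values in X (identified with a
   subspace of E by j); Ct may be applied to it as soon as w lies in its
   domain almost everywhere. *)
Definition wellposed (Y : completeNormedModType R[i])
    (Ct : unbounded_op X Y) :=
  [/\ ctrl_admissible, obs_admissible Ct &
  exists tau : R, 0 < tau /\ exists K : R, forall u : R -> U,
    in_Lpw p a `[0, tau] u ->
    exists w : R -> X,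
      [/\ {ae mu, forall t, `[0, tau]%classic t ->
             conv_at u t (j (w t)) /\ op_dom Ct (w t)},
          in_Lpw p a `[0, tau] (fun t => Ct (w t))
        & (Lpw_norm p a `[0%R, tau] (fun t => Ct (w t))
           <= K%:E * Lpw_norm p a `[0%R, tau] u)%E]].

Section MildSolution.
Context {Y Z : completeNormedModType R[i]}.
Variables (F : X -> {linear Y -> U}) (C : unbounded_op X Y) (x0 : X).

Definition mild_solution (tau : R) (x : R -> X) :=
  {ae mu, forall t, `[0, tau]%classic t -> op_dom C (x t)} /\
  forall t, 0 <= t <= tau ->
    conv_at (fun s => F (x s) (C (x s)) - F x0 (C (x s))) t
            (j (x t - T t x0)).

(* x is in C([0,tau],X) and in L^p_a([0,tau],Z), Z being embedded by iota. *)
Definition in_solution_space (iota : {linear Z -> X}) (tau : R) (x : R -> X) :=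
  {within `[0, tau], continuous x} /\
  exists2 z : R -> Z, in_Lpw p a `[0, tau] z
    & {ae mu, forall t, `[0, tau]%classic t -> x t = iota (z t)}.

End MildSolution.
End Admissibility.

(* A0 = A - B F(x0) C, where A and B take values in the extrapolation space E:
   the domain of A0 consists of the x for which the right-hand side is defined
   and belongs to X. *)
Definition is_closed_loop_op (R : realType)
    (X U Y E : completeNormedModType R[i]) (j : {linear X -> E})
    (A : unbounded_op X E) (B : {linear U -> E}) (Fx0 : {linear Y -> U})
    (C : unbounded_op X Y) (A0 : unbounded_op X X) :=
  forall x v, op_dom A0 x /\ A0 x = v <->
    [/\ op_dom A x, op_dom C x & A x - B (Fx0 (C x)) = j v].

(* Main.v *)
Require Import Defs.
From HB Require Import structures.
From mathcomp Require Import all_boot all_order all_algebra.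
From mathcomp Require Import all_classical all_reals all_analysis.
From mathcomp Require Import complex ring lra measurable_realfun ess_sup_inf.
Set Implicit Arguments.
Unset Strict Implicit.
Unset Printing Implicit Defensive.
Import Order.TTheory GRing.Theory Num.Theory.
Import numFieldNormedType.Exports.
Local Open Scope classical_set_scope.
Local Open Scope ring_scope.
Local Open Scope complex_scope.

(* Write Phi u for the convolution of T_{-k} and B u. The unknown is the input
   u in L^p_a(U): setting x = T x0 + Phi u, the equation becomes
   u = (F(x) - F(x0)) C x on [0,tau']. Both x - x0 in C([0,tau'],X) and x in
   L^p_a([0,tau'],Z) are O(rho) once |u| <= rho and tau' is small, because
   T t x0 -> x0 and the norm of T x0 in L^p_a([0,tau'],Z) tends to 0 with tau';
   hence the right-hand side, quadratic in these two quantities, is a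
   contraction of the ball of radius rho. That T x0 lies in L^p_a(Z) for every
   x0 in X follows from the admissibility of Id_Z, which only concerns the
   domain of a power of A0, since T s x0 lies there for s > 0 and tends to x0.
   Uniqueness is local and propagates to [0,tau']: on a short interval beyond
   the one where two solutions agree, the difference of the inputs is at most
   half of itself. Admissibility of B only gives values of Phi u in X almost
   everywhere; they exist for all t and are continuous, by the semigroup
   property and the absolute continuity of the norm. *)

(** * The real-valued norm of a complex space *)

(** The input is taken as the unknown because its single norm controls, linearly and with one
    constant K, both the state in X and its representative in Z; iterating on x would require
    following two norms at once. Well-posedness provides its bound on one interval []0, tau[]. All
    norms are therefore taken there: an input on a shorter interval is extended by zero ([cutoff]),
    and since Phi is causal this changes nothing on the shorter interval. So K does not deteriorate
    as tau' shrinks, and the same device measures a function on the small windows used for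
    continuity and for uniqueness. Functions are not identified almost everywhere. Whenever a
    measurable norm is needed, a strongly measurable function is replaced by an everywhere limit of
    simple functions, and representatives in Z are compared through the injectivity of the
    embeddings of Z in X and of X in X_{-k}. *)

Section Norm.
Context {R : realType} {V : normedModType R[i]}.
Implicit Types (x y : V) (c : R).

Lemma nrmE x : `|x| = (nrm x)%:C.
Proof. by rewrite /nrm RRe_real ?ger0_real. Qed.

Lemma nrm_ge0 x : 0 <= nrm x.
Proof. by rewrite -lecR -nrmE normr_ge0. Qed.

Lemma nrm0 : nrm (0 : V) = 0.
Proof. by rewrite /nrm normr0. Qed.

Lemma nrm_eq0 x : nrm x = 0 -> x = 0.
Proof. by move=> h; apply/normr0_eq0; rewrite nrmE h. Qed.

Lemma nrmN x : nrm (- x) = nrm x.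
Proof. by rewrite /nrm normrN. Qed.

Lemma nrm_distC x y : nrm (x - y) = nrm (y - x).
Proof. by rewrite -nrmN opprB. Qed.

Lemma nrmD x y : nrm (x + y) <= nrm x + nrm y.
Proof. by rewrite -lecR rmorphD/= -!nrmE ler_normD. Qed.

Lemma nrmB x y : nrm (x - y) <= nrm x + nrm y.
Proof. by rewrite -[nrm y]nrmN nrmD. Qed.

Lemma nrm_tri z x y : nrm (x - y) <= nrm (x - z) + nrm (z - y).
Proof. by rewrite -[x - y](subrKA z) nrmD. Qed.

Lemma nrmZC (c : R[i]) x : nrm (c *: x) = complex.Re `|c| * nrm x.
Proof.
by rewrite /nrm normrZ nrmE /=; case: `|c| => a b /=; rewrite mulr0 subr0.
Qed.

Lemma nrmZ c x : nrm (c%:C *: x) = `|c| * nrm x.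
Proof. by rewrite nrmZC normc_def/= expr0n/= addr0 sqrtr_sqr. Qed.

Lemma ler_nrm_dist x y : `|nrm x - nrm y| <= nrm (x - y).
Proof.
have h := nrmD (x - y) y; have h' := nrmD (y - x) x.
by rewrite !subrK [nrm (y - x)]nrm_distC in h h'; rewrite ler_norml; lra.
Qed.

Lemma nrm_cvgP {T : Type} {F : set_system T} {FF : Filter F} (f : T -> V) l :
  f @ F --> l <-> forall e : R, 0 < e -> \forall t \near F, nrm (f t - l) < e.
Proof.
split=> [/cvgrPdist_lt h e e0|h].
  have := h e%:C; rewrite ltcR => /(_ e0); apply: filterS => t.
  by rewrite nrmE ltcR nrm_distC.
apply/cvgrPdist_lt => e e0.
have eE : e = (complex.Re e)%:C by rewrite RRe_real ?gtr0_real.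
have := h (complex.Re e); rewrite -ltcR -eE => /(_ e0); apply: filterS => t.
by rewrite nrm_distC -ltcR -eE -nrmE.
Qed.

Lemma nrm_cvg0P {T : Type} {F : set_system T} {FF : Filter F} (f : T -> V) l :
  f @ F --> l <-> nrm (f t - l) @[t --> F] --> (0 : R).
Proof.
rewrite nrm_cvgP; split=> [h|/cvgr0Pnorm_lt h e e0].
  apply/cvgr0Pnorm_lt => e /h; apply: filterS => t.
  by rewrite ger0_norm ?nrm_ge0.
by have := h e e0; apply: filterS => t; rewrite ger0_norm ?nrm_ge0.
Qed.

Lemma cvg_nrm {T : Type} {F : set_system T} {FF : Filter F} (f : T -> V) l :
  f @ F --> l -> nrm (f t) @[t --> F] --> nrm l.
Proof.
move=> /nrm_cvgP h; apply/cvgrPdist_lt => e /h; apply: filterS => t.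
by apply: le_lt_trans; rewrite nrm_distC ler_nrm_dist.
Qed.

Lemma nrm_lim_le {T : Type} {F : set_system T} {FF : ProperFilter F}
  (f : T -> V) l M : f @ F --> l -> (\forall t \near F, nrm (f t) <= M) ->
  nrm l <= M.
Proof.
exact: (fun h => cvgr_to_le (cvg_nrm h)).
Qed.

Lemma nrm_squeeze {T : Type} {F : set_system T} {FF : Filter F} (f : T -> V) l
  (b : T -> R) : (\forall t \near F, nrm (f t - l) <= b t) ->
  b t @[t --> F] --> 0 -> f @ F --> l.
Proof.
move=> fb b0; apply/nrm_cvg0P.
apply: (squeeze_cvgr _ (cvg_cst 0) b0).
by apply: filterS fb => t ->; rewrite nrm_ge0.
Qed.

End Norm.

Lemma nrm_continuousP (R : realType) (V : normedModType R[i]) (D : set R)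
    (f : R -> V) :
  {within D, continuous f} <->
  forall t, D t -> forall e, 0 < e -> exists2 d, 0 < d &
    forall s, D s -> `|s - t| < d -> nrm (f s - f t) < e.
Proof.
rewrite subspace_continuousP; split=> h t Dt.
  move=> e e0; have /nrm_cvgP/(_ e e0) := h t Dt.
  rewrite /within/= => /nbhs_ballP[d /= d0 dh]; exists d => // s Ds std.
  by apply: dh => //; rewrite /ball/= distrC.
apply/nrm_cvgP => e e0; have [d d0 dh] := h t Dt e e0.
rewrite /within/=; apply/nbhs_ballP; exists d => //= s; rewrite /ball/= => ts Ds.
by apply: dh => //; rewrite distrC.
Qed.

Lemma nrm_cauchy_cvg (R : realType) (V : completeNormedModType R[i])
    (u : nat -> V) :
  (forall e : R, 0 < e -> exists N, forall n m, (N <= n)%N -> (N <= m)%N ->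
    nrm (u n - u m) < e) ->
  exists l : V, u @ \oo --> l.
Proof.
move=> h; suff : cvg (u @ \oo) by move=> cu; exists (lim (u @ \oo)).
apply/cauchy_cvgP/cauchyP => e e0.
have eE : e = (complex.Re e)%:C by rewrite RRe_real ?gtr0_real.
have := h (complex.Re e); rewrite -ltcR -eE => /(_ e0)[N hN].
exists (u N); exists N => // n /= Nn.
by rewrite -ball_normE /= nrmE eE ltcR hN.
Qed.

Lemma nrm_cauchy_cvg_bound (R : realType) (V : completeNormedModType R[i])
    (u : nat -> V) (b : nat -> R) :
  (forall n m, (n <= m)%N -> nrm (u n - u m) <= b n) -> b @ \oo --> 0 ->
  exists l : V, u @ \oo --> l.
Proof.
move=> ub b0; apply: nrm_cauchy_cvg => e e0.
have /cvgr0Pnorm_lt/(_ e e0)[N _ hN] := b0; exists N => n m Nn Nm.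
wlog nm : n m Nn Nm / (n <= m)%N => [hw|].
  by have [|/ltnW] := leqP n m; [|rewrite nrm_distC]; exact: hw.
exact: le_lt_trans (ub _ _ nm) (le_lt_trans (ler_norm _) (hN n Nn)).
Qed.

Lemma bounded_op_cvg (R : realType) (V W : normedModType R[i])
    (f : {linear V -> W}) (bf : bounded_op f) {T : Type} {F : set_system T}
    {FF : Filter F} (u : T -> V) l :
  u @ F --> l -> f (u t) @[t --> F] --> f l.
Proof.
move: bf => [M fM] /nrm_cvg0P ul.
apply: (@nrm_squeeze _ _ _ _ _ _ _ (fun t => M * nrm (u t - l))).
  by apply: nearW => t; rewrite -linearB fM.
by rewrite -(mulr0 M); apply: cvgMr.
Qed.

(* Gliding hump (Sokal); the Banach-Steinhaus theorem of the library is stated for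
   real scalars only. *)
Lemma uniform_boundedness (R : realType) (V : completeNormedModType R[i])
    (W : normedModType R[i]) (I : Type) (f : I -> {linear V -> W}) :
  (forall i, bounded_op (f i)) ->
  (forall x, exists M : R, forall i, nrm (f i x) <= M) ->
  exists2 M : R, 0 <= M & forall i x, nrm (f i x) <= M * nrm x.
Proof.
move=> fb fx; apply: contrapT => /forall2NP hM.
(* Every ball contains a point where some [f i] exceeds [M]: for [y] of norm r with [f i y] large, 2
   f y = f (c + y) - f (c - y) forces one of the two values to be large. *)
have large (M r : R) c : 0 <= M -> 0 < r ->
    exists i y, nrm (y - c) <= r /\ M < nrm (f i y).
  move=> M0 r0; have Mr : 0 <= M / r by rewrite divr_ge0 // ltW.
  have [//|/existsNP[i /existsNP[x /negP]]] := hM (M / r).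
  rewrite -ltNge => Mx.
  have x0 : 0 < nrm x.
    rewrite lt0r nrm_ge0 andbT; apply/eqP => /nrm_eq0 x0.
    by move: Mx; rewrite x0 nrm0 linear0 nrm0 mulr0 ltxx.
  pose y := (r / nrm x)%:C *: x.
  have yr : nrm y = r.
    by rewrite nrmZ ger0_norm ?divr_ge0 ?nrm_ge0 1?ltW // divfK ?gt_eqF.
  have fy : M < nrm (f i y).
    rewrite linearZ nrmZ ger0_norm ?divr_ge0 ?nrm_ge0 1?ltW //.
    have -> : M = r / nrm x * (M / r * nrm x).
      by field; rewrite !gt_eqF.
    by rewrite ltr_pM2l ?divr_gt0.
  have [fp|fp] := ltP M (nrm (f i (c + y))).
    by exists i, (c + y); rewrite addrAC subrr add0r yr.
  exists i, (c - y); rewrite addrAC subrr add0r nrmN yr; split=> //.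
  have : nrm (f i y + f i y) <= nrm (f i (c + y)) + nrm (f i (c - y)).
    rewrite -linearD (_ : y + y = (c + y) - (c - y)); last first.
      by rewrite opprB [c + y]addrC addrACA subrr addr0.
    by rewrite linearB nrmB.
  have : nrm (f i y + f i y) = nrm (f i y) *+ 2.
    by rewrite -mulr2n -scaler_nat; have := nrmZ 2 (f i y); rewrite rmorph_nat => ->; rewrite normr_nat mulr_natl.
  lra.
(* The state is a counter n and a closed ball. Asking [large] for n + 1 and taking the radius below
   1 / (|B| + 1), with [B] a bound of [f i], keeps [f i] above n on the whole new ball. *)
have step (s : nat * (V * R)) : exists s' : nat * (V * R), 0 < s.2.2 ->
   [/\ s'.1 = s.1.+1, 0 < s'.2.2, s'.2.2 <= s.2.2 / 2,
      (forall z, nrm (z - s'.2.1) <= s'.2.2 -> nrm (z - s.2.1) <= s.2.2) &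
      exists i, forall z, nrm (z - s'.2.1) <= s'.2.2 -> s.1%:R < nrm (f i z)].
  have [s0|s0] := ltP 0 s.2.2; last by exists s.
  have n1 : 0 <= s.1%:R + 1 :> R by rewrite addr_ge0.
  have s2 : 0 < s.2.2 / 2 by rewrite divr_gt0.
  have [i [y [yc fy]]] := large _ _ s.2.1 n1 s2.
  have [B fB] := fb i.
  pose r := Num.min (s.2.2 / 2) (1 / (`|B| + 1)).
  have B1 : 0 < `|B| + 1 by rewrite ltr_wpDl.
  have r0 : 0 < r by rewrite lt_min !divr_gt0.
  exists (s.1.+1, (y, r)); split => //=.
  - by rewrite ge_min lexx.
  - move=> z; rewrite le_min => /andP[zy _].
    by have := nrm_tri y z s.2.1; lra.
  exists i => z; rewrite le_min => /andP[_ zy].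
  have := fB (z - y); rewrite linearB => fzy.
  have : B * nrm (z - y) <= 1.
    apply: (@le_trans _ _ ((`|B| + 1) * (1 / (`|B| + 1)))).
      apply: (@le_trans _ _ ((`|B| + 1) * nrm (z - y))).
        by rewrite ler_wpM2r ?nrm_ge0 // (le_trans (ler_norm _)) // lerDl.
      by rewrite ler_pM2l.
    by rewrite mulrC divfK ?gt_eqF.
  by have := nrm_tri (f i z) (f i y) 0; rewrite !subr0 [nrm (f i y - _)]nrm_distC; lra.
have [g gP] := choice step.
pose s n := iter n g (0%N, (0, 1)) : nat * (V * R).
have s0 n : 0 < (s n).2.2 by elim: n => [|n IH] //=; have [] := gP _ IH.
have s1 n : (s n).1 = n by elim: n => [|n IH] //=; have [->] := gP _ (s0 n); rewrite IH.
have sr n : (s n).2.2 <= 2^-1 ^+ n.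
  elim: n => [|n IH]; first by rewrite expr0.
  by have [_ _ h _ _] := gP _ (s0 n); rewrite exprSr (le_trans h) // ler_pM2r.
have nest n m : (n <= m)%N -> forall z, nrm (z - (s m).2.1) <= (s m).2.2 ->
    nrm (z - (s n).2.1) <= (s n).2.2.
  move=> /subnK <-; elim: (m - n)%N => [//|k IH] z.
  by have [_ _ _ h _] := gP _ (s0 (k + n)%N); rewrite addSn => /h /IH.
have cs n m : (n <= m)%N -> nrm ((s m).2.1 - (s n).2.1) <= (s n).2.2.
  by move=> nm; apply: nest nm _ _; rewrite subrr nrm0 ltW.
have [l cl] : exists l : V, (fun n => (s n).2.1) @ \oo --> l.
  apply: (@nrm_cauchy_cvg_bound _ _ _ (fun n => 2^-1 ^+ n)).
    by move=> n m nm; rewrite nrm_distC (le_trans (cs _ _ nm)).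
  by apply: cvg_expr; rewrite ger0_norm ?invr_ge0 // invf_lt1 // ltr1n.
have ls n : nrm (l - (s n).2.1) <= (s n).2.2.
  apply: (@nrm_lim_le _ _ _ \oo _ (fun m => (s m).2.1 - (s n).2.1)).
    by apply: cvgB cl _; exact: cvg_cst.
  by exists n => // m /= nm; exact: cs.
have [M hMl] := fx l.
have [n Mn] : exists n : nat, M < n%:R.
  by exists (Num.truncn M).+1; exact: truncnS_gt.
have [_ _ _ _ [i /(_ l (ls n.+1))]] := gP _ (s0 n).
by rewrite s1 => nl; have := hMl i; lra.
Qed.

(** * Simple functions and strong measurability *)

Section LowerIntegral.
Context d (T : measurableType d) (R : realType).
Variable mu : {measure set T -> \bar R}.
Import HBNNSimple.

(* [integral] is a supremum over simple functions below, so for nonnegative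
   functions no measurability is needed. *)
Lemma ge0_ae_le_integral_nomeas (D : set T) (f g : T -> \bar R) :
  (forall x, D x -> (0 <= f x)%E) -> (forall x, D x -> (0 <= g x)%E) ->
  {ae mu, forall x, D x -> (f x <= g x)%E} ->
  (\int[mu]_(x in D) f x <= \int[mu]_(x in D) g x)%E.
Proof.
move=> f0 g0 [N [mN N0 fgN]]; rewrite !ge0_integralE //.
apply: ge_ereal_sup => _ [h /= hf <-].
(* Zeroing [h] on the exceptional null set preserves its integral and makes it a competitor in the
   supremum for [g]. *)
pose h' := proj_nnsfun h (measurableC mN).
have -> : sintegral mu h = sintegral mu h'.
  rewrite -!integralT_nnsfun; apply: ge0_ae_eq_integral => //.
  - exact/measurable_EFinP.
  - exact/measurable_EFinP.
  - by move=> x _; rewrite lee_fin.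
  - by move=> x _; rewrite lee_fin.
  exists N; split => // x /= /not_implyP[_ hx]; apply: contrapT => Nx; apply: hx.
  by rewrite mindicE mem_set // mulr1.
apply: ereal_sup_ubound; exists h' => //= x.
rewrite mindicE; have [Nx|Nx] := pselect (N x).
  rewrite memNset ?mulr0; last by move/(_ Nx).
  by rewrite /patch; case: ifPn => // /[!inE]; exact: g0.
rewrite mem_set // mulr1 (le_trans (hf x)) // /patch.
case: ifPn => // /[!inE] Dx.
have : ~ ~ (D x -> (f x <= g x)%E) by move=> H; apply: Nx; exact: fgN.
by move=> /contrapT/(_ Dx).
Qed.

Lemma ge0_ae_eq_integral_nomeas (D : set T) (f g : T -> \bar R) :
  (forall x, D x -> (0 <= f x)%E) -> (forall x, D x -> (0 <= g x)%E) ->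
  {ae mu, forall x, D x -> f x = g x} ->
  (\int[mu]_(x in D) f x = \int[mu]_(x in D) g x)%E.
Proof.
move=> f0 g0 fg; apply/eqP; rewrite eq_le; apply/andP; split;
  apply: ge0_ae_le_integral_nomeas => //; apply: filterS fg => x h /h -> //.
Qed.
End LowerIntegral.

Section SimpleFunctions.
Context {R : realType} {E : normedModType R[i]}.
Local Notation mu := (@lebesgue_measure R).
Local Notation simple_fun := (@simple_fun R E).
Implicit Types (s : simple_fun) (A D : set R).

(** [P] is arbitrary: the sum takes finitely many values, so no sigma-algebra on [E] is involved.
    The induction splits on membership in the first set; [v] accumulates the values already
    decided. *)
Lemma measurable_simple_sum d' (T' : measurableType d') (P : E -> T')
    (n : nat) (A : 'I_n -> set R) (e : 'I_n -> E) (v : E) :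
  (forall i, measurable (A i)) ->
  measurable_fun setT
    (fun t => P (v + \sum_(i < n) (\1_(A i) t : R)%:C *: e i)).
Proof.
elim: n A e v => [|n IH] A e v mA.
  by under eq_fun do rewrite big_ord0; exact: measurable_cst.
move=> _ Y mY; rewrite setTI.
have -> : (fun t => P (v + \sum_(i < n.+1) (\1_(A i) t : R)%:C *: e i)) @^-1` Y
  = (A ord0 `&` (fun t => P ((v + e ord0) +
       \sum_(i < n) (\1_(A (lift ord0 i)) t : R)%:C *: e (lift ord0 i))) @^-1` Y)
  `|` (~` A ord0 `&` (fun t => P (v +
       \sum_(i < n) (\1_(A (lift ord0 i)) t : R)%:C *: e (lift ord0 i))) @^-1` Y).
  apply/seteqP; split=> t /=; rewrite big_ord_recl indicE.
    have [At|At] := pselect (A ord0 t).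
      by rewrite mem_set // scale1r addrA; left.
    by rewrite memNset // scale0r add0r; right.
  move=> [[At]|[At]]; first by rewrite mem_set // scale1r addrA.
  by rewrite memNset // scale0r add0r.
apply: measurableU; apply: measurableI.
- exact: mA.
- by rewrite -[X in measurable X]setTI; apply: IH => // i; exact: mA.
- by apply: measurableC; exact: mA.
- by rewrite -[X in measurable X]setTI; apply: IH => // i; exact: mA.
Qed.

Lemma measurable_sf_eval d' (T' : measurableType d') (P : E -> T') s :
  measurable_fun setT (P \o sf_eval s).
Proof.
have := @measurable_simple_sum _ _ P _ (@sf_set _ _ s) (@sf_val _ _ s) 0
  (@sf_measurable _ _ s).
by under eq_fun do rewrite add0r.
Qed.

Lemma measurable_nrm_sf s : measurable_fun setT (fun t => nrm (sf_eval s t)).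
Proof. exact: measurable_sf_eval. Qed.

(* Splitting D along the first set and induction avoid refining the sets of a
   simple function to disjoint ones. *)
Lemma nrm_sum_le_integral n (A : 'I_n -> set R) (e : 'I_n -> E) (v : E) D :
  (forall i, measurable (A i)) -> measurable D -> (mu D < +oo)%E ->
  ((nrm ((fine (mu D))%:C *: v +
     \sum_(i < n) (fine (mu (A i `&` D)))%:C *: e i))%:E <=
  \int[mu]_(t in D) (nrm (v + \sum_(i < n) (\1_(A i) t : R)%:C *: e i))%:E)%E.
Proof.
elim: n A e v D => [|n IH] A e v D mA mD Dfin.
  rewrite big_ord0 addr0; under eq_integral do rewrite big_ord0 addr0.
  rewrite integral_cst // nrmZ ger0_norm ?fine_ge0 // EFinM fineK.
    by rewrite muleC.
  by rewrite ge0_fin_numE.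
have mA0 := mA ord0.
have mD1 : measurable (D `&` A ord0) by exact: measurableI.
have mD2 : measurable (D `\` A ord0) by exact: measurableD.
have D1fin : (mu (D `&` A ord0) < +oo)%E.
  by apply: le_lt_trans Dfin; apply: le_measure; rewrite ?inE //; exact: subIsetl.
have D2fin : (mu (D `\` A ord0) < +oo)%E.
  by apply: le_lt_trans Dfin; apply: le_measure; rewrite ?inE //; exact: subDsetl.
have fin_sub B C : measurable B -> measurable C -> C `<=` D ->
    mu (B `&` C) \is a fin_num.
  move=> mB mC CD; rewrite ge0_fin_numE // (le_lt_trans _ Dfin) //.
  apply: le_measure; rewrite ?inE //; first exact: measurableI.
  by move=> t [_ /CD].
have split_mu B : measurable B -> (fine (mu (B `&` D)) =
    fine (mu (B `&` (D `&` A ord0))) + fine (mu (B `&` (D `\` A ord0)))).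
  move=> mB; rewrite -fineD ?fin_sub //.
  by rewrite (measureDI mu (measurableI _ _ mB mD) mA0) addeC setIA setIDA.
have mA' i : measurable (A (lift ord0 i)) by exact: mA.
have -> : (\int[mu]_(t in D) (nrm (v + \sum_(i < n.+1) (\1_(A i) t : R)%:C *: e i))%:E
  = \int[mu]_(t in D `&` A ord0) (nrm ((v + e ord0) +
       \sum_(i < n) (\1_(A (lift ord0 i)) t : R)%:C *: e (lift ord0 i)))%:E
  + \int[mu]_(t in D `\` A ord0) (nrm (v +
       \sum_(i < n) (\1_(A (lift ord0 i)) t : R)%:C *: e (lift ord0 i)))%:E)%E.
  rewrite -[in LHS](setUIDK D (A ord0)) ge0_integral_setU //.
  - congr (_ + _)%E; apply: eq_integral => t; rewrite inE => -[_ At].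
      by rewrite big_ord_recl indicE mem_set // scale1r addrA.
    by rewrite big_ord_recl indicE memNset // scale0r add0r.
  - apply/measurable_EFinP; apply: measurable_funTS.
    exact: (measurable_simple_sum (@nrm _ _)).
  - by move=> t _; rewrite lee_fin nrm_ge0.
  by apply/disj_setPLR => t [_ At] [_].
apply: (le_trans _ (leeD (IH _ (fun i => e (lift ord0 i)) (v + e ord0) _ mA' mD1 D1fin)
  (IH _ (fun i => e (lift ord0 i)) v _ mA' mD2 D2fin))).
rewrite -EFinD lee_fin; apply: le_trans (nrmD _ _); rewrite le_eqVlt; apply/orP; left.
apply/eqP; congr nrm; rewrite big_ord_recl.
have := split_mu setT; rewrite !setTI => -> //.
rewrite [A ord0 `&` D]setIC !scalerDr rmorphD/= scalerDl.
rewrite [in RHS]addrACA -!addrA; congr (_ + _).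
under eq_bigr do rewrite split_mu // rmorphD/= scalerDl.
rewrite big_split /= !addrA; congr (_ + _ + _).
by rewrite addrC.
Qed.
End SimpleFunctions.

Section AE.
Context {R : realType}.
Local Notation mu := (@lebesgue_measure R).
Implicit Types P Q : R -> Prop.

#[global] Instance ae_lebesgue_filter : Filter (almost_everywhere mu).
Proof. exact: ae_filter_ringOfSetsType. Qed.

Lemma aeS P Q : (forall t, P t -> Q t) ->
  {ae mu, forall t, P t} -> {ae mu, forall t, Q t}.
Proof. by move=> PQ; apply: (@filterS _ (almost_everywhere mu)). Qed.

Lemma aeS2 P P' Q : (forall t, P t -> P' t -> Q t) ->
  {ae mu, forall t, P t} -> {ae mu, forall t, P' t} -> {ae mu, forall t, Q t}.
Proof. by move=> PQ; apply: (@filterS2 _ (almost_everywhere mu)). Qed.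

Lemma aeS3 P P' P'' Q : (forall t, P t -> P' t -> P'' t -> Q t) ->
  {ae mu, forall t, P t} -> {ae mu, forall t, P' t} ->
  {ae mu, forall t, P'' t} -> {ae mu, forall t, Q t}.
Proof. by move=> PQ; apply: (@filterS3 _ (almost_everywhere mu)). Qed.

Lemma ae_nat (P : nat -> R -> Prop) : (forall n, {ae mu, forall t, P n t}) ->
  {ae mu, forall t, forall n, P n t}.
Proof. exact: ae_foralln. Qed.
End AE.

(** * Sums, restrictions and linear images of simple functions *)

Section SimpleAlgebra.
Context {R : realType}.
Local Notation mu := (@lebesgue_measure R).

Section SimpleOps.
Context {E : normedModType R[i]}.
Local Notation simple_fun := (@simple_fun R E).
Implicit Types (s : simple_fun) (A D : set R).

Lemma nrm_sf_integral_le D s : measurable D -> (mu D < +oo)%E ->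
  ((nrm (sf_integral D s))%:E <= \int[mu]_(t in D) (nrm (sf_eval s t))%:E)%E.
Proof.
move=> mD Dfin.
have := nrm_sum_le_integral (@sf_val _ _ s) 0 (@sf_measurable _ _ s) mD Dfin.
rewrite scaler0 add0r => /le_trans; apply; rewrite le_eqVlt; apply/orP; left.
by apply/eqP; apply: eq_integral => t _; rewrite add0r.
Qed.

Section Add.
Variables s s' : simple_fun.
Let A (i : 'I_(sf_size s + sf_size s')) : set R :=
  match fintype.split i with inl k => @sf_set _ _ s k | inr k => @sf_set _ _ s' k end.
Let e (i : 'I_(sf_size s + sf_size s')) : E :=
  match fintype.split i with inl k => @sf_val _ _ s k | inr k => @sf_val _ _ s' k end.
Let mA i : measurable (A i).
Proof. by rewrite /A; case: fintype.split => k; exact: sf_measurable. Qed.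
Let fA i : (mu (A i) < +oo)%E.
Proof. by rewrite /A; case: fintype.split => k; exact: sf_finite. Qed.
(** The sets of a simple function may overlap, so a sum is the concatenation of two families. *)
Definition sf_add := SimpleFun e mA fA.

Let split_l k : fintype.split (@lshift _ (sf_size s') k) = inl k :> ('I_(sf_size s) + _).
Proof. exact: (unsplitK (inl k)). Qed.
Let split_r k : fintype.split (@rshift (sf_size s) _ k) = inr k :> (_ + 'I_(sf_size s')).
Proof. exact: (unsplitK (inr k)). Qed.

Lemma sf_addE t : sf_eval sf_add t = sf_eval s t + sf_eval s' t.
Proof.
rewrite /sf_eval big_split_ord /=; congr (_ + _); apply: eq_bigr => k _.
  by rewrite /A /e split_l.
by rewrite /A /e split_r.
Qed.

Lemma sf_add_integral D :
  sf_integral D sf_add = sf_integral D s + sf_integral D s'.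
Proof.
rewrite /sf_integral big_split_ord /=; congr (_ + _); apply: eq_bigr => k _.
  by rewrite /A /e split_l.
by rewrite /A /e split_r.
Qed.
End Add.

Section Restr.
Variables (s : simple_fun) (A : set R) (mA : measurable A).
Let mA' i : measurable (@sf_set _ _ s i `&` A).
Proof. by apply: measurableI => //; exact: sf_measurable. Qed.
Let fA i : (mu (@sf_set _ _ s i `&` A) < +oo)%E.
Proof.
apply: le_lt_trans (@sf_finite _ _ s i); apply: le_measure; rewrite ?inE //.
  exact: mA'.
exact: sf_measurable.
Qed.
Definition sf_restr := SimpleFun (@sf_val _ _ s) mA' fA.

Lemma sf_restrE t : sf_eval sf_restr t = (\1_A t : R)%:C *: sf_eval s t.
Proof.
rewrite /sf_eval scaler_sumr; apply: eq_bigr => i _ /=.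
by rewrite scalerA indicI -rmorphM/= mulrC.
Qed.
End Restr.

Section Indic.
Variables (A : set R) (mA : measurable A) (fA : (mu A < +oo)%E) (e : E).
Definition sf_indic := @SimpleFun _ _ 1 (fun=> A) (fun=> e) (fun=> mA) (fun=> fA).

Lemma sf_indicE t : sf_eval sf_indic t = (\1_A t : R)%:C *: e.
Proof. by rewrite /sf_eval big_ord1. Qed.
End Indic.

Let m0 : measurable (set0 : set R). Proof. exact: measurable0. Qed.
Let f0 : (mu set0 < +oo)%E. Proof. by rewrite measure0. Qed.
Definition sf_zero := sf_indic m0 f0 0.

Lemma sf_zeroE t : sf_eval sf_zero t = 0.
Proof. by rewrite sf_indicE scaler0. Qed.

End SimpleOps.

Section Map.
Context {E E' : normedModType R[i]} (L : {linear E -> E'}).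
Variable s : @simple_fun R E.
Definition sf_map := SimpleFun (fun i => L (@sf_val _ _ s i))
  (@sf_measurable _ _ s) (@sf_finite _ _ s).

Lemma sf_mapE t : sf_eval sf_map t = L (sf_eval s t).
Proof.
by rewrite /sf_eval linear_sum; apply: eq_bigr => i _; rewrite linearZ.
Qed.

Lemma sf_map_integral D : sf_integral D sf_map = L (sf_integral D s).
Proof.
by rewrite /sf_integral linear_sum; apply: eq_bigr => i _; rewrite linearZ.
Qed.
End Map.

Section Opp.
Context {E : normedModType R[i]} (s : @simple_fun R E).
Definition sf_opp := sf_map ( -%R : {linear E -> E}) s.
Lemma sf_oppE t : sf_eval sf_opp t = - sf_eval s t.
Proof. exact: sf_mapE. Qed.
Lemma sf_opp_integral D : sf_integral D sf_opp = - sf_integral D s.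
Proof. exact: sf_map_integral. Qed.
End Opp.
End SimpleAlgebra.

(** * Strongly measurable functions and their everywhere-defined representatives *)

Section StrongMeasurability.
Context {R : realType}.
Local Notation mu := (@lebesgue_measure R).
Implicit Types (A D : set R).

(* Everywhere limits of simple functions; unlike strongly measurable functions,
   which are only determined almost everywhere, their norms are Borel. *)
Definition simple_limit {E : normedModType R[i]} (g : R -> E) :=
  exists s : nat -> simple_fun, forall t, sf_eval (s n) t @[n --> \oo] --> g t.

Lemma scale_indic (E : lmodType R[i]) A t (x : E) :
  (\1_A t : R)%:C *: x = if t \in A then x else 0.
Proof. by rewrite indicE; case: (t \in A); rewrite ?scale1r ?scale0r. Qed.

Section One.
Context {E : normedModType R[i]}.
Implicit Types (f g : R -> E).

Lemma simple_limit_nrm g : simple_limit g -> measurable_fun setT (fun t => nrm (g t)).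
Proof.
move=> [s sg]; apply: (measurable_fun_cvg (fun n => measurable_nrm_sf (s n))).
by move=> t _; exact: cvg_nrm.
Qed.

Lemma simple_limit_sf (s : @simple_fun R E) : simple_limit (sf_eval s).
Proof. by exists (fun=> s) => t; exact: cvg_cst. Qed.

Lemma simple_limitD f g : simple_limit f -> simple_limit g ->
  simple_limit (fun t => f t + g t).
Proof.
move=> [s sf] [s' sg]; exists (fun n => sf_add (s n) (s' n)) => t.
by under eq_fun do rewrite sf_addE; exact: cvgD.
Qed.

Lemma simple_limitN f : simple_limit f -> simple_limit (fun t => - f t).
Proof.
move=> [s sf]; exists (fun n => sf_opp (s n)) => t.
by under eq_fun do rewrite sf_oppE; exact: cvgN.
Qed.

Lemma simple_limitB f g : simple_limit f -> simple_limit g ->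
  simple_limit (fun t => f t - g t).
Proof. by move=> hf /simple_limitN; exact: simple_limitD. Qed.

Lemma simple_limit_restr f A : measurable A -> simple_limit f ->
  simple_limit (fun t => (\1_A t : R)%:C *: f t).
Proof.
move=> mA [s sf]; exists (fun n => sf_restr (s n) mA) => t.
under eq_fun do rewrite sf_restrE scale_indic; rewrite scale_indic.
by case: (t \in A); [exact: sf|apply: cvg_cst].
Qed.

Lemma simple_limit_sm f D : simple_limit f -> strongly_measurable D f.
Proof. by move=> [s sf]; exists s; apply: aeW => t _; exact: sf. Qed.

(** Restricting the approximants to the part of [D] off the exceptional null set gives convergence
    at every point, to a function that is zero elsewhere. *)
Lemma sm_simple_limit D f : measurable D -> strongly_measurable D f ->
  exists2 g, simple_limit g & {ae mu, forall t, D t -> f t = g t}.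
Proof.
move=> mD [s [N [mN N0 sN]]].
have mDN : measurable (D `\` N) by exact: measurableD.
exists (fun t => (\1_(D `\` N) t : R)%:C *: f t).
  exists (fun n => sf_restr (s n) mDN) => t.
  under eq_fun do rewrite sf_restrE scale_indic; rewrite scale_indic.
  have [|_] := boolP (t \in _); last by apply: cvg_cst.
  rewrite inE => -[Dt Nt]; apply: contrapT => h; apply/Nt/sN => /= H.
  exact/h/H.
exists N; split => // t /not_implyP[Dt ft]; apply: contrapT => Nt; apply: ft.
by rewrite scale_indic mem_set.
Qed.

Lemma sm_ae D f g : {ae mu, forall t, D t -> f t = g t} ->
  strongly_measurable D f -> strongly_measurable D g.
Proof.
move=> fg [s sf]; exists s; rewrite /ae_limit in sf *.
by apply: filterS2 fg sf => t + + Dt => /(_ Dt) <- /(_ Dt).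
Qed.

Lemma smD D f g : strongly_measurable D f -> strongly_measurable D g ->
  strongly_measurable D (fun t => f t + g t).
Proof.
move=> [s sf] [s' sg]; exists (fun n => sf_add (s n) (s' n)).
rewrite /ae_limit in sf sg *; apply: filterS2 sf sg => t + + Dt.
by move=> /(_ Dt) h /(_ Dt) h'; under eq_fun do rewrite sf_addE; exact: cvgD.
Qed.

Lemma smN D f : strongly_measurable D f -> strongly_measurable D (fun t => - f t).
Proof.
move=> [s sf]; exists (fun n => sf_opp (s n)).
rewrite /ae_limit in sf *; apply: filterS sf => t + Dt.
by move=> /(_ Dt) h; under eq_fun do rewrite sf_oppE; exact: cvgN.
Qed.

Lemma smB D f g : strongly_measurable D f -> strongly_measurable D g ->
  strongly_measurable D (fun t => f t - g t).
Proof. by move=> hf /smN; exact: smD. Qed.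

Lemma sm_sub D D' f : D `<=` D' -> strongly_measurable D' f ->
  strongly_measurable D f.
Proof.
move=> DD' [s sf]; exists s; rewrite /ae_limit in sf *.
by apply: filterS sf => t h /DD'.
Qed.

Lemma sm_restr D A f : measurable A -> strongly_measurable (D `&` A) f ->
  strongly_measurable D (fun t => (\1_A t : R)%:C *: f t).
Proof.
move=> mA [s sf]; exists (fun n => sf_restr (s n) mA).
rewrite /ae_limit in sf *; apply: filterS sf => t h Dt.
under eq_fun do rewrite sf_restrE scale_indic; rewrite scale_indic.
have [|_] := boolP (t \in A); last by apply: cvg_cst.
by rewrite inE => At; apply: h.
Qed.

Lemma sm_ae_dom D D' f : {ae mu, forall t, D t -> D' t} ->
  strongly_measurable D' f -> strongly_measurable D f.
Proof.
move=> DD' [s sf]; exists s; rewrite /ae_limit in sf *.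
by apply: filterS2 DD' sf => t h h' /h.
Qed.

End One.

Lemma sm_map (E E' : normedModType R[i]) (L : {linear E -> E'}) D (f : R -> E) :
  bounded_op L -> strongly_measurable D f -> strongly_measurable D (fun t => L (f t)).
Proof.
move=> bL [s sf]; exists (fun n => sf_map L (s n)).
rewrite /ae_limit in sf *; apply: filterS sf => t + Dt.
by move=> /(_ Dt) h; under eq_fun do rewrite sf_mapE; exact: bounded_op_cvg.
Qed.

End StrongMeasurability.

(** * The Bochner integral *)

Section IntegralNorm.
Context {R : realType}.
Local Notation mu := (@lebesgue_measure R).
Implicit Types (D : set R).
Local Open Scope ereal_scope.

Lemma dominated_cvg0 D (h : nat -> R -> R) (b : R -> R) : measurable D ->
  (forall n, measurable_fun D (h n)) -> measurable_fun D b ->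
  {ae mu, forall t, D t -> h n t @[n --> \oo] --> 0%R} ->
  (forall n t, D t -> (0 <= h n t <= b t)%R) ->
  \int[mu]_(t in D) (b t)%:E < +oo ->
  \int[mu]_(t in D) (h n t)%:E @[n --> \oo] --> 0.
Proof.
move=> mD mh mb h0 hb bfin.
have [| | | | |_ _] := @dominated_convergence _ _ _ mu D mD (fun n t => (h n t)%:E)
  (cst 0) (fun t => (b t)%:E).
- by move=> n; apply/measurable_EFinP; exact: mh.
- exact: measurable_cst.
- apply: aeS h0 => t /[swap] Dt /(_ Dt) ht.
  by apply/fine_cvgP; split => //; exact: nearW.
- apply/integrableP; split; first exact/measurable_EFinP.
  have b0 t : D t -> (0 <= b t)%R.
    by move=> Dt; have /andP[h1 h2] := hb 0%N t Dt; exact: le_trans h2.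
  apply: le_lt_trans bfin; apply: ge0_ae_le_integral_nomeas => [t _|t Dt|].
  - exact: abse_ge0.
  - by rewrite lee_fin b0.
  by apply: aeW => t Dt; rewrite /= lee_fin ger0_norm // b0.
- apply: aeW => t n Dt /=; have /andP[h1 h2] := hb n t Dt.
  by rewrite lee_fin ger0_norm.
by rewrite integral0.
Qed.

Lemma cvg0_le2 (I J K : nat -> \bar R) : (forall n, 0 <= I n) ->
  (forall n, I n <= J n + K n) -> J @ \oo --> 0 -> K @ \oo --> 0 -> I @ \oo --> 0.
Proof.
move=> I0 IJK J0 K0; apply: (@squeeze_cvge _ _ _ _ (cst 0) _ (fun n => J n + K n)).
- by apply: nearW => n; rewrite I0 IJK.
- exact: cvg_cst.
- by rewrite -[X in _ --> X]adde0; apply: cvgeD.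
Qed.

Lemma int_nrm_ae (E : normedModType R[i]) D (f g : R -> E) :
  {ae mu, forall t, D t -> f t = g t} ->
  \int[mu]_(t in D) (nrm (f t))%:E = \int[mu]_(t in D) (nrm (g t))%:E.
Proof.
move=> fg; apply: ge0_ae_eq_integral_nomeas => [t _|t _|].
- by rewrite lee_fin nrm_ge0.
- by rewrite lee_fin nrm_ge0.
by apply: aeS fg => t fg /fg ->.
Qed.

Section Spaces.
Context {E1 E2 E3 : normedModType R[i]}.

Lemma int_nrm_ge0 D (f : R -> E1) : 0 <= \int[mu]_(t in D) (nrm (f t))%:E.
Proof. by apply: integral_ge0 => t _; rewrite lee_fin nrm_ge0. Qed.

Lemma int_nrm_le D (f : R -> E1) (g : R -> E2) :
  {ae mu, forall t, D t -> (nrm (f t) <= nrm (g t))%R} ->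
  \int[mu]_(t in D) (nrm (f t))%:E <= \int[mu]_(t in D) (nrm (g t))%:E.
Proof.
by move=> fg; apply: ge0_ae_le_integral_nomeas => [t _|t _|];
  rewrite ?lee_fin ?nrm_ge0 //; apply: aeS fg => t + /= => fg /fg; rewrite lee_fin.
Qed.

(** Additivity of the integral requires measurable integrands: [g] and [h] are replaced by
    everywhere limits, while nothing is asked of [f]. *)
Lemma int_nrm_le2 D (f : R -> E1) (g : R -> E2) (h : R -> E3) : measurable D ->
  strongly_measurable D g -> strongly_measurable D h ->
  {ae mu, forall t, D t -> (nrm (f t) <= nrm (g t) + nrm (h t))%R} ->
  \int[mu]_(t in D) (nrm (f t))%:E <=
  \int[mu]_(t in D) (nrm (g t))%:E + \int[mu]_(t in D) (nrm (h t))%:E.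
Proof.
move=> mD /(sm_simple_limit mD)[g' g'l gg'] /(sm_simple_limit mD)[h' h'l hh'] fgh.
have := simple_limit_nrm g'l; have := simple_limit_nrm h'l => mh' mg'.
rewrite (int_nrm_ae gg') (int_nrm_ae hh').
rewrite -ge0_integralD //.
- apply: ge0_ae_le_integral_nomeas.
  + by move=> t _; rewrite lee_fin nrm_ge0.
  + by move=> t _; rewrite adde_ge0 // lee_fin nrm_ge0.
  apply: aeS3 fgh gg' hh' => t h1 h2 h3 Dt.
  by rewrite -EFinD lee_fin -(h2 Dt) -(h3 Dt) h1.
- by move=> t _; rewrite lee_fin nrm_ge0.
- by apply/measurable_EFinP/measurable_funTS.
- by move=> t _; rewrite lee_fin nrm_ge0.
- by apply/measurable_EFinP/measurable_funTS.
Qed.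

Lemma int_nrmZ D (c : R) (f : R -> E1) : measurable D -> (0 <= c)%R ->
  strongly_measurable D f ->
  \int[mu]_(t in D) (c * nrm (f t))%:E = c%:E * \int[mu]_(t in D) (nrm (f t))%:E.
Proof.
move=> mD c0 /(sm_simple_limit mD)[f' f'l ff'].
have := simple_limit_nrm f'l => mf'.
rewrite (int_nrm_ae ff').
have -> : \int[mu]_(t in D) (c * nrm (f t))%:E = \int[mu]_(t in D) (c%:E * (nrm (f' t))%:E).
  apply: ge0_ae_eq_integral_nomeas => [t _|t _|].
  - by rewrite lee_fin mulr_ge0 ?nrm_ge0.
  - by rewrite -EFinM lee_fin mulr_ge0 ?nrm_ge0.
  by apply: aeS ff' => t gg' /gg' ->.
rewrite ge0_integralZl //.
- by apply/measurable_EFinP/measurable_funTS.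
- by move=> t _; rewrite lee_fin nrm_ge0.
Qed.
End Spaces.

Lemma int_nrm_leZ (E1 E2 : normedModType R[i]) D (c : R) (f : R -> E1) (g : R -> E2) :
  measurable D -> (0 <= c)%R -> strongly_measurable D g ->
  {ae mu, forall t, D t -> (nrm (f t) <= c * nrm (g t))%R} ->
  \int[mu]_(t in D) (nrm (f t))%:E <= c%:E * \int[mu]_(t in D) (nrm (g t))%:E.
Proof.
move=> mD c0 sg fg; rewrite -int_nrmZ //.
apply: ge0_ae_le_integral_nomeas => [t _|t _|].
- by rewrite lee_fin nrm_ge0.
- by rewrite lee_fin mulr_ge0 ?nrm_ge0.
by apply: aeS fg => t fg /fg; rewrite lee_fin.
Qed.
End IntegralNorm.

Section BochnerTheory.
Context {R : realType}.
Local Notation mu := (@lebesgue_measure R).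
Variables (D : set R) (mD : measurable D) (Dfin : (mu D < +oo)%E).
Local Notation I f := (\int[mu]_(t in D) (nrm (f t))%:E)%E.

Section OneSpace.
Context {E : normedModType R[i]}.
Implicit Types (f g : R -> E) (v w : E).

Lemma sm_sf (s : @simple_fun R E) : strongly_measurable D (sf_eval s).
Proof. exact/simple_limit_sm/simple_limit_sf. Qed.

Lemma int_sf_lty (s : @simple_fun R E) : (I (sf_eval s) < +oo)%E.
Proof.
pose M := \sum_(i < sf_size s) nrm (@sf_val _ _ s i).
apply: (@le_lt_trans _ _ (\int[mu]_(t in D) M%:E)%E).
  apply: ge0_ae_le_integral_nomeas => [t _|t _|].
  - by rewrite lee_fin nrm_ge0.
  - by rewrite lee_fin sumr_ge0 // => i _; exact: nrm_ge0.
  apply: aeW => t _; rewrite lee_fin /sf_eval /M.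
  elim/big_ind2: _ => [|a b c d ab cd|i _]; first by rewrite nrm0.
    by rewrite (le_trans (nrmD _ _)) // lerD.
  rewrite scale_indic; case: ifP => // _; by rewrite nrm0 nrm_ge0.
rewrite integral_cst //= lte_mul_pinfty // lee_fin sumr_ge0 // => i _.
exact: nrm_ge0.
Qed.

Lemma bochner_sm f v : bochner_integral D f v -> strongly_measurable D f.
Proof. by move=> [s [sf _ _]]; exists s. Qed.

(** One approximant at finite distance suffices, since a simple function is integrable on a set of
    finite measure. *)
Lemma bochner_lty f v : bochner_integral D f v -> (I f < +oo)%E.
Proof.
move=> bf; have sf := bochner_sm bf; move: bf => [s [_ If _]].
have /fine_cvgP[[N _ hN] _] := If.
have := hN N (leqnn N); rewrite ge0_fin_numE ?int_nrm_ge0 //= => hN'.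
apply: (@le_lt_trans _ _ (I (fun t => f t - sf_eval (s N) t) + I (sf_eval (s N)))%E).
  apply: int_nrm_le2 => //; first by apply: smB => //; exact: sm_sf.
    exact: sm_sf.
  by apply: aeW => t _; rewrite -[X in nrm X](subrK (sf_eval (s N) t)) nrmD.
by rewrite lte_add_pinfty // int_sf_lty.
Qed.

Lemma bochner_norm f v : bochner_integral D f v -> ((nrm v)%:E <= I f)%E.
Proof.
move=> bf; have sf := bochner_sm bf; have ff := bochner_lty bf.
move: bf => [s [_ If sv]].
have fnum : I f \is a fin_num by rewrite ge0_fin_numE ?int_nrm_ge0.
rewrite -(fineK fnum) lee_fin.
have /fine_cvgP[nearfin If'] := If.
have key : \forall n \near \oo, nrm (sf_integral D (s n)) <=
    fine (I (fun t => f t - sf_eval (s n) t)) + fine (I f).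
  near=> n; rewrite -lee_fin EFinD !fineK //; last by near: n.
  apply: le_trans (nrm_sf_integral_le _ mD Dfin) _.
  apply: int_nrm_le2 => //; first by apply: smB => //; exact: sm_sf.
  apply: aeW => t _; rewrite nrm_distC.
  by rewrite -[X in nrm X <= _](subrK (f t)) nrmD.
have If'' : fine (I (fun t => f t - sf_eval (s n) t)) + fine (I f) @[n --> \oo]
    --> fine (I f).
  by rewrite -[X in _ --> X]add0r; apply: cvgD => //; exact: cvg_cst.
apply: (ler_cvg_to (cvg_nrm sv) If'' key).
Unshelve. all: end_near. Qed.

Lemma bochner_ae f g v : {ae mu, forall t, D t -> f t = g t} ->
  bochner_integral D f v -> bochner_integral D g v.
Proof.
move=> fg [s [sf If sv]]; exists s; split => //.
  by rewrite /ae_limit in sf *; apply: aeS2 fg sf => t + + Dt => /(_ Dt) <- /(_ Dt).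
suff -> : (fun n => I (fun t => g t - sf_eval (s n) t)) =
    (fun n => I (fun t => f t - sf_eval (s n) t)) by [].
by apply/funext => n; apply: int_nrm_ae; apply: aeS fg => t fg /fg ->.
Qed.

Lemma bochnerD f g v w : bochner_integral D f v -> bochner_integral D g w ->
  bochner_integral D (fun t => f t + g t) (v + w).
Proof.
move=> bf bg; have sf := bochner_sm bf; have sg := bochner_sm bg.
move: bf bg => [s [sfs If sv]] [s' [sgs Ig sw]].
exists (fun n => sf_add (s n) (s' n)); split.
- rewrite /ae_limit in sfs sgs *; apply: aeS2 sfs sgs => t h1 h2 Dt.
  by under eq_fun do rewrite sf_addE; apply: cvgD; [exact: h1|exact: h2].
- apply: cvg0_le2 If Ig => n; first exact: int_nrm_ge0.
  apply: int_nrm_le2 => //; try by apply: smB => //; exact: sm_sf.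
  by apply: aeW => t _; rewrite sf_addE opprD addrACA nrmD.
- by under eq_fun do rewrite sf_add_integral; exact: cvgD.
Qed.

(* The witness truncates s n to the set where |s n| <= 2 |f|, which provides an
   integrable bound. *)
Lemma bochner_exists_aux f : (I f < +oo)%E -> simple_limit f ->
  exists s : nat -> simple_fun,
    (forall t, sf_eval (s n) t @[n --> \oo] --> f t) /\
    (I (fun t => f t - sf_eval (s n) t) @[n --> \oo] --> 0%E)%E.
Proof.
move=> ff fl; have [s sf] := fl.
pose A n := [set t | nrm (sf_eval (s n) t) <= 2 * nrm (f t)].
have mf := simple_limit_nrm fl.
have mA n : measurable (A n).
  have -> : A n = setT `&` (fun t => 2 * nrm (f t) - nrm (sf_eval (s n) t)) @^-1`
      `[0, +oo[%classic.
    by apply/seteqP; split => t; rewrite setTI /A /= in_itv /= andbT subr_ge0.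
  suff : measurable_fun setT (fun t => 2 * nrm (f t) - nrm (sf_eval (s n) t)).
    by move=> mfs; apply: mfs => //; exact: measurable_itv.
  apply: measurable_funB; last exact: measurable_nrm_sf.
  exact: measurable_funM.
have s's n t : sf_eval (sf_restr (s n) (mA n)) t =
    if nrm (sf_eval (s n) t) <= 2 * nrm (f t) then sf_eval (s n) t else 0.
  rewrite sf_restrE scale_indic; congr (if _ then _ else _).
  by apply/idP/idP; rewrite inE.
have s'f t : sf_eval (sf_restr (s n) (mA n)) t @[n --> \oo] --> f t.
  (* Where [f] vanishes, so does the truncated approximant. Elsewhere the truncation is eventually
     inactive, since |s - f| < |f| implies |s| <= 2 |f|. *)
  have [f0|f0] := eqVneq (nrm (f t)) 0.
    apply: (@nrm_squeeze _ _ _ _ _ _ _ (cst 0)); last exact: cvg_cst.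
    apply: nearW => n; rewrite (nrm_eq0 f0) subr0 s's; case: ifP; rewrite ?nrm0 //.
    by rewrite f0 mulr0.
  have fp : 0 < nrm (f t) by rewrite lt0r f0 nrm_ge0.
  apply/nrm_cvgP => e e0.
  have /nrm_cvgP sft := sf t.
  apply: filterS2 (sft e e0) (sft _ fp) => n h1 h2; rewrite s's ifT //.
  by have := nrm_tri (f t) (sf_eval (s n) t) 0; rewrite !subr0; lra.
exists (fun n => sf_restr (s n) (mA n)); split => //.
apply: (@dominated_cvg0 _ _ _ (fun t => 3 * nrm (f t))) => //.
- move=> n; apply: measurable_funTS; apply: simple_limit_nrm.
  by apply: simple_limitB => //; exact: simple_limit_sf.
- by apply: measurable_funTS; exact: measurable_funM.
- apply: aeW => t _; have /nrm_cvg0P := s'f t.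
  by under eq_fun do rewrite nrm_distC.
- move=> n t _; rewrite nrm_ge0 /=; apply: le_trans (nrmB _ _) _.
  rewrite s's; case: ifPn => [|_]; first lra.
  by rewrite nrm0; have := nrm_ge0 (f t); lra.
rewrite int_nrmZ //; last exact: simple_limit_sm.
by rewrite lte_mul_pinfty.
Qed.
End OneSpace.

Lemma bochnerN (E : normedModType R[i]) (f : R -> E) v :
  bochner_integral D f v -> bochner_integral D (fun t => - f t) (- v).
Proof.
move=> [s [sf If sv]]; exists (fun n => sf_opp (s n)); split.
- rewrite /ae_limit in sf *; apply: aeS sf => t h Dt.
  by under eq_fun do rewrite sf_oppE; apply: cvgN; exact: h.
- under eq_fun => n do under eq_integral => t _ do rewrite sf_oppE -opprD nrmN.
  exact: If.
- by under eq_fun do rewrite sf_opp_integral; exact: cvgN.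
Qed.

Lemma bochnerB (E : normedModType R[i]) (f g : R -> E) v w :
  bochner_integral D f v -> bochner_integral D g w ->
  bochner_integral D (fun t => f t - g t) (v - w).
Proof. by move=> bf /bochnerN; exact: bochnerD. Qed.

Lemma bochner_uniq (E : normedModType R[i]) (f : R -> E) v w :
  bochner_integral D f v -> bochner_integral D f w -> v = w.
Proof.
move=> bv bw; have /bochner_norm := bochnerB bv bw.
under eq_integral do rewrite subrr nrm0.
rewrite integral0 lee_fin => h; apply/subr0_eq/nrm_eq0/eqP.
by rewrite eq_le h nrm_ge0.
Qed.

(** Completeness enters here: the integrals of the approximants are Cauchy, by [nrm_sf_integral_le]
    applied to the differences s n - s m. *)
Lemma bochner_exists (E : completeNormedModType R[i]) (f : R -> E) :
  strongly_measurable D f -> (I f < +oo)%E -> exists v, bochner_integral D f v.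
Proof.
move=> /(sm_simple_limit mD)[g gl fg] ff.
have If := int_nrm_ae fg.
rewrite If in ff; have [s [sg Ig]] := bochner_exists_aux ff gl.
have /fine_cvgP[[N _ hN] /cvgr0Pnorm_lt Ig'] := Ig.
have [v sv] : exists v : E, sf_integral D (s n) @[n --> \oo] --> v.
  apply: nrm_cauchy_cvg => e e0.
  have [M _ hM] := Ig' (e / 2) ltac:(by rewrite divr_gt0).
  exists (maxn N M) => n m; rewrite !geq_max => /andP[Nn Mn] /andP[Nm Mm].
  have -> : sf_integral D (s n) - sf_integral D (s m) =
      sf_integral D (sf_add (s n) (sf_opp (s m))).
    by rewrite sf_add_integral sf_opp_integral.
  have : ((nrm (sf_integral D (sf_add (s n) (sf_opp (s m)))))%:E <=
      I (fun t => g t - sf_eval (s n) t) + I (fun t => g t - sf_eval (s m) t))%E.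
    apply: le_trans (nrm_sf_integral_le _ mD Dfin) _.
    have sgg : strongly_measurable D g by exact: simple_limit_sm.
    apply: int_nrm_le2 => //; try by apply: smB => //; exact: sm_sf.
    apply: aeW => t _; rewrite sf_addE sf_oppE [nrm (g t - sf_eval (s n) t)]nrm_distC.
    exact: nrm_tri.
  rewrite -(fineK (hN n Nn)) -(fineK (hN m Nm)) -EFinD lee_fin.
  have := hM n Mn; have := hM m Mm.
  rewrite /= !ger0_norm ?fine_ge0 ?int_nrm_ge0 //; lra.
exists v; apply: (@bochner_ae _ g); first by apply: aeS fg => t fg /fg ->.
exists s; split => //.
by rewrite /ae_limit; apply: aeW => t _; exact: sg.
Qed.

Lemma bochner_map (E E' : normedModType R[i]) (L : {linear E -> E'}) (f : R -> E) v :
  bounded_op L -> bochner_integral D f v ->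
  bochner_integral D (fun t => L (f t)) (L v).
Proof.
move=> bL bf; have sf := bochner_sm bf; move: bf => [s [sfs If sv]].
exists (fun n => sf_map L (s n)); split.
- rewrite /ae_limit in sfs *; apply: aeS sfs => t h Dt.
  by under eq_fun do rewrite sf_mapE; apply: bounded_op_cvg => //; exact: h.
- have [M hM] := bL.
  apply: (@squeeze_cvge _ _ _ _ (cst 0%E) _
    (fun n => `|M|%:E * I (fun t => f t - sf_eval (s n) t))%E).
  + apply: nearW => n; rewrite int_nrm_ge0 /=.
    apply: int_nrm_leZ => //; first by apply: smB => //; exact: sm_sf.
    apply: aeW => t _; rewrite sf_mapE -linearB (le_trans (hM _)) //.
    by rewrite ler_wpM2r ?nrm_ge0 // ler_norm.
  + exact: cvg_cst.
  + by rewrite -[X in _ --> X](mule0 `|M|%:E); apply: cvgeZl.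
- by under eq_fun do rewrite sf_map_integral; exact: bounded_op_cvg.
Qed.
End BochnerTheory.

Section BochnerDomain.
Context {R : realType}.
Local Notation mu := (@lebesgue_measure R).
Variables (D D' : set R) (mD : measurable D) (mD' : measurable D').
Hypothesis DD' : D `<=` D'.

Lemma sf_restr_integral (E : normedModType R[i]) (s : @simple_fun R E) :
  sf_integral D' (sf_restr s mD) = sf_integral D s.
Proof.
apply: eq_bigr => i _ /=; congr ((fine (mu _))%:C *: _).
apply/seteqP; split=> t; first by case=> -[].
by move=> [At Dt]; split; [split|exact: DD'].
Qed.

Lemma bochner_extend (E : normedModType R[i]) (f : R -> E) v :
  {ae mu, forall t, D' t -> ~ D t -> f t = 0} ->
  bochner_integral D f v -> bochner_integral D' f v.
Proof.
move=> f0 [s [sf If sv]]; exists (fun n => sf_restr (s n) mD); split.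
- rewrite /ae_limit in sf *; apply: aeS2 sf f0 => t h h' D't.
  under eq_fun do rewrite sf_restrE scale_indic.
  have [|] := boolP (t \in D); rewrite ?notin_setE ?inE => Dt; first exact: h.
  by rewrite h' //; apply: cvg_cst.
- suff -> : (fun n => \int[mu]_(t in D') (nrm (f t - sf_eval (sf_restr (s n) mD) t))%:E)%E =
    (fun n => \int[mu]_(t in D) (nrm (f t - sf_eval (s n) t))%:E)%E by [].
  apply/funext => n; rewrite -[in RHS](setIidr DD') integral_mkcondr.
  apply: ge0_ae_eq_integral_nomeas => [t _|t _|].
  + by rewrite lee_fin nrm_ge0.
  + by rewrite /patch; case: ifP => // _; rewrite lee_fin nrm_ge0.
  apply: aeS f0 => t h D't; rewrite /patch sf_restrE scale_indic.
  case: ifPn => //; rewrite notin_setE => Dt.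
  by rewrite h // subr0 nrm0.
- by under eq_fun do rewrite sf_restr_integral.
Qed.

End BochnerDomain.

(** * Almost everywhere limits and strongly continuous families of operators *)

Section Limits.
Context {R : realType}.
Local Notation mu := (@lebesgue_measure R).

Lemma ae_cvg0_of_int (D : set R) (psi : nat -> R -> R) (C : R) : measurable D ->
  (forall n, measurable_fun setT (psi n)) -> (forall n t, 0 <= psi n t) ->
  (forall n, (\int[mu]_(t in D) (psi n t)%:E <= (C * 2^-1 ^+ n)%:E)%E) ->
  {ae mu, forall t, D t -> psi n t @[n --> \oo] --> 0}.
Proof.
move=> mD mpsi psi0 Ipsi.
have C0 : 0 <= C.
  have := Ipsi 0%N; rewrite expr0 mulr1 -lee_fin; apply: le_trans.
  by apply: integral_ge0 => t _; rewrite lee_fin.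
pose S t := (\sum_(0 <= n <oo) (psi n t)%:E)%E.
have mS : measurable_fun D S.
  apply: (@ge0_emeasurable_sum _ _ _ _ (fun n t => (psi n t)%:E) xpredT).
    by move=> k t _ _; rewrite lee_fin.
  by move=> k _; apply/measurable_EFinP; exact: measurable_funTS.
have S0 t : (0 <= S t)%E by apply: nneseries_ge0 => n _ _; rewrite lee_fin.
have iS : mu.-integrable D S.
  apply/integrableP; split => //.
  apply: (@le_lt_trans _ _ (C * 2)%:E); last by rewrite ltry.
  apply: (@le_trans _ _ (\int[mu]_(t in D) S t)%E).
    by apply: ge0_ae_le_integral_nomeas => [t _|t _|] //; apply: aeW => t _; rewrite gee0_abs.
  rewrite integral_nneseries //; last 2 first.
  - move=> n; apply/measurable_EFinP; apply: (measurable_funTS (D := D)).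
    exact: mpsi.
  - by move=> n t _; rewrite lee_fin.
  apply: lime_le.
    by apply: is_cvg_nneseries => n _ _; apply: integral_ge0 => t _; rewrite lee_fin.
  apply: nearW => n.
  apply: (@le_trans _ _ (\sum_(0 <= k < n) (C * 2^-1 ^+ k)%:E)%E); first exact: lee_sum.
  rewrite sumEFin lee_fin -mulr_sumr ler_wpM2l //.
  suff -> : \sum_(0 <= i < n) 2^-1 ^+ i = 2 - 2 * 2^-1 ^+ n :> R.
    by rewrite gerBl mulr_ge0 // exprn_ge0.
  elim: n => [|n IH]; first by rewrite big_geq // expr0 mulr1 subrr.
  by rewrite big_nat_recr //= IH exprS; field.
have Sae : {ae mu, forall t, D t -> S t \is a fin_num} :=
  @integrable_ae _ _ _ mu D mD S iS.
apply: aeS Sae => t h Dt.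
have Sfin : (S t < +oo)%E by rewrite -ge0_fin_numE // h.
have psiE0 k : xpredT k -> (0 <= (psi k t)%:E)%E by move=> _; rewrite lee_fin.
have tail0 := nneseries_tail_cvg Sfin psiE0.
have : (fun n => (psi n t)%:E) @ \oo --> 0%E.
  apply: (squeeze_cvge _ (cvg_cst 0%E) tail0); apply: nearW => n.
  rewrite lee_fin psi0 /=.
  have := @nneseries_lim_ge _ (fun k => (psi k t)%:E) xpredT n n.+1.
  rewrite big_nat1; apply => k _ _; by rewrite lee_fin.
by move=> /fine_cvgP[].
Qed.

(* Simple functions close in measure to f_ n: the minimum with 1 makes the
   distances integrable, and a summable rate turns this into a.e. convergence. *)
Lemma sm_limit (E : normedModType R[i]) (D : set R) (f_ : nat -> R -> E) f :
  measurable D -> (mu D < +oo)%E -> (forall n, strongly_measurable D (f_ n)) ->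
  {ae mu, forall t, D t -> f_ n t @[n --> \oo] --> f t} ->
  strongly_measurable D f.
Proof.
move=> mD Dfin sf ff.
have /choice[g /all_and2[gl gf]] : forall n, exists g : R -> E, simple_limit g /\
    {ae mu, forall t, D t -> f_ n t = g t}.
  by move=> n; have [g gl gf] := sm_simple_limit mD (sf n); exists g.
have [s sg] := choice gl.
pose phi n m t := Num.min 1 (nrm (g n t - sf_eval (s n m) t)).
have mphi n m : measurable_fun setT (phi n m).
  apply: measurable_minr => //.
  by apply: simple_limit_nrm; apply: simple_limitB => //; exact: simple_limit_sf.
have phi0 n m t : 0 <= phi n m t by rewrite /phi le_min ler01 nrm_ge0.
have /choice[m Im] : forall n, exists m,
    (\int[mu]_(t in D) (phi n m t)%:E <= (1 * 2^-1 ^+ n)%:E)%E.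
  move=> n.
  have : (\int[mu]_(t in D) (phi n m t)%:E @[m --> \oo] --> 0)%E.
    apply: (@dominated_cvg0 _ _ _ (cst 1)) => //.
    - by move=> m; exact: measurable_funTS.
    - apply: aeW => t _.
      have /nrm_cvg0P := sg n t; under eq_fun do rewrite nrm_distC.
      apply: (squeeze_cvgr _ (cvg_cst 0)).
      by apply: nearW => m; rewrite phi0 /= /phi ge_min lexx orbT.
    - by move=> m t _; rewrite phi0 /= /phi ge_min lexx.
    by rewrite [ltLHS](integral_cst mu mD 1) mul1e.
  move=> /fine_cvgP[[N _ hN]] /cvgr0Pnorm_lt/(_ (2^-1 ^+ n)).
  rewrite exprn_gt0 // => /(_ isT)[M _ hM]; exists (maxn N M).
  have h1 := hN (maxn N M) (leq_maxl _ _); have h2 := hM (maxn N M) (leq_maxr _ _).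
  rewrite -(fineK h1) lee_fin mul1r ltW // (le_lt_trans (ler_norm _)) //.
have phicvg := ae_cvg0_of_int mD (fun n => mphi n (m n)) (fun n => phi0 n (m n)) Im.
exists (fun n => s n (m n)); rewrite /ae_limit.
apply: aeS3 phicvg ff (ae_nat gf) => t h1 h2 h3 Dt.
have gt : g n t @[n --> \oo] --> f t.
  by have := h2 Dt; under eq_fun => n do rewrite h3 //.
have d0 : nrm (sf_eval (s n (m n)) t - g n t) @[n --> \oo] --> 0.
  apply/cvgr0Pnorm_lt => e e0.
  have /cvgr0Pnorm_lt/(_ (Num.min 1 e)) := h1 Dt; rewrite lt_min ltr01 e0 => /(_ isT).
  apply: filterS => n; rewrite !ger0_norm ?nrm_ge0 // /phi nrm_distC.
  by rewrite lt_min !gt_min ltxx /= => /andP[h /orP[/(lt_trans h)|]].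
apply: (@nrm_squeeze _ _ _ _ _ _ _ (fun n => nrm (sf_eval (s n (m n)) t - g n t) + nrm (g n t - f t))).
  by apply: nearW => n; exact: nrm_tri.
by rewrite -[X in _ --> X]addr0; apply: cvgD => //; exact/nrm_cvg0P.
Qed.

(** Freezing [G] at the midpoints of n + 1 equal cells turns the n-th approximant of [f] into a
    simple function; local boundedness and strong continuity of [G] give convergence. This covers
    the weights t^a, the operators [Tk (t - s)] and the family [F (x s)]. The interval is open
    because a weight may be singular at 0. *)
Lemma sm_family (E E' : normedModType R[i]) (G : R -> {linear E -> E'}) (a b : R)
    (f : R -> E) :
  (forall s, a < s < b -> exists d M : R, 0 < d /\
     forall s', a < s' < b -> `|s' - s| < d -> forall e, nrm (G s' e) <= M * nrm e) ->
  (forall s e (eps : R), a < s < b -> 0 < eps -> exists2 d : R, 0 < d &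
     forall s', a < s' < b -> `|s' - s| < d -> nrm (G s' e - G s e) < eps) ->
  strongly_measurable `]a, b[ f -> strongly_measurable `]a, b[ (fun s => G s (f s)).
Proof.
move=> Gb Gc [s sf].
have [ab|ba] := ltP a b; last first.
  exists (fun=> sf_zero); rewrite /ae_limit; apply: aeW => t /=.
  by rewrite in_itv /= => /andP[/lt_trans h /h]; rewrite ltNge ba.
pose l n : R := (b - a) / n.+1%:R.
have l0 n : 0 < l n by rewrite divr_gt0 ?subr_gt0 // ltr0n.
(* Midpoints stay strictly inside []a, b[], where alone [G] is controlled. The cells are half-open,
   so exactly one term of [h n] survives at each point. *)
pose c n k : R := a + (k%:R + 2^-1) * l n.
pose J n k : set R := `[a + k%:R * l n, a + k.+1%:R * l n[%classic.
have mJ n k : measurable (J n k) by exact: measurable_itv.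
pose h n := \big[sf_add/sf_zero]_(k < n.+1) sf_restr (sf_map (G (c n k)) (s n)) (mJ n k).
have hE n t : sf_eval (h n) t = \sum_(k < n.+1) (\1_(J n k) t : R)%:C *: G (c n k) (sf_eval (s n) t).
  rewrite /h (big_morph (fun s => sf_eval s t) (fun s s' => sf_addE s s' t) (sf_zeroE t)).
  by apply: eq_bigr => k _; rewrite sf_restrE sf_mapE.
have hval n t : a < t < b -> exists2 u, (a < u < b) /\ `|u - t| <= l n &
    sf_eval (h n) t = G u (sf_eval (s n) t).
  move=> /andP[a_t tb].
  have q0 : 0 <= (t - a) / l n by rewrite divr_ge0 ?subr_ge0 // ltW.
  set q := (t - a) / l n in q0.
  have tq : t = a + q * l n by rewrite /q divfK ?gt_eqF // addrC subrK.
  have /andP[kq qk] := truncn_itv q0.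
  set k := Num.truncn q in kq qk.
  have kn : (k < n.+1)%N.
    rewrite -(ltr_nat R) (le_lt_trans kq) // /q ltr_pdivrMr // /l mulrC divfK ?pnatr_eq0 //.
    by rewrite ltrD2r.
  exists (c n k).
    have bE : b = a + n.+1%:R * l n by rewrite /l mulrC divfK ?pnatr_eq0 // addrC subrK.
    have kn' : k%:R + 1 <= n.+1%:R :> R by rewrite natr1 ler_nat.
    split; first apply/andP; first split.
    - by rewrite /c ltrDl mulr_gt0 // ltr_wpDl.
    - rewrite bE /c ltrD2l ltr_pM2r //; lra.
    rewrite /c {1}tq opprD addrACA subrr add0r -mulrBl normrM (gtr0_norm (l0 n)).
    rewrite ger_pMl // ler_norml; rewrite -natr1 in qk; lra.
  rewrite hE (bigD1 (Ordinal kn)) //= big1 ?addr0.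
    rewrite scale_indic ifT // inE /J /= in_itv /= {1 2}tq lerD2l ltrD2l.
    by rewrite ler_pM2r // ltr_pM2r // kq.
  move=> i ik; rewrite scale_indic ifN // notin_setE /J /= in_itv /= {1 2}tq lerD2l ltrD2l.
  rewrite ler_pM2r // ltr_pM2r // => /andP[i1 i2].
  move/negP: ik; apply; apply/eqP/val_inj => /=; apply/eqP.
  by rewrite eq_sym /k truncn_eq // i1.
exists h; rewrite /ae_limit in sf *; apply: aeS sf => t sft.
rewrite /= in_itv /= => tab.
have {}sft : sf_eval (s n) t @[n --> \oo] --> f t by apply: sft; rewrite /= in_itv.
apply/nrm_cvgP => e e0.
have [d [M [d0 GM]]] := Gb t tab.
have e2 : 0 < e / 2 by rewrite divr_gt0.
have [d' d'0 Gd'] := Gc t (f t) (e / 2) tab e2.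
have lcvg : l @ \oo --> 0.
  by rewrite -(mulr0 (b - a)); apply: cvgMr; exact: cvg_harmonic.
have M1 : 0 < `|M| + 1 by rewrite ltr_wpDl.
have e' : 0 < e / 2 / (`|M| + 1) by rewrite !divr_gt0.
have /cvgr0Pnorm_lt/(_ (Num.min d d')) := lcvg; rewrite lt_min d0 d'0 => /(_ isT) near1.
have /nrm_cvgP/(_ _ e') near2 := sft.
apply: filterS2 near1 near2 => n.
rewrite gtr0_norm // lt_min => /andP[ld ld'] sn.
have [u [uab ut] ->] := hval n t tab.
have h1 := GM u uab (le_lt_trans ut ld) (sf_eval (s n) t - f t).
have h2 := Gd' u uab (le_lt_trans ut ld').
have h3 : nrm (G u (sf_eval (s n) t - f t)) < e / 2.
  apply: le_lt_trans h1 _; apply: (@le_lt_trans _ _ ((`|M| + 1) * nrm (sf_eval (s n) t - f t))).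
    by rewrite ler_wpM2r ?nrm_ge0 // (le_trans (ler_norm _)) // lerDl.
  by rewrite mulrC -ltr_pdivlMr.
rewrite linearB in h3.
by have := nrm_tri (G u (f t)) (G u (sf_eval (s n) t)) (G t (f t)); lra.
Qed.
End Limits.

(** * Vector-valued Lp spaces *)

Lemma powR_continuous (R : realType) (a x : R) : 0 < x -> {for x, continuous (fun y : R => y `^ a)}.
Proof.
move=> x0; apply: differentiable_continuous; apply/derivable1_diffP.
by apply: derivable_powR; rewrite in_itv /= x0.
Qed.

Lemma powR_cvg (R : realType) (p : R) (u : nat -> R) l : 1 <= p -> (forall n, 0 <= u n) ->
  u @ \oo --> l -> u n `^ p @[n --> \oo] --> l `^ p.
Proof.
move=> p1 u0 ul.
have p0 : 0 < p by apply: lt_le_trans p1.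
have l0 : 0 <= l by apply: (cvgr_to_ge ul); exact: nearW.
move: l0; rewrite le_eqVlt => /orP[/eqP l0|l0]; last first.
  by apply: (@continuous_cvg _ _ _ \oo _ u (fun y : R => y `^ p) l _ ul); exact: powR_continuous.
rewrite -l0 powR0 ?gt_eqF // in ul *.
apply: (squeeze_cvgr _ (cvg_cst 0) ul).
have /cvgr0Pnorm_lt/(_ _ ltr01) := ul; apply: filterS => n.
rewrite ger0_norm // powR_ge0 /= => u1.
have [->|un0] := eqVneq (u n) 0; first by rewrite powR0 ?gt_eqF.
by rewrite ge1r_powR // lt0r un0 u0 ltW.
Qed.

Section LpSpaces.
Context {R : realType}.
Local Notation mu := (@lebesgue_measure R).
Variables (p : R) (p1 : 1 <= p).
Let p0 : 0 < p. Proof. exact: lt_le_trans p1. Qed.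
Let pn0 : p != 0. Proof. by rewrite gt_eqF. Qed.
Let pV0 : 0 <= p^-1. Proof. by rewrite invr_ge0 ltW. Qed.
Implicit Types D : set R.

Lemma Lp_normE (E : normedModType R[i]) D (f : R -> E) :
  Lp_norm p%:E D f = ((\int[mu]_(t in D) (nrm (f t) `^ p)%:E) `^ p^-1)%E.
Proof.
rewrite /Lp_norm unlock; congr (_ `^ _)%E; rewrite [RHS]integral_mkcond.
apply: eq_integral => t _; rewrite /patch; case: ifP => _.
  by rewrite /= ger0_norm ?nrm_ge0.
by rewrite abse0 poweR0r.
Qed.

Lemma int_powR_ge0 (E : normedModType R[i]) D (f : R -> E) :
  (0 <= \int[mu]_(t in D) (nrm (f t) `^ p)%:E)%E.
Proof. by apply: integral_ge0 => t _; rewrite lee_fin powR_ge0. Qed.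

Lemma Lp_norm_ge0 (E : normedModType R[i]) D (f : R -> E) : (0 <= Lp_norm p%:E D f)%E.
Proof. by rewrite Lp_normE poweR_ge0. Qed.

Lemma Lp_powR (E : normedModType R[i]) D (f : R -> E) :
  ((Lp_norm p%:E D f) `^ p = \int[mu]_(t in D) (nrm (f t) `^ p)%:E)%E.
Proof. by rewrite Lp_normE -poweRrM mulVf // poweRe1 // int_powR_ge0. Qed.

Lemma le_poweR (x y : \bar R) q : (0 <= q)%R -> (0 <= x)%E -> (x <= y)%E ->
  (x `^ q <= y `^ q)%E.
Proof.
move=> q0 x0 xy; apply: gt0_ler_poweR => //; rewrite in_itv /= ?x0 ?leey //.
by rewrite (le_trans x0 xy).
Qed.

Lemma Lp_norm_le_ae (E E' : normedModType R[i]) D (f : R -> E) (g : R -> E') :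
  {ae mu, forall t, D t -> nrm (f t) <= nrm (g t)} ->
  (Lp_norm p%:E D f <= Lp_norm p%:E D g)%E.
Proof.
move=> fg; rewrite !Lp_normE le_poweR ?int_powR_ge0 //.
apply: ge0_ae_le_integral_nomeas => [t _|t _|]; rewrite ?lee_fin ?powR_ge0 //.
apply: aeS fg => t fg Dt; rewrite lee_fin ge0_ler_powR ?nnegrE ?nrm_ge0 ?(ltW p0) //.
exact: fg.
Qed.

Lemma Lp_norm_ae (E E' : normedModType R[i]) D (f : R -> E) (g : R -> E') :
  {ae mu, forall t, D t -> nrm (f t) = nrm (g t)} ->
  Lp_norm p%:E D f = Lp_norm p%:E D g.
Proof.
move=> fg; apply/eqP; rewrite eq_le; apply/andP; split; apply: Lp_norm_le_ae;
  by apply: aeS fg => t fg /fg ->.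
Qed.

Lemma Lp_norm_dom (E : normedModType R[i]) D D' (f : R -> E) :
  {ae mu, forall t, D t <-> D' t} -> Lp_norm p%:E D f = Lp_norm p%:E D' f.
Proof.
move=> DD'; rewrite !Lp_normE; congr (_ `^ _)%E.
rewrite integral_mkcond [RHS]integral_mkcond.
apply: ge0_ae_eq_integral_nomeas => [t _|t _|].
- by rewrite /patch; case: ifP => // _; rewrite lee_fin powR_ge0.
- by rewrite /patch; case: ifP => // _; rewrite lee_fin powR_ge0.
apply: aeS DD' => t [h h'] _; rewrite /patch; congr (if _ then _ else _).
by apply/idP/idP; rewrite !inE.
Qed.

Lemma Lp_norm_restr (E : normedModType R[i]) D A (f : R -> E) :
  Lp_norm p%:E (D `&` A) f = Lp_norm p%:E D (fun t => (\1_A t : R)%:C *: f t).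
Proof.
rewrite !Lp_normE integral_mkcondr; congr (_ `^ _)%E.
apply: eq_integral => t _; rewrite /patch scale_indic; case: ifP => // _.
by rewrite nrm0 powR0.
Qed.

Lemma Lp_normZ (E : normedModType R[i]) D (f : R -> E) c : measurable D ->
  0 <= c -> strongly_measurable D f ->
  Lp_norm p%:E D (fun t => c%:C *: f t) = (c%:E * Lp_norm p%:E D f)%E.
Proof.
move=> mD c0 /(sm_simple_limit mD)[g gl fg].
have mg := simple_limit_nrm gl.
rewrite (@Lp_norm_ae _ _ _ _ (fun t => c%:C *: g t)); last first.
  by apply: aeS fg => t fg /fg ->.
rewrite (@Lp_norm_ae _ _ _ f g); last by apply: aeS fg => t fg /fg ->.
rewrite !Lp_normE.
have mgp : measurable_fun D (fun t => nrm (g t) `^ p).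
  apply: (measurable_funTS (D := D)).
  exact: (measurableT_comp (measurable_powR p) mg).
under eq_integral => t _ do rewrite nrmZ ger0_norm // powRM ?nrm_ge0 // EFinM.
rewrite ge0_integralZl //.
- rewrite poweRM ?int_powR_ge0 ?lee_fin ?powR_ge0 // -poweR_EFin -poweRrM mulfV //.
  by rewrite poweRe1.
- exact/measurable_EFinP.
- by move=> t _; rewrite lee_fin powR_ge0.
- by rewrite lee_fin powR_ge0.
Qed.

(** Minkowski's inequality for the real functions |g| and |h|, after extension by zero from [D] and
    passage to representatives with measurable norms. *)
Lemma Lp_norm_triangle (E E1 E2 : normedModType R[i]) D (f : R -> E) (g : R -> E1)
    (h : R -> E2) : measurable D ->
  strongly_measurable D g -> strongly_measurable D h ->
  {ae mu, forall t, D t -> nrm (f t) <= nrm (g t) + nrm (h t)} ->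
  (Lp_norm p%:E D f <= Lp_norm p%:E D g + Lp_norm p%:E D h)%E.
Proof.
move=> mD /(sm_simple_limit mD)[g' g'l gg'] /(sm_simple_limit mD)[h' h'l hh'] fgh.
rewrite (@Lp_norm_ae _ _ _ g g'); last by apply: aeS gg' => t e /e ->.
rewrite (@Lp_norm_ae _ _ _ h h'); last by apply: aeS hh' => t e /e ->.
pose G t := nrm ((\1_D t : R)%:C *: g' t); pose H t := nrm ((\1_D t : R)%:C *: h' t).
have mG : measurable_fun setT G by apply: simple_limit_nrm; exact: simple_limit_restr.
have mH : measurable_fun setT H by apply: simple_limit_nrm; exact: simple_limit_restr.
have eqN (E' : normedModType R[i]) (k : R -> E') :
    Lp_norm p%:E D k = ('N[mu]_p%:E [EFin \o (fun t => nrm ((\1_D t : R)%:C *: k t))])%E.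
  rewrite /Lp_norm; congr Lnorm; apply/funext => t /=.
  by rewrite scale_indic /patch; case: ifP; rewrite ?nrm0.
rewrite (eqN _ g') (eqN _ h').
apply: le_trans (minkowski_EFin mu mG mH p1).
rewrite Lp_normE unlock le_poweR ?int_powR_ge0 // [leLHS]integral_mkcond.
apply: ge0_ae_le_integral_nomeas => [t _|t _|].
- by rewrite /patch; case: ifP => // _; rewrite lee_fin powR_ge0.
- by rewrite poweR_ge0.
apply: aeS3 fgh gg' hh' => t h1 h2 h3 _; rewrite /patch /=.
case: ifPn => [|_]; last by rewrite lee_fin powR_ge0.
rewrite inE => Dt; rewrite ?poweR_EFin lee_fin ge0_ler_powR ?nnegrE ?nrm_ge0 ?(ltW p0) //.
rewrite /G /H !scale_indic !mem_set // ger0_norm ?addr_ge0 ?nrm_ge0 //.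
by rewrite -h2 // -h3 // h1.
Qed.

Lemma Lp_norm_le2 (E E1 E2 : normedModType R[i]) D (f : R -> E) (g : R -> E1)
    (h : R -> E2) c d : measurable D -> 0 <= c -> 0 <= d ->
  strongly_measurable D g -> strongly_measurable D h ->
  {ae mu, forall t, D t -> nrm (f t) <= c * nrm (g t) + d * nrm (h t)} ->
  (Lp_norm p%:E D f <= c%:E * Lp_norm p%:E D g + d%:E * Lp_norm p%:E D h)%E.
Proof.
move=> mD c0 d0 sg sh fgh; rewrite -!Lp_normZ //.
have bz (V : normedModType R[i]) (x : R) : bounded_op (GRing.scale x%:C : {linear V -> V}).
  by exists `|x| => v; rewrite nrmZ.
apply: Lp_norm_triangle => //.
- exact: sm_map (bz _ c) sg.
- exact: sm_map (bz _ d) sh.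
by apply: aeS fgh => t h1 Dt; rewrite !nrmZ !ger0_norm // h1.
Qed.

Lemma Lp_norm_eq0 (E : normedModType R[i]) D (f : R -> E) : measurable D ->
  strongly_measurable D f -> Lp_norm p%:E D f = 0%E ->
  {ae mu, forall t, D t -> f t = 0}.
Proof.
move=> mD /(sm_simple_limit mD)[g gl fg].
rewrite (@Lp_norm_ae _ _ _ f g); last by apply: aeS fg => t e /e ->.
rewrite Lp_normE => /poweR_eq0_eq0 => /(_ (int_powR_ge0 _ _)) I0.
have mgp : measurable_fun D (fun t => (nrm (g t) `^ p)%:E).
  apply/measurable_EFinP; apply: (measurable_funTS (D := D)).
  exact: (measurableT_comp (measurable_powR p) (simple_limit_nrm gl)).
have [+ _] := ae_eq_integral_abs mu mD mgp.
rewrite (_ : (\int[mu]_(x in D) `|(nrm (g x) `^ p)%:E|)%E = 0%E); last first.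
  by rewrite -I0; apply: eq_integral => t _; rewrite gee0_abs // lee_fin powR_ge0.
move=> /(_ erefl) g0; apply: aeS2 fg g0 => t fg g0 Dt.
by rewrite fg //; apply: nrm_eq0; have [] := g0 Dt; exact: powR_eq0_eq0.
Qed.

(** Absolute continuity of the norm: dominated convergence under |f|^p. *)
Lemma Lp_norm_small (E : normedModType R[i]) D (f : R -> E) (A : nat -> set R)
    (e : R) : measurable D -> strongly_measurable D f -> 0 < e ->
  (Lp_norm p%:E D f < +oo)%E -> (forall n, measurable (A n)) ->
  {ae mu, forall t, D t -> (\1_(A n) t : R) @[n --> \oo] --> 0} ->
  \forall n \near \oo, (Lp_norm p%:E (D `&` A n) f < e%:E)%E.
Proof.
move=> mD /(sm_simple_limit mD)[g gl fg] e0 fin mA A0.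
have mgp : measurable_fun D (fun t => (nrm (g t) `^ p)).
  apply: (measurable_funTS (D := D)).
  exact: (measurableT_comp (measurable_powR p) (simple_limit_nrm gl)).
pose h n t := (\1_(A n) t : R) * nrm (g t) `^ p.
have Ih : (\int[mu]_(t in D) (h n t)%:E @[n --> \oo] --> 0)%E.
  apply: (@dominated_cvg0 _ _ _ (fun t => nrm (g t) `^ p)) => //.
  - by move=> n; apply: measurable_funM => //; exact: measurable_indic.
  - apply: aeS A0 => t A0 /A0 h0; rewrite -(mul0r (nrm (g t) `^ p)).
    by apply: cvgMl.
  - by move=> n t _; rewrite /h mulr_ge0 ?powR_ge0 //= ler_piMl ?powR_ge0.
  rewrite -Lp_powR (@Lp_norm_ae _ _ _ g f); first exact: poweR_lty.
  by apply: aeS fg => t e' /e' ->.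
have /fine_cvgP[near1 /cvgr0Pnorm_lt/(_ (e `^ p))] := Ih.
rewrite powR_gt0 // => /(_ isT) near2; apply: filterS2 near1 near2 => n h1 h2.
rewrite Lp_norm_restr (@Lp_norm_ae _ _ _ _ (fun t => (\1_(A n) t : R)%:C *: g t)).
  have -> : e%:E = ((e `^ p)%:E `^ p^-1)%E.
    by rewrite poweR_EFin -powRrM mulfV // powRr1 // ltW.
  have Ih0 : (0 <= \int[mu]_(t in D) (h n t)%:E)%E.
    by apply: integral_ge0 => t _; rewrite lee_fin mulr_ge0 ?powR_ge0.
  rewrite Lp_normE.
  have -> : (\int[mu]_(t in D) (nrm ((\1_(A n) t : R)%:C *: g t) `^ p)%:E)%E =
            (\int[mu]_(t in D) (h n t)%:E)%E.
    apply: eq_integral => t _; rewrite /h scale_indic indicE.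
    by case: (t \in A n); rewrite ?mul1r // mul0r nrm0 powR0.
  rewrite -(fineK h1) !poweR_EFin lte_fin gt0_ltr_powR ?invr_gt0 ?nnegrE ?powR_ge0 ?fine_ge0 //.
  by rewrite (le_lt_trans (ler_norm _)).
by apply: aeS fg => t e' /e' ->.
Qed.

(** With the rate 4^-n, even 2^n |f (n+1) - f n| tends to 0 almost everywhere. The increments are
    then eventually below 2^-n, which makes the sequence Cauchy pointwise. Fatou's lemma carries the
    rate over to the limit. *)
Lemma Lp_complete (E : completeNormedModType R[i]) D (f : nat -> R -> E) (C : R) :
  measurable D -> (mu D < +oo)%E -> (forall n, strongly_measurable D (f n)) ->
  (forall n, (Lp_norm p%:E D (fun t => f n.+1 t - f n t)%R <= (C * 4^-1 ^+ n)%:E)%E) ->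
  exists g : R -> E, [/\ strongly_measurable D g,
    {ae mu, forall t, D t -> f n t @[n --> \oo] --> g t} &
    forall n, (Lp_norm p%:E D (fun t => g t - f n t)%R <= (2 * C * 4^-1 ^+ n)%:E)%E].
Proof.
move=> mD Dfin sf fC.
have C0 : 0 <= C.
  by have := fC 0%N; rewrite expr0 mulr1 -lee_fin; apply: le_trans; exact: Lp_norm_ge0.
have /choice[f' /all_and2[f'l ff']] : forall n, exists f' : R -> E, simple_limit f' /\
    {ae mu, forall t, D t -> f n t = f' t}.
  by move=> n; have [g gl gf] := sm_simple_limit mD (sf n); exists g.
have {}ff' := ae_nat ff'.
have mdiff n m : measurable_fun setT (fun t => nrm (f' n t - f' m t)).
  by apply: simple_limit_nrm; apply: simple_limitB.
pose psi n t := (2 ^+ n * nrm (f' n.+1 t - f' n t)) `^ p.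
have mpsi n : measurable_fun setT (psi n).
  by apply: (measurableT_comp (measurable_powR p)); exact: measurable_funM.
have Ipsi n : (\int[mu]_(t in D) (psi n t)%:E <= (C `^ p * 2^-1 ^+ n)%:E)%E.
  have -> : (\int[mu]_(t in D) (psi n t)%:E =
      (Lp_norm p%:E D (fun t => (2 ^+ n)%:C *: (f n.+1 t - f n t))%R) `^ p)%E.
    rewrite Lp_powR; apply: ge0_ae_eq_integral_nomeas => [t _|t _|].
    - by rewrite lee_fin powR_ge0.
    - by rewrite lee_fin powR_ge0.
    apply: aeS ff' => t e Dt; rewrite /psi nrmZ ger0_norm ?exprn_ge0 //.
    by rewrite !(e _ Dt).
  rewrite Lp_normZ ?exprn_ge0 //; last exact: smB.
  apply: (@le_trans _ _ (((2 ^+ n)%:E * (C * 4^-1 ^+ n)%:E) `^ p)%E).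
    apply: le_poweR; rewrite ?(ltW p0) //.
      by rewrite mule_ge0 ?lee_fin ?exprn_ge0 // Lp_norm_ge0.
    by apply: lee_wpmul2l => //; rewrite lee_fin exprn_ge0.
  rewrite -EFinM poweR_EFin lee_fin mulrCA -exprMn.
  rewrite (_ : 2 * 4^-1 = 2^-1 :> R); last by field.
  rewrite powRM ?exprn_ge0 // ler_wpM2l ?powR_ge0 //.
  by rewrite ge1r_powR // exprn_gt0 //= exprn_ile1 // invf_le1 // ler1n.
have psicvg := ae_cvg0_of_int mD mpsi (fun n t => powR_ge0 _ _) Ipsi.
have cvgf' : {ae mu, forall t, D t -> exists l : E, f' n t @[n --> \oo] --> l}.
  apply: aeS psicvg => t h Dt; have /cvgr0Pnorm_lt/(_ _ ltr01)[N _ hN] := h Dt.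
  have step n : (N <= n)%N -> nrm (f' n.+1 t - f' n t) <= 2^-1 ^+ n.
    move=> /hN; rewrite ger0_norm ?powR_ge0 // => lt1.
    rewrite exprVn -[leRHS]mul1r ler_pdivlMr ?exprn_gt0 // mulrC leNgt.
    apply/negP => gt1; move: lt1; rewrite ltNge => /negP; apply.
    exact: le_trans (ltW gt1) (le1r_powR (ltW gt1) p1).
  have tail n m : (N <= n)%N -> (n <= m)%N -> nrm (f' n t - f' m t) <= 2 * 2^-1 ^+ n.
    move=> Nn /subnK <-; suff : nrm (f' n t - f' (m - n + n)%N t) <=
       2 * 2^-1 ^+ n - 2 * 2^-1 ^+ (m - n + n).
      by move/le_trans; apply; rewrite gerBl mulr_ge0 // exprn_ge0.
    elim: (m - n)%N => [|q IH]; first by rewrite add0n !subrr nrm0.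
    have := step (q + n)%N (leq_trans Nn (leq_addl _ _)).
    have := nrm_tri (f' (q + n)%N t) (f' n t) (f' (q.+1 + n)%N t).
    rewrite addSn [nrm (f' (q + n)%N t - _)]nrm_distC exprS; lra.
  have [l hl] : exists l : E, f' (n + N)%N t @[n --> \oo] --> l.
    apply: (@nrm_cauchy_cvg_bound _ _ _ (fun n => 2 * 2^-1 ^+ (n + N))).
      by move=> n m nm; apply: tail; rewrite ?leq_addl // leq_add2r.
    rewrite -(mulr0 2); apply: cvgMr.
    rewrite (cvg_shiftn N (fun n => 2^-1 ^+ n : R)).
    by apply: cvg_expr; rewrite ger0_norm ?invr_ge0 // invf_lt1 // ltr1n.
  by exists l; rewrite -(cvg_shiftn N).
have [g gP] : exists g : R -> E, {ae mu, forall t, D t -> f' n t @[n --> \oo] --> g t}.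
  exists (fun t => xget 0 [set l | f' n t @[n --> \oo] --> l]).
  apply: aeS cvgf' => t h /h[l hl].
  by case: xgetP => [x _ //|/(_ l)]; move/(_ hl).
have fg : {ae mu, forall t, D t -> f n t @[n --> \oo] --> g t}.
  apply: aeS2 gP ff' => t h1 h2 Dt; have := h1 Dt.
  by under eq_fun do rewrite -h2 //.
exists g; split => //; first exact: sm_limit fg.
move=> n.
have bound m : (n <= m)%N ->
    (Lp_norm p%:E D (fun t => f' m t - f' n t)%R <= (2 * C * 4^-1 ^+ n)%:E)%E.
  move=> nm; rewrite (@Lp_norm_ae _ _ _ _ (fun t => f m t - f n t)); last first.
    by apply: aeS ff' => t e Dt; rewrite !e.
  move: nm => /subnK <-.
  (* The difference of two geometric tails is the bound that an induction on the distance of the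
     indices can carry. *)
  apply: (@le_trans _ _ (2 * C * 4^-1 ^+ n - 2 * C * 4^-1 ^+ (m - n + n))%:E); last first.
    by rewrite lee_fin gerBl !mulr_ge0 // exprn_ge0.
  elim: (m - n)%N => [|q IH].
    rewrite add0n subrr (@Lp_norm_ae _ _ _ _ (fun t => (0:R)%:C *: (f n t - f n t))).
      by rewrite Lp_normZ ?mul0e //; exact: smB.
    by apply: aeW => t _; rewrite scale0r subrr.
  rewrite addSn; apply: le_trans (Lp_norm_triangle mD (smB (sf (q + n).+1) (sf (q + n)%N))
    (smB (sf (q + n)%N) (sf n)) _) _.
    by apply: aeW => t _; exact: nrm_tri.
  apply: le_trans (leeD (fC _) IH) _; rewrite -EFinD lee_fin exprS.
  have : 0 <= C * 4^-1 ^+ (q + n) by rewrite mulr_ge0 // exprn_ge0.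
  lra.
have b0 : 0 <= 2 * C * 4^-1 ^+ n by rewrite !mulr_ge0 // exprn_ge0.
suff : ((Lp_norm p%:E D (fun t => g t - f n t)%R) `^ p <= ((2 * C * 4^-1 ^+ n)%:E) `^ p)%E.
  move=> h; have := le_poweR pV0 (poweR_ge0 _ _) h.
  by rewrite -!poweRrM !mulfV // !poweRe1 ?lee_fin ?Lp_norm_ge0.
rewrite Lp_powR.
pose u m t := (nrm (f' m t - f' n t) `^ p)%:E.
have mu_ m : measurable_fun D (u m).
  apply/measurable_EFinP; apply: (measurable_funTS (D := D)).
  exact: (measurableT_comp (measurable_powR p) (mdiff _ _)).
apply: (@le_trans _ _ (\int[mu]_(t in D) limn_einf (u ^~ t))%E).
  apply: ge0_ae_le_integral_nomeas => [t _|t _|].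
  - by rewrite lee_fin powR_ge0.
  - rewrite limn_einf_lim; apply: lime_ge; first exact: is_cvg_einfs.
    by apply: nearW => k; apply: le_ereal_inf_tmp => _ [m _ <-]; rewrite lee_fin powR_ge0.
  apply: aeS2 gP ff' => t h1 h2 Dt.
  suff hu : u ^~ t @ \oo --> (nrm (g t - f n t) `^ p)%:E.
    by have [-> _] := cvg_limn_einf_sup hu.
  apply/fine_cvgP; split; first exact: nearW.
  rewrite h2 //.
  have h : nrm (f' m t - f' n t) @[m --> \oo] --> nrm (g t - f' n t).
    by apply: cvg_nrm; apply: cvgB; [exact: h1|exact: cvg_cst].
  exact: (powR_cvg p1 (fun m => nrm_ge0 _) h).
have u_ge0 m t : D t -> (0 <= u m t)%E by move=> _; rewrite lee_fin powR_ge0.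
apply: le_trans (@fatou _ _ _ mu D mD u mu_ u_ge0) _.
rewrite limn_einf_lim; apply: lime_le; first exact: is_cvg_einfs.
apply: nearW => k.
(* The index maxn k n belongs to the tail beyond k over which the infimum runs, and is at least n,
   as [bound] requires. *)
apply: (@le_trans _ _ (\int[mu]_(t in D) u (maxn k n) t)%E).
  by apply: ereal_inf_lbound; exists (maxn k n) => //=; rewrite leq_maxl.
rewrite -Lp_powR; apply: le_poweR; rewrite ?(ltW p0) ?Lp_norm_ge0 //.
by rewrite bound // leq_maxr.
Qed.
End LpSpaces.

(** * Weighted spaces *)

(** Restriction to a smaller set is encoded as extension by zero, so that all norms are taken on the
    same interval. *)
Definition cutoff (R : realType) (V : lmodType R[i]) (A : set R) (f : R -> V) (t : R) : V :=
  (\1_A t : R)%:C *: f t.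

Section Cut.
Context {R : realType}.
Local Notation mu := (@lebesgue_measure R).

Lemma cutoff_in (V : lmodType R[i]) A (f : R -> V) t : A t -> cutoff A f t = f t.
Proof. by move=> At; rewrite /cutoff scale_indic mem_set. Qed.

Lemma cutoff_out (V : lmodType R[i]) A (f : R -> V) t : ~ A t -> cutoff A f t = 0.
Proof. by move=> At; rewrite /cutoff scale_indic memNset. Qed.

Lemma nrm_cutoff_le (V : normedModType R[i]) A (f : R -> V) t : nrm (cutoff A f t) <= nrm (f t).
Proof. by rewrite /cutoff scale_indic; case: ifP; rewrite // nrm0 nrm_ge0. Qed.

Lemma sm_cutoff (V : normedModType R[i]) D A (f : R -> V) : measurable A ->
  strongly_measurable D f -> strongly_measurable D (cutoff A f).
Proof. by move=> mA sf; apply: sm_restr => //; apply: sm_sub sf; exact: subIsetl. Qed.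

Lemma ae_neq (x : R) : {ae mu, forall t, t <> x}.
Proof.
exists [set x]; split; [exact: measurable_set1|exact: lebesgue_measure_set1|].
by move=> t /= /contrapT ->.
Qed.

Lemma ae_itv_cc (x y : R) : {ae mu, forall t, `[x, y]%classic t <-> `]x, y[%classic t}.
Proof.
apply: aeS2 (ae_neq x) (ae_neq y) => t /eqP tx /eqP ty.
rewrite /= !in_itv /= !le_eqVlt [x == t]eq_sym (negbTE tx) (negbTE ty) //=.
Qed.

Lemma mu_itv_lty (x y : R) b b' : (mu [set` Interval (BSide b x) (BSide b' y)] < +oo)%E.
Proof.
by rewrite lebesgue_measure_itv /=; case: ifP => // _; rewrite -EFinB ltry.
Qed.
End Cut.

Section WeightedLp.
Context {R : realType}.
Local Notation mu := (@lebesgue_measure R).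
Variables (p a : R) (p1 : 1 <= p).
Let p0 : 0 < p. Proof. exact: lt_le_trans p1. Qed.

Lemma scale_bounded (V : normedModType R[i]) (x : R) :
  bounded_op (GRing.scale x%:C : {linear V -> V}).
Proof. by exists `|x| => v; rewrite nrmZ. Qed.

Lemma sm_weight (V : normedModType R[i]) (b tau : R) (f : R -> V) :
  strongly_measurable `]0, tau[ f ->
  strongly_measurable `]0, tau[ (fun t => (t `^ b)%:C *: f t).
Proof.
apply: (@sm_family _ _ _ (fun t => (GRing.scale (t `^ b)%:C : {linear V -> V}))).
  move=> s /andP[s0 _].
  have /cvgrPdist_lt/(_ 1 ltr01)/nbhs_ballP[d /= d0 hd] := @powR_continuous _ b _ s0.
  exists d, (s `^ b + 1); split => // s' _ ss' e.
  rewrite nrmZ ler_wpM2r ?nrm_ge0 // ger0_norm ?powR_ge0 //.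
  have := hd s'; rewrite /ball /= distrC => /(_ ss').
  by rewrite ltr_norml => /andP[+ _]; lra.
move=> s e eps /andP[s0 _] eps0.
have e1 : 0 < nrm e + 1 by rewrite ltr_wpDl // nrm_ge0.
have /cvgrPdist_lt/(_ (eps / (nrm e + 1)))[|] := @powR_continuous _ b _ s0.
  by rewrite divr_gt0.
move=> d /= d0 hd; exists d => // s' _ ss'.
rewrite -scalerBl -rmorphB nrmZ /=.
have := hd s'; rewrite /ball /= distrC => /(_ ss'); rewrite distrC ltr_pdivlMr // => h.
apply: le_lt_trans h; rewrite ler_wpM2l //; lra.
Qed.

Lemma sm_weightP (V : normedModType R[i]) (b tau : R) (f : R -> V) :
  strongly_measurable `]0, tau[ (fun t => (t `^ b)%:C *: f t) <->
  strongly_measurable `]0, tau[ f.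
Proof.
split; last exact: sm_weight.
move=> /(sm_weight (- b)); apply: sm_ae; apply: aeW => t /=.
rewrite in_itv /= => /andP[t0 _].
by rewrite scalerA -rmorphM /= powRN mulVf ?scale1r // gt_eqF // powR_gt0.
Qed.

Section Fixed.
Variable tau : R.
Local Notation D := `]0, tau[%classic.
Local Notation N f := (Lpw_norm p a D f).

Let mD : measurable D. Proof. exact: measurable_itv. Qed.
Let Dfin : (mu D < +oo)%E. Proof. exact: mu_itv_lty. Qed.

Lemma in_LpwP (V : normedModType R[i]) (f : R -> V) : in_Lpw p a D f <->
  strongly_measurable D f /\ (N f < +oo)%E.
Proof. by split => -[h1 h2]; split => //; exact/(sm_weightP a). Qed.

Lemma Lpw_norm_ge0 (V : normedModType R[i]) (f : R -> V) : (0 <= N f)%E.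
Proof. exact: Lp_norm_ge0. Qed.

Lemma Lpw_norm_le2 (V V1 V2 : normedModType R[i]) (f : R -> V) (g : R -> V1)
    (h : R -> V2) (c d : R) : 0 <= c -> 0 <= d -> strongly_measurable D f ->
  in_Lpw p a D g -> in_Lpw p a D h ->
  {ae mu, forall t, D t -> nrm (f t) <= c * nrm (g t) + d * nrm (h t)} ->
  in_Lpw p a D f /\ (N f <= c%:E * N g + d%:E * N h)%E.
Proof.
move=> c0 d0 sf [sg gfin] [sh hfin] fgh.
have le : (N f <= c%:E * N g + d%:E * N h)%E.
  apply: Lp_norm_le2 => //; apply: aeS fgh => t h1 Dt.
  rewrite !nrmZ mulrCA [d * _]mulrCA -mulrDr ler_wpM2l //; exact: h1.
split => //; apply/in_LpwP; split => //; apply: le_lt_trans le _.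
by rewrite lte_add_pinfty // lte_mul_pinfty // lee_fin.
Qed.

Lemma Lpw_norm_le (V V1 : normedModType R[i]) (f : R -> V) (g : R -> V1)
    (c : R) : 0 <= c -> strongly_measurable D f -> in_Lpw p a D g ->
  {ae mu, forall t, D t -> nrm (f t) <= c * nrm (g t)} ->
  in_Lpw p a D f /\ (N f <= c%:E * N g)%E.
Proof.
move=> c0 sf pg fg; have [|h1 h2] := Lpw_norm_le2 c0 (lexx 0) sf pg pg.
  by apply: aeS fg => t h /h; rewrite mul0r addr0.
by split=> //; rewrite mul0e adde0 in h2.
Qed.

Lemma Lpw_norm_eq0 (V : normedModType R[i]) (f : R -> V) :
  in_Lpw p a D f -> N f = 0%E -> {ae mu, forall t, D t -> f t = 0}.
Proof.
move=> [sf _] /(Lp_norm_eq0 p1 mD sf); apply: aeS => t h Dt.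
have /eqP := h Dt; rewrite scaler_eq0 => /orP[|/eqP //].
move: Dt; rewrite /= in_itv /= => /andP[t0 _].
by rewrite fmorph_eq0 gt_eqF // powR_gt0.
Qed.

Lemma Lpw_small (V : normedModType R[i]) (f : R -> V) (A : nat -> set R) (e : R) :
  in_Lpw p a D f -> 0 < e -> (forall n, measurable (A n)) ->
  {ae mu, forall t, D t -> (\1_(A n) t : R) @[n --> \oo] --> 0} ->
  \forall n \near \oo, (N (cutoff (A n) f) < e%:E)%E.
Proof.
move=> [sf ff] e0 mA A0.
have := Lp_norm_small p1 mD sf e0 ff mA A0; apply: filterS => n.
rewrite Lp_norm_restr // /Lpw_norm /cutoff.
suff -> : (fun t => (\1_(A n) t)%:C *: ((t `^ a)%:C *: f t)) =
  (fun t => (t `^ a)%:C *: ((\1_(A n) t)%:C *: f t)) by [].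
by apply/funext => t; rewrite !scalerA mulrC.
Qed.

Lemma Lpw_complete (V : completeNormedModType R[i]) (f : nat -> R -> V) (C : R) :
  (forall n, in_Lpw p a D (f n)) ->
  (forall n, (N (fun t => f n.+1 t - f n t)%R <= (C * 4^-1 ^+ n)%:E)%E) ->
  exists g : R -> V, [/\ in_Lpw p a D g,
    {ae mu, forall t, D t -> f n t @[n --> \oo] --> g t} &
    forall n, (N (fun t => g t - f n t)%R <= (2 * C * 4^-1 ^+ n)%:E)%E].
Proof.
move=> pf fC.
have [||g [sg cg gC]] := @Lp_complete _ _ p1 _ D (fun n t => (t `^ a)%:C *: f n t) C mD Dfin.
- by move=> n; have [] := pf n.
- move=> n; apply: le_trans (fC n); rewrite /Lpw_norm.
  rewrite le_eqVlt; apply/orP; left; apply/eqP; congr Lp_norm.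
  by apply/funext => t; rewrite scalerBr.
pose g' t := (t `^ (- a))%:C *: g t.
have gg' t : D t -> (t `^ a)%:C *: g' t = g t.
  rewrite /= in_itv /= => /andP[t0 _].
  by rewrite scalerA -rmorphM /= powRN mulfV ?scale1r // gt_eqF // powR_gt0.
have sg' : strongly_measurable D g' by exact: sm_weight.
have g'C n : (N (fun t => g' t - f n t)%R <= (2 * C * 4^-1 ^+ n)%:E)%E.
  apply: le_trans (gC n); rewrite /Lpw_norm; apply: Lp_norm_le_ae => //.
  by apply: aeW => t Dt; rewrite scalerBr gg'.
exists g'; split => //.
  have [pd _] : in_Lpw p a D (fun t => g' t - f 0%N t) /\ True.
    split => //; apply/in_LpwP; split; last exact: le_lt_trans (g'C 0%N) (ltry _).
    by apply: smB => //; have /in_LpwP[] := pf 0%N.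
  have [] := @Lpw_norm_le2 _ _ _ g' (fun t => g' t - f 0%N t) (f 0%N) 1 1 ler01 ler01 sg' pd (pf 0%N).
    by apply: aeW => t _; rewrite !mul1r -{1}(subrK (f 0%N t) (g' t)) nrmD.
  by [].
apply: aeS cg => t h Dt; have {h} := h Dt.
move: (Dt); rewrite /= in_itv /= => /andP[t0 _] h.
have ta : t `^ a != 0 by rewrite gt_eqF // powR_gt0.
have := bounded_op_cvg (scale_bounded V (t `^ (- a))) h.
rewrite /= -/(g' t); under eq_fun do rewrite scalerA -rmorphM /= powRN mulVf // scale1r.
by move=> H; apply: H.
Qed.

(** Away from 0 the weight is bounded below, and y <= 1 + y^p takes the place of Hölder's
    inequality. *)
Lemma Lpw_int_lty (V : normedModType R[i]) (f : R -> V) (d : R) : 0 < d ->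
  in_Lpw p a D f -> (\int[mu]_(t in `]d, tau[) (nrm (f t))%:E < +oo)%E.
Proof.
move=> d0 [sf ff].
(* According to the sign of a, t^(-a) is largest at d or at tau; the sum covers both cases. *)
pose c := d `^ (- a) + tau `^ (- a).
have c0 : 0 <= c by rewrite addr_ge0 // powR_ge0.
have wc t : d < t < tau -> t `^ (- a) <= c.
  move=> /andP[dt tt]; have t0 : 0 < t := lt_trans d0 dt.
  have [a0|a0] := leP 0 (- a).
    apply: (@le_trans _ _ (tau `^ (- a))); last by rewrite lerDr powR_ge0.
    by rewrite ge0_ler_powR ?nnegrE ?(ltW t0) ?(ltW tt) ?(ltW (lt_trans t0 tt)).
  apply: (@le_trans _ _ (d `^ (- a))); last by rewrite lerDl powR_ge0.
  have aN : 0 <= a by rewrite -oppr_le0 ltW.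
  by rewrite !powRN lef_pV2 ?posrE ?powR_gt0 // ge0_ler_powR ?nnegrE ?(ltW d0) ?(ltW t0) ?(ltW dt).
have sD : `]d, tau[ `<=` D.
  by move=> t /=; rewrite !in_itv /= => /andP[dt ->]; rewrite (lt_trans d0).
pose y t := nrm ((t `^ a)%:C *: f t).
have [g gl fg] := sm_simple_limit mD sf.
have mg := simple_limit_nrm gl.
have mgp : measurable_fun setT (fun t => nrm (g t) `^ p).
  exact: (measurableT_comp (measurable_powR p) mg).
apply: (@le_lt_trans _ _ (\int[mu]_(t in `]d, tau[) (c%:E * (1 + nrm (g t) `^ p)%:E))%E).
  apply: ge0_ae_le_integral_nomeas => [t _|t _|].
  - by rewrite lee_fin nrm_ge0.
  - by rewrite -EFinM lee_fin mulr_ge0 // addr_ge0 // powR_ge0.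
  apply: aeS fg => t fg Dt; rewrite -EFinM lee_fin.
  have Dt' := sD _ Dt; rewrite -(fg Dt').
  move: Dt; rewrite /= in_itv /= => tt; have t0 : 0 < t by case/andP: tt => /(lt_trans d0).
  have -> : nrm (f t) = t `^ (- a) * nrm ((t `^ a)%:C *: f t).
    rewrite nrmZ ger0_norm ?powR_ge0 // mulrA powRN mulVf ?mul1r //.
    by rewrite gt_eqF // powR_gt0.
  apply: ler_pM; rewrite ?powR_ge0 ?nrm_ge0 ?wc //.
  set z := nrm _; have [z1|z1] := leP z 1.
    by rewrite (le_trans z1) // lerDl powR_ge0.
  by rewrite (le_trans (le1r_powR (ltW z1) p1)) // lerDr.
have mdt : measurable (`]d, tau[%classic : set R) by exact: measurable_itv.
have mgp' : measurable_fun (`]d, tau[%classic : set R) (fun t => nrm (g t) `^ p).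
  exact: (measurable_funTS (D := `]d, tau[%classic)).
rewrite ge0_integralZl //; last 2 first.
- apply/measurable_EFinP; apply: measurable_funD => //; exact: measurable_cst.
- by move=> t _; rewrite lee_fin addr_ge0 // powR_ge0.
rewrite lte_mul_pinfty ?lee_fin //.
under eq_integral do rewrite EFinD.
rewrite ge0_integralD //; last 2 first.
- by move=> t _; rewrite lee_fin powR_ge0.
- exact/measurable_EFinP.
apply: lte_add_pinfty.
  by rewrite integral_cst //= mul1e mu_itv_lty.
apply: (@le_lt_trans _ _ (\int[mu]_(t in D) (nrm ((t `^ a)%:C *: f t) `^ p)%:E)%E).
  rewrite -[in leLHS](setIidr sD) integral_mkcondr.
  apply: ge0_ae_le_integral_nomeas => [t _|t _|].
  - by rewrite /patch; case: ifP => // _; rewrite lee_fin powR_ge0.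
  - by rewrite lee_fin powR_ge0.
  apply: aeS fg => t fg Dt; rewrite /patch; case: ifP => _; rewrite lee_fin ?powR_ge0 //.
  by rewrite fg.
by rewrite -Lp_powR //; exact: poweR_lty.
Qed.
End Fixed.

Section Domains.
Context {V : normedModType R[i]}.
Implicit Type f : R -> V.

Lemma Lpw_norm_cc tau f : Lpw_norm p a `[0%R, tau] f = Lpw_norm p a `]0%R, tau[ f.
Proof. by apply: Lp_norm_dom => //; exact: ae_itv_cc. Qed.

Lemma in_Lpw_cc tau f : in_Lpw p a `[0, tau] f <-> in_Lpw p a `]0, tau[ f.
Proof.
have := @Lpw_norm_cc tau f; rewrite /Lpw_norm => e.
by split=> -[h1 h2]; split; rewrite ?e // -?e //;
  apply: sm_ae_dom h1; apply: aeS (ae_itv_cc 0 tau) => t [].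
Qed.

Lemma Lpw_norm_restr (tau tau' : R) f : tau' <= tau ->
  Lpw_norm p a `]0%R, tau'[ f = Lpw_norm p a `]0%R, tau[ (cutoff `[0, tau'] f).
Proof.
move=> tt; rewrite /Lpw_norm.
transitivity (Lp_norm p%:E (`]0, tau[ `&` `[0, tau']) (fun t => (t `^ a)%:C *: f t)).
  apply: Lp_norm_dom => //; apply: aeS (ae_itv_cc 0 tau') => t h; split=> [h'|[_ h'] //]; last exact/h.
  split; last exact/h.
  by move: h'; rewrite /= !in_itv /= => /andP[-> h']; rewrite (lt_le_trans h').
rewrite Lp_norm_restr //; congr Lp_norm; apply/funext => t.
by rewrite /cutoff !scalerA mulrC.
Qed.

Lemma in_Lpw_restr (tau tau' : R) f : tau' <= tau ->
  in_Lpw p a `]0, tau'[ f <-> in_Lpw p a `]0, tau[ (cutoff `[0, tau'] f).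
Proof.
move=> tt; rewrite !in_LpwP (Lpw_norm_restr f tt).
split=> -[h1 h2]; split => //.
  apply: sm_restr; first exact: measurable_itv.
  apply: sm_ae_dom h1; apply: aeS (ae_itv_cc 0 tau') => t h [_ /h //].
apply: (@sm_ae _ _ _ (cutoff `[0, tau'] f)).
  apply: aeW => t /=; rewrite in_itv /= => /andP[t0 tt'].
  by rewrite cutoff_in //= in_itv /= (ltW t0) ltW.
apply: sm_sub h1 => t /=; rewrite !in_itv /= => /andP[-> h']; exact: lt_le_trans h' tt.
Qed.
End Domains.
End WeightedLp.

(** * Semigroups *)

Section SemigroupTheory.
Context {R : realType} {X : completeNormedModType R[i]}.
Variable T : R -> {linear X -> X}.
Hypothesis TC0 : C0_semigroup T.

Lemma semigroup_right_cvg x (e : R) : 0 < e ->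
  exists2 d, 0 < d & forall h, 0 <= h < d -> nrm (T h x - x) < e.
Proof.
have [_ T0 _ Tx] := TC0 => e0.
have /nrm_cvgP/(_ e e0) := Tx x.
rewrite near_withinE => /nbhs_ballP[d /= d0 hd]; exists d => // h /andP[].
rewrite le_eqVlt => /orP[/eqP <- _|h0 hd']; first by rewrite T0 subrr nrm0.
by apply: hd => //; rewrite /ball /= sub0r normrN gtr0_norm.
Qed.

(** Otherwise there are times t n <= 1 / (n + 1) at which the norm of T (t n) exceeds n, although T
    (t n) x tends to x for each x. This contradicts uniform boundedness. *)
Lemma semigroup_bounded_near0 : exists d M : R, [/\ 0 < d, 0 <= M &
  forall t x, 0 <= t <= d -> nrm (T t x) <= M * nrm x].
Proof.
have [Tb T0 _ _] := TC0; apply: contrapT => hN.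
have /choice[t tP] : forall n : nat, exists t : R, 0 <= t <= n.+1%:R^-1 /\
    exists x, n%:R * nrm x < nrm (T t x).
  move=> n; apply: contrapT => h; apply: hN; exists n.+1%:R^-1, n%:R.
  split => // t x tn; rewrite leNgt; apply/negP => lt; apply: h.
  by exists t; split => //; exists x.
have [i|x|M M0 hM] := @uniform_boundedness _ X X nat (fun n => T (t n)).
- by apply: Tb; have [/andP[]] := tP i.
- have [d d0 hd] := semigroup_right_cvg x ltr01.
  have /cvgr0Pnorm_lt/(_ d d0)[N _ hN'] := @cvg_harmonic R.
  exists (\sum_(k < N) nrm (T (t k) x) + (nrm x + 1)) => n.
  have S0 : 0 <= \sum_(k < N) nrm (T (t k) x) by apply: sumr_ge0 => k _; exact: nrm_ge0.
  have [nN|Nn] := ltnP n N.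
    rewrite (bigD1 (Ordinal nN)) //= -addrA lerDl addr_ge0 //.
      by apply: sumr_ge0 => k _; exact: nrm_ge0.
    by rewrite addr_ge0 // nrm_ge0.
  have [/andP[t0 tn] _] := tP n.
  have := hN' n Nn; rewrite ger0_norm ?invr_ge0 // => nd.
  have := hd (t n); rewrite t0 (le_lt_trans tn nd) => /(_ isT).
  by have := nrm_tri x (T (t n) x) 0; rewrite !subr0; lra.
have [_ [x]] := tP (Num.truncn M).+1; apply/negP; rewrite -leNgt.
by rewrite (le_trans (hM _ _)) // ler_wpM2r ?nrm_ge0 // ltW // truncnS_gt.
Qed.

Lemma semigroup_bounded (tau : R) : exists2 M : R, 1 <= M &
  forall t x, 0 <= t <= tau -> nrm (T t x) <= M * nrm x.
Proof.
have [_ _ TD _] := TC0.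
have [d [M [d0 M0 hM]]] := semigroup_bounded_near0.
pose M1 := Num.max 1 M.
have M11 : 1 <= M1 by rewrite le_max lexx.
have M10 : 0 <= M1 by rewrite (le_trans _ M11).
have hM1 t x : 0 <= t <= d -> nrm (T t x) <= M1 * nrm x.
  by move=> /hM/le_trans; apply; rewrite ler_wpM2r ?nrm_ge0 // le_max lexx orbT.
have hn n : forall t x, 0 <= t <= n.+1%:R * d -> nrm (T t x) <= M1 ^+ n.+1 * nrm x.
  elim: n => [|n IH] t x; first by rewrite mul1r expr1; exact: hM1.
  move=> /andP[t0 tn]; have [td|dt] := leP t d.
    apply: le_trans (hM1 t x _) _; first by rewrite t0.
    by rewrite ler_wpM2r ?nrm_ge0 // exprS ler_peMr // exprn_ege1.
  have -> : t = d + (t - d) by rewrite addrC subrK.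
  have td0 : 0 <= t - d by rewrite subr_ge0 ltW.
  rewrite TD ?(ltW d0) //; apply: le_trans (hM1 d _ _) _; first by rewrite lexx ltW.
  rewrite exprS -mulrA ler_wpM2l // IH // td0 lerBlDr.
  by rewrite -natr1 mulrDl mul1r in tn.
exists (M1 ^+ (Num.truncn (tau / d)).+1) => [|t x /andP[t0 tt]].
  exact: exprn_ege1.
by apply: hn; rewrite t0 (le_trans tt) // -ler_pdivrMr // ltW // truncnS_gt.
Qed.

(** Factoring out the operator at the smaller of the two times reduces both one-sided limits to
    right continuity at 0. *)
Lemma semigroup_continuous x (t : R) (e : R) : 0 <= t -> 0 < e ->
  exists2 d, 0 < d & forall s, 0 <= s -> `|s - t| < d -> nrm (T s x - T t x) < e.
Proof.
have [_ _ TD _] := TC0 => t0 e0.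
have [M M1 hM] := semigroup_bounded (t + 1).
have M0 : 0 < M by rewrite (lt_le_trans _ M1).
have [d d0 hd] := @semigroup_right_cvg x (e / M) ltac:(by rewrite divr_gt0).
exists (Num.min d 1) => [|s s0]; first by rewrite lt_min d0 ltr01.
rewrite lt_min => /andP[sd s1].
have key u v : 0 <= u -> u <= v -> u <= t + 1 -> v - u < d ->
    nrm (T v x - T u x) < e.
  move=> u0 uv ut vu; have -> : v = u + (v - u) by rewrite addrC subrK.
  rewrite TD ?subr_ge0 // -linearB; apply: le_lt_trans (hM u _ _) _; first by rewrite u0.
  by rewrite mulrC -ltr_pdivlMr // hd // subr_ge0 uv.
have [st|ts] := leP s t.
  rewrite nrm_distC; apply: key => //.
    by rewrite (le_trans st) // lerDl.
  by move: sd; rewrite distrC ger0_norm ?subr_ge0.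
apply: key => //; first exact: ltW.
  by rewrite lerDl.
by move: sd; rewrite gtr0_norm ?subr_gt0.
Qed.
End SemigroupTheory.

(** * Powers of the generator, the extrapolation space and analytic smoothing *)

Section Generator.
Context {R : realType} {X : completeNormedModType R[i]}.
Variables (A : unbounded_op X X).

Lemma op0 (W : lmodType R[i]) (O : unbounded_op X W) : O 0 = 0.
Proof.
have := op_lin (u := 0) (v := 0) (-1) (op_dom0 O) (op_dom0 O).
by rewrite scaler0 addr0 scaleN1r addNr.
Qed.

Lemma opB (W : lmodType R[i]) (O : unbounded_op X W) u v : op_dom O u -> op_dom O v ->
  op_dom O (u - v) /\ O (u - v) = O u - O v.
Proof.
move=> du dv; have := op_dom_lin (-1) dv du; have := op_lin (-1) dv du.
by rewrite !scaleN1r [- v + u]addrC [- O v + _]addrC.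
Qed.

Lemma pow_dom_lin k c u v : pow_dom A k u -> pow_dom A k v ->
  pow_dom A k (c *: u + v) /\ iter k A (c *: u + v) = c *: iter k A u + iter k A v.
Proof.
elim: k => [//|k IH] /= [pu du] [pv dv]; have [p1 ->] := IH pu pv.
by split; [split => //; exact: op_dom_lin|exact: op_lin].
Qed.

(** The definition adds a condition on the last iterate; here the first application of [A] is peeled
    off instead. *)
Lemma pow_domS k x : pow_dom A k.+1 x <-> op_dom A x /\ pow_dom A k (A x).
Proof.
elim: k => [|k IH]; first by split=> [[_ h]|[h _]]; split.
split=> [[/IH[dx px] h]|[dx [px h]]].
  by split => //; split => //; rewrite -iterSr.
by split; [apply/IH|rewrite iterSr].
Qed.

Section Resolvent.
Variables (l0 : R[i]) (hl0 : resolvent_set A (- l0)).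

(** [S] inverts -l0 - A, hence [- S] inverts l0 + A, and its k-fold iterate provides the preimages
    with their bound. *)
Lemma resolvent_powE k : exists2 M : R, 0 <= M & forall y, exists x,
  [/\ pow_dom A k x, shift_pow A l0 k x = y & nrm x <= M * nrm y].
Proof.
have [S [[M hM] hS _]] := hl0.
have S' y : op_dom A (- S y) /\ l0 *: (- S y) + A (- S y) = y.
  have [d e] := hS y; have [d' e'] := opB (op_dom0 A) d.
  rewrite op0 !sub0r in d' e'; split => //.
  by rewrite -[RHS]e e' scalerN scaleNr.
have pow_S' m : forall x, pow_dom A m x -> pow_dom A m.+1 (- S x).
  elim: m => [|m IH] x px; first by split => //; have [] := S' x.
  apply/pow_domS; have [d e] := S' x; split => //.
  (* Solving the resolvent equation for A (- S x) expresses it by - S x, regular by induction, and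
     x, regular by assumption. *)
  have -> : A (- S x) = (- l0) *: (- S x) + x by rewrite -{3}e scaleNr addKr.
  have [] // := @pow_dom_lin m.+1 (- l0) (- S x) x _ px.
  by apply: IH; case: px.
exists (`|M| ^+ k) => [|y]; first exact: exprn_ge0.
exists (iter k (fun z => - S z) y); split.
- by elim: k => [//|k IH]; rewrite iterS; exact: pow_S'.
- elim: k y => [//|k IH] y.
  by rewrite /shift_pow iterSr iterS; have [_ ->] := S' (iter k (fun z => - S z) y); exact: IH.
elim: k => [|k IH]; first by rewrite expr0 mul1r.
rewrite iterS nrmN; apply: le_trans (hM _) _; rewrite exprS -mulrA.
apply: (@le_trans _ _ (`|M| * nrm (iter k (fun z => - S z) y))).
  by rewrite ler_wpM2r ?nrm_ge0 // ler_norm.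
by rewrite ler_wpM2l.
Qed.

Lemma shift_pow0 k : shift_pow A l0 k 0 = 0.
Proof.
by rewrite /shift_pow; elim: k => [//|k IH]; rewrite iterS IH scaler0 add0r op0.
Qed.

(** The norm identity in [extrapolation_space] concerns the vectors (l0 + A)^k x only; by
    [resolvent_powE] these exhaust X, with |x| controlled by |y|. *)
Lemma extrapolation_bounded k (E : completeNormedModType R[i]) (j : {linear X -> E}) :
  extrapolation_space A l0 k j -> bounded_op j /\ forall x, j x = 0 -> x = 0.
Proof.
move=> [jn _]; have [M M0 hM] := resolvent_powE k; split.
  exists M => y; have [x [px <- xM]] := hM y.
  by rewrite jn.
move=> y; have [x [px <- _]] := hM y => j0.
have := jn x px; rewrite j0 nrm0 => /esym/nrm_eq0 ->; exact: shift_pow0.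
Qed.
End Resolvent.

Section Analytic.
Variable T : R -> {linear X -> X}.
Hypotheses (TA : analytic_semigroup T) (AT : neg_generates A T).

(** A positive real s lies in the sector, and the complex derivative there, taken along positive
    real increments, is the limit of the difference quotient that characterises the domain. *)
Lemma analytic_dom s x : 0 < s -> op_dom A (T s x).
Proof.
have [TC0 [th [S [/andP[th0 thpi] ST _ [_ Sd _]]]]] := TA => s0.
have [_ _ TD _] := TC0.
have secs : sector th (s%:C : R[i]^o).
  split => //=; rewrite normr0 mulr_gt0 // divr_gt0 //.
    by rewrite sin_gt0_pihalf // th0.
  by rewrite cos_gt0_pihalf // thpi (lt_trans _ th0) // oppr_lt0 divr_gt0 // pi_gt0.
have /cvg_ex[l /= /nrm_cvgP hl] := Sd x _ secs.
have [|d _] := (AT (T s x) l).2; last by [].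
apply/nrm_cvgP => e e0.
have := hl e e0; rewrite near_withinE => /nbhs_ballP[r /= r0 hr].
have rE : r = (complex.Re r)%:C by rewrite RRe_real ?gtr0_real.
have r0' : 0 < complex.Re r by rewrite -ltcR -rE.
rewrite near_withinE; apply/nbhs_ballP; exists (complex.Re r) => //= h hr' h0.
have nh : `|h%:C : R[i]| = `|h|%:C.
  by rewrite normc_def /= expr0n /= addr0 sqrtr_sqr.
move: hr'; rewrite /ball /= sub0r normrN => hr'.
have := hr (h%:C : R[i]^o); rewrite /ball /= sub0r normrN nh rE ltcR hr' => /(_ isT).
have hn0 : h%:C != 0 :> R[i] by rewrite fmorph_eq0 gt_eqF.
move=> /(_ hn0).
have -> : (h%:C *: (1 : R[i]^o) + s%:C) = (h + s)%:C :> R[i]^o.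
  by rewrite /GRing.scale /= mulr1 -rmorphD.
rewrite !ST ?addr_gt0 // TD ?(ltW h0) ?(ltW s0) //.
by rewrite fmorphV.
Qed.

Lemma generator_shift t y : 0 <= t -> op_dom A y ->
  op_dom A (T t y) /\ A (T t y) = T t (A y).
Proof.
have [[Tb _ TD _] _] := TA => t0 dy.
have /(_ (conj dy erefl)) hy := (AT y (- A y)).1.
have [|d e] := (AT (T t y) (T t (- A y))).2.
  apply: cvg_trans (bounded_op_cvg (Tb t t0) hy); apply: near_eq_cvg.
  rewrite near_withinE; apply: nearW => h h0.
  by rewrite linearZ linearB /= -!TD ?(ltW h0) // [t + h]addrC.
by split => //; rewrite -[LHS]opprK e linearN opprK.
Qed.

(** The second clause carries the induction: the iterate is again a value T r y with r > 0. At each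
    step half of r is spent on entering the domain and the other half is kept. *)
Lemma analytic_pow_dom k s x : 0 < s -> pow_dom A k (T s x) /\
  exists y r, 0 < r /\ iter k A (T s x) = T r y.
Proof.
have [[_ _ TD _] _] := TA.
move=> s0; elim: k => [|k [pk [y [r [r0 e]]]]]; first by split => //; exists x, s.
have r2 : 0 < r / 2 by rewrite divr_gt0.
have rE : T r y = T (r / 2) (T (r / 2) y).
  by rewrite -TD ?(ltW r2) // -splitr.
split; first by split => //; rewrite e; exact: analytic_dom.
exists (A (T (r / 2) y)), (r / 2); split => //.
by rewrite iterS e rE; have [_ ->] := generator_shift (ltW r2) (analytic_dom y r2).
Qed.
End Analytic.
End Generator.

(** [fine] sends an infinite norm to 0, so comparisons of these values rely on [in_Lpw]. *)
Definition wnorm (R : realType) (V : normedModType R[i]) (p a tau : R) (f : R -> V) : R :=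
  fine (Lpw_norm p a `]0, tau[ f).

Section WeightedNorm.
Context {R : realType}.
Local Notation mu := (@lebesgue_measure R).
Variables (p a tau : R) (p1 : 1 <= p).
Local Notation D := `]0, tau[%classic.
Local Notation N := (wnorm p a tau).

Lemma wnormE (V : normedModType R[i]) (f : R -> V) : in_Lpw p a D f ->
  Lpw_norm p a D f = (N f)%:E.
Proof.
by move=> [_ ff]; rewrite fineK // ge0_fin_numE // Lpw_norm_ge0.
Qed.

Lemma wnorm_ge0 (V : normedModType R[i]) (f : R -> V) : 0 <= N f.
Proof. by rewrite fine_ge0 // Lpw_norm_ge0. Qed.

Lemma wnorm_le2 (V V1 V2 : normedModType R[i]) (f : R -> V) (g : R -> V1)
    (h : R -> V2) (c d : R) : 0 <= c -> 0 <= d -> strongly_measurable D f ->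
  in_Lpw p a D g -> in_Lpw p a D h ->
  {ae mu, forall t, D t -> nrm (f t) <= c * nrm (g t) + d * nrm (h t)} ->
  in_Lpw p a D f /\ N f <= c * N g + d * N h.
Proof.
move=> c0 d0 sf pg ph fgh.
have [pf] := Lpw_norm_le2 p1 c0 d0 sf pg ph fgh.
by rewrite !wnormE // -!EFinM -EFinD lee_fin.
Qed.

Lemma wnorm_le (V V1 : normedModType R[i]) (f : R -> V) (g : R -> V1)
    (c : R) : 0 <= c -> strongly_measurable D f -> in_Lpw p a D g ->
  {ae mu, forall t, D t -> nrm (f t) <= c * nrm (g t)} ->
  in_Lpw p a D f /\ N f <= c * N g.
Proof.
move=> c0 sf pg fg; have [pf] := Lpw_norm_le p1 c0 sf pg fg.
by rewrite !wnormE // -!EFinM lee_fin.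
Qed.

Lemma Lpw_sm (V : normedModType R[i]) (f : R -> V) :
  in_Lpw p a D f -> strongly_measurable D f.
Proof. by move=> /(in_LpwP p a)[]. Qed.

Lemma LpwB (V : normedModType R[i]) (f g : R -> V) : in_Lpw p a D f ->
  in_Lpw p a D g -> in_Lpw p a D (fun t => f t - g t).
Proof.
move=> pf pg; have [] // := @wnorm_le2 _ _ _ (fun t => f t - g t) f g 1 1 ler01 ler01 _ pf pg.
  by apply: smB; exact: Lpw_sm.
by apply: aeW => t _; rewrite !mul1r nrmB.
Qed.

Lemma Lpw_cutoff (V : normedModType R[i]) (f : R -> V) A : measurable A ->
  in_Lpw p a D f -> in_Lpw p a D (cutoff A f) /\ N (cutoff A f) <= N f.
Proof.
move=> mA pf; have [] := @wnorm_le _ _ (cutoff A f) f 1 ler01 _ pf.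
- by apply: sm_cutoff => //; exact: Lpw_sm.
- by apply: aeW => t _; rewrite mul1r nrm_cutoff_le.
by rewrite mul1r.
Qed.

Lemma wnorm_cutoff_sub (V : normedModType R[i]) (f : R -> V) A A' : measurable A ->
  measurable A' -> A `<=` A' -> in_Lpw p a D f -> N (cutoff A f) <= N (cutoff A' f).
Proof.
move=> mA mA' AA' pf.
have [] := @wnorm_le _ _ (cutoff A f) (cutoff A' f) 1 ler01.
- by apply: sm_cutoff => //; exact: Lpw_sm.
- by have [] := Lpw_cutoff mA' pf.
- apply: aeW => t _; rewrite mul1r; have [At|At] := pselect (A t).
    by rewrite !cutoff_in //; exact: AA'.
  by rewrite cutoff_out // nrm0 nrm_ge0.
by rewrite mul1r.
Qed.

Lemma wnorm_small (V : normedModType R[i]) (f : R -> V) (A : nat -> set R) (e : R) :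
  in_Lpw p a D f -> 0 < e -> (forall n, measurable (A n)) ->
  {ae mu, forall t, D t -> (\1_(A n) t : R) @[n --> \oo] --> 0} ->
  \forall n \near \oo, N (cutoff (A n) f) < e.
Proof.
move=> pf e0 mA A0; have := Lpw_small p1 pf e0 mA A0; apply: filterS => n.
by have [pc _] := Lpw_cutoff (mA n) pf; rewrite wnormE.
Qed.

Lemma wnorm_eq0 (V : normedModType R[i]) (f : R -> V) :
  in_Lpw p a D f -> N f <= 0 -> {ae mu, forall t, D t -> f t = 0}.
Proof.
move=> pf Nf; apply: (Lpw_norm_eq0 p1 pf); rewrite wnormE //; congr EFin.
by apply/eqP; rewrite eq_le Nf wnorm_ge0.
Qed.

Lemma wnorm_complete (V : completeNormedModType R[i]) (f : nat -> R -> V) (C : R) :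
  (forall n, in_Lpw p a D (f n)) ->
  (forall n, N (fun t => f n.+1 t - f n t) <= C * 4^-1 ^+ n) ->
  exists g : R -> V, [/\ in_Lpw p a D g,
    {ae mu, forall t, D t -> f n t @[n --> \oo] --> g t} &
    forall n, N (fun t => g t - f n t) <= 2 * C * 4^-1 ^+ n].
Proof.
move=> pf fC; have [|g [pg cg gC]] := Lpw_complete p1 (C := C) pf.
  by move=> n; rewrite wnormE ?lee_fin //; exact: LpwB.
exists g; split => // n; have := gC n; rewrite wnormE ?lee_fin //; exact: LpwB.
Qed.
End WeightedNorm.

Section AEPick.
Context {R : realType}.
Local Notation mu := (@lebesgue_measure R).

(** A null set contains no nonempty open interval. *)
Lemma ae_pick (P : R -> Prop) (x y : R) : x < y -> {ae mu, forall t, P t} ->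
  exists2 t, x < t < y & P t.
Proof.
move=> xy [N [mN N0 PN]]; apply: contrapT => h.
have mI : measurable (`]x, y[%classic : set R) by exact: measurable_itv.
have : (mu `]x, y[ <= mu N)%E.
  apply: le_measure; rewrite ?inE //.
  move=> t /=; rewrite in_itv /= => xty; apply: PN => Pt; apply: h.
  by exists t.
rewrite N0 lebesgue_measure_itv /= lte_fin xy -EFinB lee_fin; apply/negP.
by rewrite -ltNge subr_gt0.
Qed.

Lemma mu_setT_gt0 : (0 < mu setT)%E.
Proof.
apply: (@lt_le_trans _ _ (mu `]0, 1[)).
  by rewrite lebesgue_measure_itv /= lte_fin ltr01 -EFinB lte_fin subr0.
by apply: le_measure; rewrite ?inE //; exact: (measurable_itv `]0, 1[).
Qed.

Lemma Lp_norm_oo_ae (V : normedModType R[i]) D (f : R -> V) (c : R) :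
  (Lp_norm +oo D f <= c%:E)%E -> {ae mu, forall t, D t -> nrm (f t) <= c}.
Proof.
rewrite /Lp_norm unlock mu_setT_gt0 => /ess_supP.
apply: aeS => t /= + Dt; rewrite /patch mem_set //= lee_fin.
by rewrite ger0_norm ?nrm_ge0.
Qed.
End AEPick.

(** * Convolutions *)

Section Convolution.
Context {R : realType} {X U E : completeNormedModType R[i]}.
Local Notation mu := (@lebesgue_measure R).
Variables (Tk : R -> {linear E -> E}) (B : {linear U -> E}).
Hypotheses (TkC0 : C0_semigroup Tk) (Bb : bounded_op B).
Implicit Types u : R -> U.

Let mD (t : R) : measurable (`[0, t]%classic : set R).
Proof. exact: measurable_itv. Qed.
Let fD (t : R) : (mu `[0%R, t] < +oo)%E.
Proof. exact: mu_itv_lty. Qed.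

Lemma conv_sm u t : strongly_measurable `]0, t[ u ->
  strongly_measurable `[0, t] (fun s => Tk (t - s) (B (u s))).
Proof.
move=> su; apply: (@sm_ae_dom _ _ _ `]0, t[).
  by apply: aeS (ae_itv_cc 0 t) => s [].
apply: (@sm_family _ _ _ (fun s => Tk (t - s))); last exact: sm_map su.
  move=> s /andP[s0 st]; have [M _ hM] := semigroup_bounded TkC0 t.
  exists 1, M; split => // s' /andP[s'0 s't] _ e; apply: hM.
  by rewrite subr_ge0 gerBl !ltW.
move=> s e eps /andP[s0 st] eps0.
have ts : 0 <= t - s by rewrite subr_ge0 ltW.
have [d d0 hd] := semigroup_continuous TkC0 e ts eps0.
exists d => // s' /andP[s'0 s't] ss'; apply: hd; first by rewrite subr_ge0 ltW.
by rewrite opprB addrC addrA subrK distrC.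
Qed.

Lemma conv_uniq u t v w : conv_at Tk B u t v -> conv_at Tk B u t w -> v = w.
Proof. by move=> cv cw; exact: (bochner_uniq (mD t) (fD t) cv cw). Qed.

Lemma conv_ae u u' t v : {ae mu, forall s, `[0, t]%classic s -> u s = u' s} ->
  conv_at Tk B u t v -> conv_at Tk B u' t v.
Proof. by move=> uu'; apply: bochner_ae; apply: aeS uu' => s h /h ->. Qed.

Lemma convB u u' t v v' : conv_at Tk B u t v -> conv_at Tk B u' t v' ->
  conv_at Tk B (fun s => u s - u' s) t (v - v').
Proof.
move=> cu cu'; have := bochnerB (mD t) cu cu'; apply: bochner_ae.
by apply: aeW => s _; rewrite !linearB.
Qed.

Lemma conv0 u t : {ae mu, forall s, `[0, t]%classic s -> u s = 0} ->
  conv_at Tk B u t 0.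
Proof.
move=> u0; apply: (@bochner_ae _ _ _ (fun=> 0)).
  by apply: aeS u0 => s h /h ->; rewrite !linear0.
have [||v bv] := @bochner_exists _ _ (mD t) (fD t) E (fun=> 0).
- by exists (fun=> sf_zero); apply: aeW => s _; under eq_fun do rewrite sf_zeroE; exact: cvg_cst.
- by under eq_integral do rewrite nrm0; rewrite integral0.
have := bochner_norm (mD t) (fD t) bv.
under eq_integral do rewrite nrm0.
rewrite integral0 lee_fin => v0.
suff /nrm_eq0 v00 : nrm v = 0 by rewrite v00 in bv.
by apply/eqP; rewrite eq_le v0 nrm_ge0.
Qed.

(** After the input has stopped, the state evolves freely: the semigroup law lets the operator at
    time t - s be taken out of the integral. *)
Lemma conv_shift u s t v : 0 <= s <= t ->
  {ae mu, forall r, s < r <= t -> u r = 0} ->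
  conv_at Tk B u s v -> conv_at Tk B u t (Tk (t - s) v).
Proof.
have [Tb _ TD _] := TkC0 => /andP[s0 st] u0 cu.
have ts : 0 <= t - s by rewrite subr_ge0.
have sub : `[0, s]%classic `<=` `[0, t]%classic.
  by move=> r /=; rewrite !in_itv /= => /andP[-> /le_trans]; exact.
apply: (bochner_extend (mD s) sub).
  apply: aeS u0 => r h; rewrite /= !in_itv /= => /andP[r0 rt] nrs.
  rewrite h ?linear0 // rt andbT ltNge; apply/negP => rs; apply: nrs.
  by rewrite r0.
have := bochner_map (mD s) (Tb _ ts) cu; apply: bochner_ae; apply: aeW => r.
rewrite /= in_itv /= => /andP[r0 rs].
by rewrite -TD ?subr_ge0 // addrA subrK.
Qed.

Lemma conv_int_le u t : exists2 M, 0 <= M &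
  forall s, `[0, t]%classic s -> nrm (Tk (t - s) (B (u s))) <= M * nrm (u s).
Proof.
have [M M1 hM] := semigroup_bounded TkC0 t; have [K hK] := Bb.
have M0 : 0 <= M := le_trans ler01 M1.
exists (M * `|K|) => [|s]; first by rewrite mulr_ge0.
rewrite /= in_itv /= => /andP[s0 st].
apply: le_trans (hM _ _ _) _; first by rewrite subr_ge0 st gerBl.
rewrite -mulrA ler_wpM2l // (le_trans (hK _)) // ler_wpM2r ?nrm_ge0 //.
exact: ler_norm.
Qed.

Section Admissible.
Variables (p a : R) (p1 : 1 <= p).
Variables (T : R -> {linear X -> X}) (TC0 : C0_semigroup T).
Variables (j : {linear X -> E}) (jb : bounded_op j) (j0 : forall x, j x = 0 -> x = 0).
Hypothesis Tj : extends_semigroup j T Tk.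
Hypothesis adm : ctrl_admissible p a j Tk B.
Variables (tau : R) (tau0 : 0 < tau).
Local Notation N := (wnorm p a tau).
Local Notation Lp := (in_Lpw p a `]0, tau[).

Let jinj x y : j x = j y -> x = y.
Proof. by move=> h; apply/subr0_eq/j0; rewrite linearB h subrr. Qed.

(* Admissibility bounds the convolution at almost every time only: if u vanishes
   on (s, t], pick a good time r in between and apply the semigroup up to t. *)
Lemma conv_value_vanishing : exists2 K, 0 <= K & forall u s t, Lp u ->
  0 <= s -> s < t -> t <= tau -> {ae mu, forall r, s < r <= t -> u r = 0} ->
  exists2 w, conv_at Tk B u t (j w) & nrm w <= K * N u.
Proof.
have [_ /(_ tau tau0)[K hK]] := adm.
have [M M1 hM] := semigroup_bounded TC0 tau.
have M0 : 0 <= M := le_trans ler01 M1.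
exists (M * `|K|) => [|u s t pu s0 st tt u0]; first by rewrite mulr_ge0.
have [w [cw _ wK]] := hK u pu.
have wn : {ae mu, forall r, `]0, tau[%classic r -> nrm (w r) <= K * N u}.
  by apply: Lp_norm_oo_ae; rewrite EFinM -wnormE.
have [r /andP[sr rt] [r1 r2]] : exists2 r, s < r < t & (conv_at Tk B u r (j (w r))
    /\ nrm (w r) <= K * N u).
  have [r str [h1 h2]] := ae_pick st (aeS2 (fun r h1 h2 => conj h1 h2) cw wn).
  exists r => //; have D0 : `]0, tau[%classic r.
    rewrite /= in_itv /=; move/andP: str => [sr rt].
    by rewrite (le_lt_trans s0 sr) (lt_le_trans rt tt).
  by split; [exact: h1|exact: h2].
have r0 : 0 <= r := le_trans s0 (ltW sr).
exists (T (t - r) (w r)).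
  rewrite -Tj ?subr_ge0 ?(ltW rt) //; apply: conv_shift r1.
    by rewrite r0 ltW.
  by apply: aeS u0 => q h /andP[rq qt]; apply: h; rewrite (lt_trans sr rq).
apply: le_trans (hM _ _ _) _.
  by rewrite subr_ge0 (ltW rt) (le_trans _ tt) // gerBl.
rewrite -mulrA ler_wpM2l // (le_trans r2) // ler_wpM2r ?wnorm_ge0 //.
exact: ler_norm.
Qed.

(** The offset n + 2 keeps [tn t 0] strictly between 0 and t, so that it also serves as a lower
    limit away from the weight's singularity. *)
Let tn (t : R) n := t - t / n.+2%:R.

Let tn_prop t n : 0 < t -> 0 < tn t n < t.
Proof.
move=> t0; rewrite /tn subr_gt0 ltr_pdivrMr // ltr_pMr // ltr1n /=.
by rewrite gtrBl divr_gt0.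
Qed.

Let tn_le t n m : 0 < t -> (n <= m)%N -> tn t n <= tn t m.
Proof.
move=> t0 nm; rewrite /tn lerD2l lerN2 ler_pM2l // lef_pV2 ?posrE //.
by rewrite ler_nat.
Qed.

Let tn_cut t r : r < t -> (\1_`]tn t n, t[%classic r : R) @[n --> \oo] --> 0.
Proof.
move=> rt; apply/cvgr0Pnorm_lt => e e0.
have : (t / n.+2%:R) @[n --> \oo] --> (0 : R).
  rewrite -(mulr0 t); apply: cvgMr.
  by have := @cvg_harmonic R; rewrite -(cvg_shiftS (fun n => n.+1%:R^-1 : R)).
move=> /cvgr0Pnorm_lt/(_ (t - r)); rewrite subr_gt0 => /(_ rt).
apply: filterS => n hn; rewrite indicE memNset ?normr0 //=.
rewrite in_itv /= /tn => /andP[h _].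
have hq : t / n.+2%:R < t - r := le_lt_trans (ler_norm _) hn.
by move: h; rewrite ltrBlDr -ltrBlDl ltNge (ltW hq).
Qed.

(* Every u is the limit of its truncations to [0, t - t/(n+2)], which vanish
   before t. *)
Lemma conv_value : exists2 K, 0 <= K & forall u t, Lp u -> 0 <= t <= tau ->
  exists2 w, conv_at Tk B u t (j w) & nrm w <= K * N u.
Proof.
have [K K0 hK] := conv_value_vanishing; exists K => // u t pu /andP[].
rewrite le_eqVlt => /orP[/eqP <- _|t0 tt].
  exists 0; last by rewrite nrm0 mulr_ge0 ?wnorm_ge0.
  rewrite linear0; apply: conv0; apply: aeS (ae_neq 0) => s s0.
  by rewrite /= in_itv /= -eq_le eq_sym => /eqP.
have mc (n : nat) : measurable (`[0, tn t n]%classic : set R) by exact: measurable_itv.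
pose u_ n := cutoff `[0, tn t n] u.
have pu_ n : Lp (u_ n) by have [] := Lpw_cutoff p1 (mc n) pu.
have /choice[w /all_and2[cw wK]] : forall n, exists w, conv_at Tk B (u_ n) t (j w) /\
    nrm w <= K * N (u_ n).
  move=> n; have /andP[n0 nt] := tn_prop n t0.
  have [|w cw wK] := hK (u_ n) (tn t n) t (pu_ n) (ltW n0) nt tt; last by exists w.
  apply: aeW => r /andP[nr rt]; apply: cutoff_out => /=.
  by rewrite in_itv /= [_ <= tn _ _]leNgt nr andbF.
have mo (x y : R) : measurable (`]x, y[%classic : set R) by exact: measurable_itv.
have small e : 0 < e -> \forall n \near \oo, N (cutoff `]tn t n, t[ u) < e.
  move=> e0; apply: (wnorm_small p1 pu e0 (fun n => mo _ _)).
  apply: aeS (ae_neq t) => r /eqP rt _.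
  have [/tn_cut //|tr] := ltP r t.
  have -> : (fun n => \1_`]tn t n, t[%classic r : R) = cst 0.
    apply/funext => n; rewrite indicE memNset //= in_itv /= => /andP[_].
    by rewrite ltNge tr.
  exact: cvg_cst.
(* The difference of the two truncations vanishes after [tn t m], which is below t, so [hK] applies
   to it; its norm is at most that of a tail of [u]. *)
have diff n m : (n <= m)%N -> nrm (w n - w m) <= K * N (cutoff `]tn t n, t[ u).
  move=> nm; have /andP[n0 nt] := tn_prop n t0; have /andP[m0 mt] := tn_prop m t0.
  have nmt := tn_le t0 nm.
  have pd := LpwB p1 (pu_ m) (pu_ n).
  have [|w' cw' w'K] := hK _ (tn t m) t pd (ltW m0) mt tt.
    apply: aeW => r /andP[mr rt]; rewrite /u_ !cutoff_out ?subrr //=.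
      by rewrite in_itv /= [_ <= tn _ _]leNgt (le_lt_trans nmt mr) andbF.
    by rewrite in_itv /= [_ <= tn _ _]leNgt mr andbF.
  have -> : w n - w m = - w'.
    rewrite (_ : w' = w m - w n) ?opprB //; apply: jinj.
    by rewrite linearB; apply: conv_uniq cw' _; exact: convB.
  rewrite nrmN (le_trans w'K) // ler_wpM2l //.
  have [|||_] := @wnorm_le _ p a tau p1 _ _ (fun s => u_ m s - u_ n s) (cutoff `]tn t n, t[ u) 1 ler01.
  - exact: Lpw_sm pd.
  - by have [] := Lpw_cutoff p1 (mo (tn t n) t) pu.
  - apply: aeW => r; rewrite /= in_itv /= mul1r => /andP[r0 rt].
    have [rn|rn] := leP r (tn t n).
      have i1 : `[0, tn t n]%classic r by rewrite /= in_itv /= (ltW r0).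
      have i2 : `[0, tn t m]%classic r by rewrite /= in_itv /= (ltW r0) (le_trans rn).
      by rewrite /u_ (cutoff_in u i1) (cutoff_in u i2) subrr nrm0 nrm_ge0.
    rewrite [u_ n r]cutoff_out ?subr0; last by rewrite /= in_itv /= [_ <= tn _ _]leNgt rn andbF.
    have [rm|rm] := leP r (tn t m).
      have i2 : `[0, tn t m]%classic r by rewrite /= in_itv /= (ltW r0).
      have i3 : `]tn t n, t[%classic r by rewrite /= in_itv /= rn (le_lt_trans rm).
      by rewrite /u_ (cutoff_in u i2) (cutoff_in u i3).
    rewrite /u_ cutoff_out ?nrm0 ?nrm_ge0 //= in_itv /= [_ <= tn _ _]leNgt rm andbF //.
  by rewrite mul1r.
have [l wl] : exists l : X, w @ \oo --> l.
  apply: nrm_cauchy_cvg => e e0.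
  have e1 : 0 < e / (K + 1) by rewrite divr_gt0 // ltr_wpDl.
  have [M _ hM] := small _ e1; exists M => n m Mn Mm.
  wlog nm : n m Mn Mm / (n <= m)%N => [hw|].
    by have [|/ltnW] := leqP n m; [|rewrite nrm_distC]; exact: hw.
  apply: le_lt_trans (diff _ _ nm) _; have := hM n Mn; rewrite /= ltr_pdivlMr ?ltr_wpDl //.
  apply: le_lt_trans; rewrite mulrC ler_wpM2l ?wnorm_ge0 // lerDl //.
exists l; last first.
  apply: (nrm_lim_le wl); apply: nearW => n; apply: le_trans (wK n) _.
  by rewrite ler_wpM2l //; have [] := Lpw_cutoff p1 (mc n) pu.
have su : strongly_measurable `]0, t[ u.
  apply: sm_sub (Lpw_sm pu) => r /=; rewrite !in_itv /= => /andP[-> h].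
  exact: lt_le_trans h tt.
have [M M0 hM] := conv_int_le u t.
have /andP[t00 t0t] := tn_prop 0%N t0.
have it0 : (\int[mu]_(s in `]tn t 0%N, t[) (nrm (u s))%:E < +oo)%E.
  have := Lpw_int_lty p1 t00 pu; apply: le_lt_trans.
  have sub : `]tn t 0%N, t[%classic `<=` `]tn t 0%N, tau[%classic.
    by move=> r /=; rewrite !in_itv /= => /andP[-> h]; exact: lt_le_trans h tt.
  rewrite -[in leLHS](setIidr sub) integral_mkcondr.
  apply: ge0_ae_le_integral_nomeas => [s _|s _|].
  - by rewrite /patch; case: ifP => // _; rewrite lee_fin nrm_ge0.
  - by rewrite lee_fin nrm_ge0.
  by apply: aeW => s _; rewrite /patch; case: ifP => // _; rewrite lee_fin nrm_ge0.
have tail_le n : (\int[mu]_(s in `[0%R, t]) (nrm (Tk (t - s) (B (u s - u_ n s)))%R)%:E <=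
    M%:E * \int[mu]_(s in `]tn t 0%N, t[) (nrm (cutoff `]tn t n, t[ u s))%:E)%E.
  have sub : `]tn t 0%N, t[%classic `<=` `[0, t]%classic.
    move=> r /=; rewrite !in_itv /= => /andP[h h'].
    by rewrite (ltW h') (le_trans (ltW t00) (ltW h)).
  have s1 : strongly_measurable `]tn t 0%N, t[ (cutoff `]tn t n, t[ u).
    apply: sm_cutoff => //; apply: sm_sub su => r /=; rewrite !in_itv /= => /andP[h ->].
    by rewrite (lt_trans t00 h).
  rewrite -int_nrmZ // -[X in (_ <= \int[_]_(_ in X) _)%E](setIidr sub) integral_mkcondr.
  apply: ge0_ae_le_integral_nomeas => [s _|s _|].
  - by rewrite lee_fin nrm_ge0.
  - by rewrite /patch; case: ifP => // _; rewrite lee_fin mulr_ge0 ?nrm_ge0.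
  apply: aeS (ae_neq t) => s /eqP st Ds.
  have nn := tn_le t0 (leq0n n).
  move: (Ds); rewrite /= in_itv /= => /andP[s0 st'].
  have st2 : s < t by rewrite lt_neqAle st.
  have [sn|sn] := leP s (tn t n).
    rewrite /u_ cutoff_in ?subrr ?linear0 ?nrm0 /=; last by rewrite in_itv /= s0.
    by rewrite /patch; case: ifP => // _; rewrite lee_fin mulr_ge0 ?nrm_ge0.
  rewrite /u_ cutoff_out ?subr0; last by rewrite /= in_itv /= [_ <= tn _ _]leNgt sn andbF.
  rewrite /patch mem_set; last by rewrite /= in_itv /= st2 (le_lt_trans nn).
  by rewrite cutoff_in ?lee_fin ?hM //= in_itv /= sn.
(* Near 0, integrability follows from the existence of the convolution of [u_ 0]; near t it follows
   from [it0]. *)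
have Ifin : (\int[mu]_(s in `[0%R, t]) (nrm (Tk (t - s) (B (u s)))%R)%:E < +oo)%E.
  apply: (@le_lt_trans _ _ (\int[mu]_(s in `[0%R, t]) (nrm (Tk (t - s) (B (u s - u_ 0%N s)))%R)%:E +
    \int[mu]_(s in `[0%R, t]) (nrm (Tk (t - s) (B (u_ 0%N s)))%R)%:E)%E).
    apply: int_nrm_le2 => //.
    - apply: (@conv_sm (fun s => u s - u_ 0%N s)); apply: smB => //.
      exact: (sm_cutoff (mc 0%N)).
    - by apply: conv_sm; exact: (sm_cutoff (mc 0%N)).
    apply: aeW => s _; rewrite -{1}[u s](subrK (u_ 0%N s)) !linearD; exact: nrmD.
  rewrite lte_add_pinfty //; last exact: bochner_lty (cw 0%N).
  apply: le_lt_trans (tail_le 0%N) _; rewrite lte_mul_pinfty ?lee_fin //.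
  apply: le_lt_trans it0; apply: int_nrm_le; apply: aeW => s _; exact: nrm_cutoff_le.
have [v cv] := bochner_exists (mD t) (fD t) (conv_sm su) Ifin.
(* Both sides are limits of [j (w n)]: the left one since [j] is bounded, the right one by
   [tail_le]. *)
suff -> : j l = v by [].
have jw : j (w n) @[n --> \oo] --> j l by exact: bounded_op_cvg.
apply: (cvg_unique _ jw) => //.
have [g gl ug] : exists2 g, simple_limit g &
    {ae mu, forall s, `]tn t 0%N, t[%classic s -> u s = g s}.
  apply: sm_simple_limit; first exact: mo.
  apply: sm_sub su => r /=; rewrite !in_itv /= => /andP[h ->].
  by rewrite (lt_trans t00 h).
have tail0 : (M%:E * \int[mu]_(s in `]tn t 0%N, t[) (nrm (cutoff `]tn t n, t[ u s))%:E @[n --> \oo] --> 0)%E.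
  rewrite -[X in _ --> X](mule0 M%:E); apply: cvgeZl => //.
  rewrite (_ : (fun n => _) = (fun n => \int[mu]_(s in `]tn t 0%N, t[)
      (\1_`]tn t n, t[%classic s * nrm (g s))%R%:E)%E); last first.
    apply/funext => n; apply: ge0_ae_eq_integral_nomeas => [s _|s _|].
    - by rewrite lee_fin nrm_ge0.
    - by rewrite lee_fin mulr_ge0 ?nrm_ge0.
    apply: aeS ug => s ug Ds; rewrite /cutoff nrmZ ger0_norm // ug //.
  have mg := simple_limit_nrm gl.
  apply: (@dominated_cvg0 _ _ _ (fun s => nrm (g s))) => //.
  - move=> n; apply: measurable_funM; last exact: measurable_funTS.
    by apply: measurable_indic; exact: mo.
  - exact: measurable_funTS.
  - apply: aeW => s; rewrite /= in_itv /= => /andP[_ st].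
    by rewrite -(mul0r (nrm (g s))); apply: cvgMl; exact: tn_cut.
  - by move=> n s _; rewrite mulr_ge0 ?nrm_ge0 //= ler_piMl ?nrm_ge0.
  rewrite -(int_nrm_ae ug); exact: it0.
have /fine_cvgP[near_fin near0] := tail0.
apply: (nrm_squeeze _ near0); apply: filterS near_fin => n hfin.
rewrite nrm_distC -lee_fin /= fineK //; apply: le_trans (tail_le n).
have cv' : conv_at Tk B u t v := cv.
exact: (bochner_norm (mD t) (fD t) (convB cv' (cw n))).
Qed.
End Admissible.
End Convolution.

(** * Causality, evolution and continuity of the convolution *)

Section Trajectory.
Context {R : realType} {X U E : completeNormedModType R[i]}.
Local Notation mu := (@lebesgue_measure R).
Variables (Tk : R -> {linear E -> E}) (B : {linear U -> E}).
Hypotheses (TkC0 : C0_semigroup Tk) (Bb : bounded_op B).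
Variables (p a : R) (p1 : 1 <= p).
Variables (T : R -> {linear X -> X}) (TC0 : C0_semigroup T).
Variables (j : {linear X -> E}) (j0 : forall x, j x = 0 -> x = 0).
Hypothesis Tj : extends_semigroup j T Tk.
Variables (tau : R).
Local Notation N := (wnorm p a tau).
Local Notation Lp := (in_Lpw p a `]0, tau[).
Local Notation conv := (conv_at Tk B).
Variables (K : R) (K0 : 0 <= K).
Hypothesis hK : forall u t, Lp u -> 0 <= t <= tau ->
  exists2 w, conv u t (j w) & nrm w <= K * N u.
Implicit Types u : R -> U.

Let jinj x y : j x = j y -> x = y.
Proof. by move=> h; apply/subr0_eq/j0; rewrite linearB h subrr. Qed.

Let mcc (x y : R) : measurable (`[x, y]%classic : set R).
Proof. exact: measurable_itv. Qed.
Let moc (x y : R) : measurable (`]x, y]%classic : set R).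
Proof. exact: measurable_itv. Qed.

Lemma conv_cutoff u s t v : t <= s -> conv (cutoff `[0, s] u) t v <-> conv u t v.
Proof.
move=> ts; split; apply: conv_ae; apply: aeW => r; rewrite /= in_itv /= => /andP[r0 rt].
  by rewrite cutoff_in //= in_itv /= r0 (le_trans rt).
by rewrite cutoff_in //= in_itv /= r0 (le_trans rt).
Qed.

(** Causality: at time t the input may be replaced by its truncation to [0, t] before [hK] is
    applied. *)
Lemma conv_bound u t w : Lp u -> 0 <= t <= tau -> conv u t (j w) ->
  nrm w <= K * N (cutoff `[0, t] u).
Proof.
move=> pu tt cw; have [pc _] := Lpw_cutoff p1 (mcc 0 t) pu.
have [w' cw' w'K] := hK pc tt.
have [h _] := @conv_cutoff u t t (j w') (lexx _).
by rewrite (jinj (conv_uniq cw (h cw'))).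
Qed.

(** Subtracting the free evolution of the state reached at s leaves the convolution of the input
    restricted to ]s, t]. *)
Lemma conv_evolution u s t w w' : Lp u -> 0 <= s -> s <= t -> t <= tau ->
  conv u s (j w) -> conv u t (j w') ->
  nrm (w' - T (t - s) w) <= K * N (cutoff `]s, t] u).
Proof.
move=> pu s0 st tt cw cw'.
have ts : 0 <= t - s by rewrite subr_ge0.
have cs : conv (cutoff `[0, s] u) t (j (T (t - s) w)).
  rewrite -Tj //; apply: (conv_shift TkC0 (s := s)); first by rewrite s0.
    by apply: aeW => r /andP[sr _]; rewrite cutoff_out //= in_itv /= [r <= s]leNgt sr andbF.
  exact/conv_cutoff.
have [pc _] := Lpw_cutoff p1 (moc s t) pu.
have t0 : 0 <= t <= tau by rewrite (le_trans s0).
have [v cv vK] := hK pc t0.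
suff -> : w' - T (t - s) w = v by [].
apply: jinj; rewrite linearB; apply: conv_uniq cv.
have := convB cw' cs; apply: conv_ae; apply: aeW => r; rewrite /= in_itv /= => /andP[r0 rt].
have [rs|sr] := leP r s.
  rewrite cutoff_in /=; last by rewrite in_itv /= r0.
  by rewrite subrr cutoff_out //= in_itv /= [s < r]ltNge rs.
rewrite cutoff_out /=; last by rewrite in_itv /= [r <= s]leNgt sr andbF.
by rewrite subr0 cutoff_in //= in_itv /= sr.
Qed.

(** The values at two nearby times are both compared with the free evolution from one earlier time.
    The errors are bounded by the norm of [u] on a short window around t, small by absolute
    continuity, and the free evolution is continuous. *)
Lemma conv_continuous u (w : R -> X) : Lp u ->
  (forall t, 0 <= t <= tau -> conv u t (j (w t))) ->
  {within `[0, tau], continuous w}.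
Proof.
move=> pu cw; apply/nrm_continuousP => t; rewrite /= in_itv /= => /andP[t0 tt] e e0.
pose A (n : nat) : set R := `[t - n.+1%:R^-1, t + n.+1%:R^-1]%classic.
have mA n : measurable (A n) by exact: measurable_itv.
have K1 : 0 < 3 * (K + 1) by rewrite mulr_gt0 // ltr_wpDl.
have A0 : {ae mu, forall r, `]0, tau[%classic r -> (\1_(A n) r : R) @[n --> \oo] --> 0}.
  apply: aeS (ae_neq t) => r /eqP rt _; apply/cvgr0Pnorm_lt => e' e'0.
  have := @cvg_harmonic R => /cvgr0Pnorm_lt/(_ `|r - t|).
  rewrite normr_gt0 subr_eq0 => /(_ rt); apply: filterS => n /=.
  rewrite ger0_norm ?invr_ge0 // => hn; have nA : ~ A n r.
    rewrite /A /= in_itv /= => /andP[h1 h2].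
    move: hn; rewrite ltNge => /negP; apply.
    by rewrite ler_distl h1 h2.
  by rewrite indicE memNset // normr0.
have [n _ hn] := wnorm_small p1 pu (divr_gt0 e0 K1) mA A0.
have {}hn : K * N (cutoff (A n) u) <= e / 3.
  have h : N (cutoff (A n) u) <= e / (3 * (K + 1)) by apply/ltW/hn => /=.
  apply: (@le_trans _ _ ((K + 1) * (e / (3 * (K + 1))))).
    apply: ler_pM; rewrite ?wnorm_ge0 //; by rewrite lerDl.
  by rewrite le_eqVlt; apply/orP; left; apply/eqP; field; rewrite gt_eqF // ltr_wpDl.
(* The common earlier time, cut at 0. Beyond it, all times up to t + 1 / (n + 1) lie in the window
   [A n]. *)
pose s0 := Num.max 0 (t - n.+1%:R^-1).
have n0 : 0 < n.+1%:R^-1 :> R by rewrite invr_gt0.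
have s00 : 0 <= s0 by rewrite le_max lexx.
have s0t : s0 <= t by rewrite ge_max t0 gerBl ltW.
have sub r : r <= t + n.+1%:R^-1 -> `]s0, r]%classic `<=` A n.
  move=> rt q; rewrite /= in_itv /= gt_max => /andP[/andP[_ q1] q2].
  by rewrite /A /= in_itv /= (ltW q1) (le_trans q2).
have cs0 : conv u s0 (j (w s0)) by apply: cw; rewrite s00 (le_trans s0t).
have ev r : s0 <= r -> r <= tau -> r <= t + n.+1%:R^-1 ->
    nrm (w r - T (r - s0) (w s0)) <= e / 3.
  move=> sr rtau rt; apply: le_trans hn.
  apply: le_trans (conv_evolution pu s00 sr rtau cs0 (cw r _)) _.
    by rewrite (le_trans s00).
  by rewrite ler_wpM2l // wnorm_cutoff_sub //; exact: sub.
have ts0 : 0 <= t - s0 by rewrite subr_ge0.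
have e3 : 0 < e / 3 by rewrite divr_gt0.
have [d d0 hd] := semigroup_continuous TC0 (w s0) ts0 e3.
exists (Num.min d n.+1%:R^-1) => [|r]; first by rewrite lt_min d0.
rewrite /= in_itv /= lt_min => /andP[r0 rtau] /andP[rd rn].
have /andP[rn1 rn2] : (t - n.+1%:R^-1 <= r) && (r <= t + n.+1%:R^-1).
  by rewrite -ler_distl ltW.
have sr : s0 <= r by rewrite ge_max r0.
have h1 := ev r sr rtau rn2.
have h2 : nrm (w t - T (t - s0) (w s0)) <= e / 3 by apply: ev => //; rewrite lerDl ltW.
have h3 : nrm (T (r - s0) (w s0) - T (t - s0) (w s0)) < e / 3.
  by apply: hd; rewrite ?subr_ge0 // opprB addrA subrK.
have := nrm_tri (T (t - s0) (w s0)) (w r) (w t).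
have := nrm_tri (T (r - s0) (w s0)) (w r) (T (t - s0) (w s0)).
rewrite [nrm (T (t - s0) (w s0) - w t)]nrm_distC; lra.
Qed.
End Trajectory.

(** * Pointwise Lipschitz estimate and measurability of the nonlinearity *)

Section Nonlinearity.
Context {R : realType} {X U Y Z : completeNormedModType R[i]}.
Local Notation mu := (@lebesgue_measure R).

(** For an unbounded map the infimum runs over the empty set and is 0 by convention, hence the
    boundedness hypothesis. *)
Lemma opnormP (V W : normedModType R[i]) (f : V -> W) y :
  f 0 = 0 -> bounded_op f -> nrm (f y) <= opnorm f * nrm y.
Proof.
move=> f0 [M hM]; have [->|y0] := eqVneq y 0; first by rewrite f0 !nrm0 mulr0.
have ny : 0 < nrm y by rewrite lt0r nrm_ge0 andbT; apply: contraNneq y0 => /nrm_eq0 ->.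
rewrite -ler_pdivrMr //; apply: lb_le_inf.
  exists `|M|; split => // x; apply: le_trans (hM x) _.
  by rewrite ler_wpM2r ?nrm_ge0 // ler_norm.
by move=> M' [_ hM']; rewrite ler_pdivrMr.
Qed.

Variables (F : X -> {linear Y -> U}).
Hypothesis Fb : forall x, bounded_op (F x).
Hypothesis FL : exists L : R, forall x x' : X,
  opnorm (fun y => F x y - F x' y) <= L * nrm (x - x').

Lemma lipschitz_pointwise : exists2 L : R, 0 < L & forall x x' y,
  nrm (F x y - F x' y) <= L * nrm (x - x') * nrm y.
Proof.
have [L hL] := FL; exists (`|L| + 1) => [|x x' y]; first by rewrite ltr_wpDl.
apply: le_trans (opnormP (f := fun y => F x y - F x' y) y _ _) _.
- by rewrite !linear0 ?subrr ?addr0.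
- have [M hM] := Fb x; have [M' hM'] := Fb x'; exists (M + M') => z.
  by rewrite mulrDl (le_trans (nrmB _ _)) // lerD.
rewrite ler_wpM2r ?nrm_ge0 // (le_trans (hL _ _)) // ler_wpM2r ?nrm_ge0 //.
by rewrite (le_trans (ler_norm _)) // lerDl.
Qed.

(** Along a continuous [x] the operators [F (x s)] are locally bounded and strongly continuous, as
    [sm_family] requires. *)
Lemma sm_nonlinear (tau : R) (x : R -> X) (y : R -> Y) :
  {within `[0, tau], continuous x} -> strongly_measurable `]0, tau[ y ->
  strongly_measurable `]0, tau[ (fun t => F (x t) (y t)).
Proof.
move=> /nrm_continuousP xc; have [L L0 hL] := lipschitz_pointwise.
have sub s : 0 < s < tau -> `[0, tau]%classic s.
  by move=> /andP[s0 st]; rewrite /= in_itv /= !ltW.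
apply: (@sm_family _ _ _ (fun s => F (x s))) => s.
  move=> st; have [d d0 hd] := xc s (sub s st) 1 ltr01.
  have [M hM] := Fb (x s); exists d, (L + M); split => // s' s't ss' e.
  have h1 := hL (x s') (x s) e; have h2 := hd s' (sub s' s't) ss'.
  have := nrm_tri (F (x s) e) (F (x s') e) 0; rewrite !subr0 mulrDl.
  move/le_trans; apply; apply: lerD => //; apply: le_trans h1 _.
  by rewrite ler_wpM2r ?nrm_ge0 // ger_pMr // ltW.
move=> e eps st eps0.
have D0 : 0 < L * (nrm e + 1) by rewrite mulr_gt0 // ltr_wpDl ?nrm_ge0.
have [d d0 hd] := xc s (sub s st) (eps / (L * (nrm e + 1))) (divr_gt0 eps0 D0).
exists d => // s' s't ss'; apply: le_lt_trans (hL _ _ _) _.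
have := hd s' (sub s' s't) ss'; rewrite ltr_pdivlMr //; apply: le_lt_trans.
rewrite mulrA [nrm (x s' - x s) * L]mulrC ler_wpM2l ?mulr_ge0 ?nrm_ge0 ?(ltW L0) //; lra.
Qed.
End Nonlinearity.

(** * The closed loop *)

Lemma subr_split_diff (V : zmodType) (A B C D G : V) :
  A - B - (C - D) = (G - C) + ((A - G) - (B - D)).
Proof.
rewrite addrA [G - C + _]addrC subrKA !opprB addrACA [RHS]addrACA.
by rewrite [- C + _]addrC.
Qed.

Section Solution.
Context {R : realType} {X U Y Z E : completeNormedModType R[i]}.
Local Notation mu := (@lebesgue_measure R).
Variables (Tk : R -> {linear E -> E}) (B : {linear U -> E}).
Hypotheses (TkC0 : C0_semigroup Tk) (Bb : bounded_op B).
Variables (p a : R) (p1 : 1 <= p).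
Variables (T : R -> {linear X -> X}) (TC0 : C0_semigroup T).
Variables (j : {linear X -> E}) (j0 : forall x, j x = 0 -> x = 0).
Hypothesis Tj : extends_semigroup j T Tk.
Variables (tau : R) (tau0 : 0 < tau).
Local Notation N := (wnorm p a tau).
Local Notation Lp := (in_Lpw p a `]0, tau[).
Local Notation conv := (conv_at Tk B).
Variables (K : R) (K0 : 0 < K).
Hypothesis hK : forall u t, Lp u -> 0 <= t <= tau ->
  exists2 w, conv u t (j w) & nrm w <= K * N u.
Variables (iota : {linear Z -> X}) (iota_inj : injective iota).
Hypothesis hZ : forall u w, Lp u -> (forall t, 0 <= t <= tau -> conv u t (j (w t))) ->
  exists z : R -> Z, [/\ Lp z, N z <= K * N u &
    {ae mu, forall t, `]0, tau[%classic t -> w t = iota (z t)}].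
Variables (F : X -> {linear Y -> U}).
Hypothesis Fb : forall x, bounded_op (F x).
Hypothesis FL : exists L : R, forall x x' : X,
  opnorm (fun y => F x y - F x' y) <= L * nrm (x - x').
Variables (L : R) (L0 : 0 < L).
Hypothesis hL : forall x x' y, nrm (F x y - F x' y) <= L * nrm (x - x') * nrm y.
Variables (CZ : {linear Z -> Y}) (c : R) (c0 : 0 < c).
Hypothesis hc : forall z, nrm (CZ z) <= c * nrm z.
Variable x0 : X.

Let jinj x y : j x = j y -> x = y.
Proof. by move=> h; apply/subr0_eq/j0; rewrite linearB h subrr. Qed.

Let kap := L * c.
Let kap0 : 0 < kap. Proof. exact: mulr_gt0. Qed.

Let mcc (x y : R) : measurable (`[x, y]%classic : set R).
Proof. exact: measurable_itv. Qed.
Let moc (x y : R) : measurable (`]x, y]%classic : set R).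
Proof. exact: measurable_itv. Qed.

Definition feedback (x : R -> X) (z : R -> Z) (t : R) : U :=
  F (x t) (CZ (z t)) - F x0 (CZ (z t)).

Lemma feedback_sm t (x : R -> X) (z : R -> Z) : {within `[0, t], continuous x} ->
  strongly_measurable `]0, t[ z -> strongly_measurable `]0, t[ (feedback x z).
Proof.
move=> xc sz; have sy : strongly_measurable `]0, t[ (fun s => CZ (z s)).
  by apply: sm_map sz; exists c.
by apply: smB; [exact: sm_nonlinear|exact: sm_map (Fb x0) sy].
Qed.

Lemma feedback_le x z t : nrm (feedback x z t) <= kap * (nrm (x t - x0) * nrm (z t)).
Proof.
apply: le_trans (hL _ _ _) _; rewrite /kap -!mulrA ler_wpM2l ?(ltW L0) //.
by rewrite mulrCA ler_wpM2l ?nrm_ge0.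
Qed.

(** A product rule. The splitting is deliberately asymmetric: |x - x'| is paired with [z'] and |z -
    z'| with x - x0, so uniqueness will need closeness to x0 for one solution and a small Z-norm for
    the other. *)
Lemma feedback_diff x z x' z' t : nrm (feedback x z t - feedback x' z' t) <=
  kap * (nrm (x t - x' t) * nrm (z' t) + nrm (x t - x0) * nrm (z t - z' t)).
Proof.
have -> : feedback x z t - feedback x' z' t =
    (F (x t) (CZ (z' t)) - F (x' t) (CZ (z' t))) +
    (F (x t) (CZ (z t - z' t)) - F x0 (CZ (z t - z' t))).
  have lin x1 : F x1 (CZ (z t - z' t)) = F x1 (CZ (z t)) - F x1 (CZ (z' t)).
    by rewrite !linearB.
  by rewrite !lin; exact: subr_split_diff.
apply: le_trans (nrmD _ _) _; rewrite mulrDr lerD //.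
  apply: le_trans (hL _ _ _) _; rewrite /kap -!mulrA ler_wpM2l ?(ltW L0) //.
  by rewrite mulrCA ler_wpM2l ?nrm_ge0.
exact: (feedback_le x (fun s => z s - z' s)).
Qed.

(** [hZ] is applied to [v] truncated to [0, s]. By causality the two convolutions agree up to s, and
    injectivity of [j] and [iota] identifies their representatives in Z, so [zeta] inherits the
    bound. *)
Lemma conv_dom_bound v d (zeta : R -> Z) s : Lp v -> s <= tau ->
  (forall t, 0 <= t <= s -> conv v t (j (d t))) -> Lp (cutoff `[0, s] zeta) ->
  {ae mu, forall t, `]0, s[%classic t -> d t = iota (zeta t)} ->
  N (cutoff `[0, s] zeta) <= K * N (cutoff `[0, s] v).
Proof.
move=> pv st cd pz dz; have [pv' _] := Lpw_cutoff p1 (mcc 0 s) pv.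
have /choice[w hw] : forall t, exists w, 0 <= t <= tau -> conv (cutoff `[0, s] v) t (j w).
  move=> t; have [tt|tt] := boolP (0 <= t <= tau); last by exists 0.
  by have [w cw _] := hK pv' tt; exists w.
have [z [pz' zK wz]] := hZ pv' hw.
apply: le_trans zK.
have [] := @wnorm_le _ p a tau p1 _ _ (cutoff `[0, s] zeta) z 1 ler01 (Lpw_sm pz) pz'.
  apply: aeS3 dz wz (ae_neq s) => t h1 h2 /eqP ts; rewrite mul1r.
  rewrite /= in_itv /= => /andP[t0 tt].
  have [st'|ts'] := leP t s; last first.
    by rewrite cutoff_out ?nrm0 ?nrm_ge0 //= in_itv /= [t <= s]leNgt ts' andbF.
  have lts : t < s by rewrite lt_neqAle ts.
  rewrite cutoff_in /=; last by rewrite in_itv /= (ltW t0).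
  rewrite (_ : zeta t = z t) //; apply: iota_inj.
  rewrite -h1 /=; last by rewrite in_itv /= t0.
  rewrite -h2 /=; last by rewrite in_itv /= t0.
  apply: jinj; apply: (conv_uniq (t := t) (cd t _)); first by rewrite (ltW t0).
  apply/(conv_cutoff _ _ _ _ st')/hw; by rewrite !ltW.
by rewrite mul1r.
Qed.

(** * Contraction on the ball of radius [rho] *)

Section Existence.
Variables (z0 : R -> Z) (pz0 : Lp z0).
Hypothesis z0E : {ae mu, forall t, `]0, tau[%classic t -> T t x0 = iota (z0 t)}.
Variables (tau' rho : R) (tau'_gt0 : 0 < tau') (tau'_le : tau' <= tau) (rho0 : 0 < rho).
Hypothesis hrho : 16 * (kap * K ^+ 2 * rho) <= 1.
Hypothesis hdelta : forall t, 0 <= t <= tau' -> nrm (T t x0 - x0) <= K * rho.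
Hypothesis heps : N (cutoff `[0, tau'] z0) <= K * rho.

(* Picard iteration on the inputs. *)
Lemma local_solution : exists u x z, [/\ Lp u, Lp z, {within `[0, tau], continuous x} &
  [/\ {ae mu, forall t, `]0, tau[%classic t -> x t = iota (z t)},
      forall t, 0 <= t <= tau' -> nrm (x t - x0) <= 2 * K * rho,
      forall t, 0 <= t <= tau -> conv u t (j (x t - T t x0)) &
      {ae mu, forall t, `]0, tau'[%classic t -> u t = feedback x z t}]].
Proof.
have Kr : 0 < K * rho by exact: mulr_gt0.
(* The orbit of x0 and the convolution contribute K rho each, so |x - x0| and the norm of z on
   [0, tau'] are at most 2 K rho. By [hrho] the map then sends the ball into that of radius rho / 4,
   and [q4] gives it the Lipschitz constant 1/4. *)
have small : kap * (2 * K * rho) * (2 * K * rho) <= rho / 4.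
  have -> : kap * (2 * K * rho) * (2 * K * rho) = 16 * (kap * K ^+ 2 * rho) * (rho / 4) by field.
  by rewrite ler_piMl // divr_ge0 // ltW.
have rho4 : rho / 4 <= rho by rewrite ler_pdivrMr // ler_pMr // ler1n.
have q4 : kap * K * (2 * K * rho) + kap * (2 * K * rho) * K <= 4^-1.
  have -> : kap * K * (2 * K * rho) + kap * (2 * K * rho) * K =
    16 * (kap * K ^+ 2 * rho) * 4^-1 by field.
  by rewrite ler_piMl.
(* [W u] is the convolution of [u] and [Zf u] its representative in Z, chosen for all inputs at
   once; outside the weighted space both take the value 0. *)
have /choice[W hW] : forall u, exists w : R -> X, Lp u ->
    forall t, 0 <= t <= tau -> conv u t (j (w t)).
  move=> u; have [pu|pu] := pselect (Lp u); last by exists (fun=> 0).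
  have /choice[w hw] : forall t, exists w, 0 <= t <= tau -> conv u t (j w).
    move=> t; have [tt|tt] := boolP (0 <= t <= tau); last by exists 0.
    by have [w cw _] := hK pu tt; exists w.
  by exists w.
have /choice[Zf hZf] : forall u, exists z : R -> Z, Lp u -> [/\ Lp z, N z <= K * N u &
    {ae mu, forall t, `]0, tau[%classic t -> W u t = iota (z t)}].
  move=> u; have [pu|pu] := pselect (Lp u); last by exists (fun=> 0).
  by have [z hz] := hZ pu (hW u pu); exists z.
have Tcont : {within `[0, tau], continuous (fun t => T t x0)}.
  apply/nrm_continuousP => t; rewrite /= in_itv /= => /andP[t0 _] e e0.
  have [d d0 hd] := semigroup_continuous TC0 x0 t0 e0; exists d => // s.
  by rewrite /= in_itv /= => /andP[s0 _]; exact: hd.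
pose xs u t := T t x0 + W u t; pose zs u t := z0 t + Zf u t.
(* Truncation at tau' keeps the iterates in the space on []0, tau[], where [K] is available,
   although [xb] and [zb] hold up to tau' only. *)
pose G u := cutoff `[0, tau'] (feedback (xs u) (zs u)).
have xsc u : Lp u -> {within `[0, tau], continuous (xs u)}.
  move=> pu; have Wc := conv_continuous TkC0 p1 TC0 j0 Tj (ltW K0) hK pu (hW u pu).
  by move=> t; apply: cvgD; [exact: Tcont|exact: Wc].
have pzs u : Lp u -> Lp (zs u).
  move=> pu; have [pz _ _] := hZf u pu.
  have [] // := @wnorm_le2 _ p a tau p1 _ _ _ (zs u) z0 (Zf u) 1 1 ler01 ler01.
    by apply: smD; [exact: Lpw_sm pz0|exact: Lpw_sm pz].
  by apply: aeW => t _; rewrite !mul1r nrmD.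
have Wb u t : Lp u -> 0 <= t <= tau -> nrm (W u t) <= K * N u.
  move=> pu tt; apply: le_trans (conv_bound p1 j0 hK pu tt (hW u pu t tt)) _.
  by rewrite ler_wpM2l ?(ltW K0) //; have [] := Lpw_cutoff p1 (mcc 0 t) pu.
have tsub t : 0 <= t <= tau' -> 0 <= t <= tau.
  by move=> /andP[-> h]; exact: le_trans tau'_le.
have xb u t : Lp u -> N u <= rho -> 0 <= t <= tau' -> nrm (xs u t - x0) <= 2 * K * rho.
  move=> pu ur tt; rewrite /xs addrAC; apply: le_trans (nrmD _ _) _.
  have h1 := hdelta tt; have h2 := Wb u t pu (tsub t tt).
  have h3 : K * N u <= K * rho by rewrite ler_wpM2l // ltW.
  lra.
have pzc u : Lp u -> Lp (cutoff `[0, tau'] (zs u)).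
  by move=> pu; have [] := Lpw_cutoff p1 (mcc 0 tau') (pzs u pu).
have zb u : Lp u -> N u <= rho -> N (cutoff `[0, tau'] (zs u)) <= 2 * K * rho.
  move=> pu ur; have [pz zK _] := hZf u pu.
  have [pz0' _] := Lpw_cutoff p1 (mcc 0 tau') pz0.
  have [] := @wnorm_le2 _ p a tau p1 _ _ _ (cutoff `[0, tau'] (zs u)) (cutoff `[0, tau'] z0)
    (Zf u) 1 1 ler01 ler01 (Lpw_sm (pzc u pu)) pz0' pz.
    apply: aeW => t _; rewrite !mul1r /cutoff /zs scalerDr.
    by apply: le_trans (nrmD _ _) _; rewrite lerD2l; exact: nrm_cutoff_le.
  move=> _; rewrite !mul1r => /le_trans; apply.
  have -> : 2 * K * rho = K * rho + K * rho by ring.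
  by rewrite lerD // (le_trans zK) // ler_wpM2l // ltW.
have Gsm u : Lp u -> strongly_measurable `]0, tau[ (G u).
  move=> pu; apply: (sm_cutoff (mcc 0 tau')).
  by apply: feedback_sm; [exact: xsc|exact: Lpw_sm (pzs u pu)].
have Gb u : Lp u -> N u <= rho -> Lp (G u) /\ N (G u) <= rho / 4.
  move=> pu ur.
  have [||pG GN] := @wnorm_le _ p a tau p1 _ _ (G u) (cutoff `[0, tau'] (zs u))
    (kap * (2 * K * rho)) _ (Gsm u pu) (pzc u pu).
  - by rewrite mulr_ge0 // ?(ltW kap0) // -mulrA mulr_ge0 // ltW.
  - apply: aeW => t; rewrite /= in_itv /= => /andP[t0 _].
    have [tt|tt] := leP t tau'; last first.
      have nt : ~ `[0, tau']%classic t by rewrite /= in_itv /= [t <= _]leNgt tt andbF.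
      by rewrite /G !cutoff_out // !nrm0 mulr0.
    have it : `[0, tau']%classic t by rewrite /= in_itv /= (ltW t0).
    rewrite /G (cutoff_in _ it) (cutoff_in (zs u) it); apply: le_trans (feedback_le _ _ _) _.
    rewrite -mulrA ler_wpM2l ?(ltW kap0) // ler_wpM2r ?nrm_ge0 //.
    by apply: xb => //; rewrite (ltW t0).
  split => //; apply: le_trans GN _; apply: le_trans small.
  rewrite ler_wpM2l ?zb // mulr_ge0 // ?(ltW kap0) // -mulrA mulr_ge0 // ltW //.
have Gd u u' : Lp u -> N u <= rho -> Lp u' -> N u' <= rho ->
    N (fun t => G u t - G u' t) <= 4^-1 * N (fun t => u t - u' t).
  move=> pu ur pu' ur'; set n := N (fun t => u t - u' t).
  have pv := LpwB p1 pu pu'.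
  have [pz _ Wz] := hZf u pu; have [pz' _ Wz'] := hZf u' pu'.
  have pzz := LpwB p1 pz pz'.
  have [pzz' _] := Lpw_cutoff p1 (mcc 0 tau) pzz.
  (* [Zf] is merely chosen, with no linearity to rely on; the difference is identified through the
     convolution of u - u'. *)
  have zdiff : N (cutoff `[0, tau] (fun t => Zf u t - Zf u' t)) <= K * n.
    have [_ le1] := Lpw_cutoff p1 (mcc 0 tau) pv.
    apply: le_trans (conv_dom_bound (d := fun t => W u t - W u' t) pv (lexx _) _ pzz' _) _.
    - by move=> t tt; rewrite linearB; apply: convB; exact: hW.
    - by apply: aeS2 Wz Wz' => t h1 h2 Dt; rewrite linearB h1 // h2.
    by rewrite ler_wpM2l // ltW.
  have n0 : 0 <= n by exact: wnorm_ge0.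
  have [] := @wnorm_le2 _ p a tau p1 _ _ _ (fun t => G u t - G u' t)
    (cutoff `[0, tau'] (zs u')) (cutoff `[0, tau] (fun t => Zf u t - Zf u' t))
    (kap * K * n) (kap * (2 * K * rho)) _ _ _ (pzc u' pu') pzz'.
  - by rewrite !mulr_ge0 // ltW.
  - by rewrite mulr_ge0 // ?(ltW kap0) // -mulrA mulr_ge0 // ltW.
  - by apply: smB; exact: Gsm.
  - apply: aeW => t; rewrite /= in_itv /= => /andP[t0 ttau].
    have [tt|tt] := leP t tau'; last first.
      have nt : ~ `[0, tau']%classic t by rewrite /= in_itv /= [t <= _]leNgt tt andbF.
      rewrite /G !(cutoff_out _ nt) subrr nrm0 addr_ge0 // mulr_ge0 ?nrm_ge0 //.
        by rewrite !mulr_ge0 // ltW.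
      by rewrite mulr_ge0 // ?(ltW kap0) // -mulrA mulr_ge0 // ltW.
    have it : `[0, tau']%classic t by rewrite /= in_itv /= (ltW t0).
    have it2 : `[0, tau]%classic t by rewrite /= in_itv /= !ltW.
    rewrite /G !(cutoff_in _ it) (cutoff_in (fun t => Zf u t - Zf u' t) it2).
    apply: le_trans (feedback_diff _ _ _ _ _) _.
    have -> : zs u t - zs u' t = Zf u t - Zf u' t by rewrite /zs opprD addrACA subrr add0r.
    have -> : xs u t - xs u' t = W u t - W u' t by rewrite /xs opprD addrACA subrr add0r.
    have b1 : nrm (W u t - W u' t) <= K * n.
      have tt2 : 0 <= t <= tau by rewrite !ltW.
      have cd : conv (fun t => u t - u' t) t (j (W u t - W u' t)).
        by rewrite linearB; apply: convB; exact: hW.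
      apply: le_trans (conv_bound p1 j0 hK pv tt2 cd) _.
      by rewrite ler_wpM2l ?(ltW K0) //; have [] := Lpw_cutoff p1 (mcc 0 t) pv.
    have b2 : nrm (xs u t - x0) <= 2 * K * rho by apply: xb; rewrite ?(ltW t0).
    have -> r q : kap * K * n * r + kap * (2 * K * rho) * q =
      kap * (K * n * r + 2 * K * rho * q) by ring.
    rewrite ler_wpM2l ?(ltW kap0) //.
    by apply: lerD; rewrite ler_wpM2r ?nrm_ge0.
  move=> _ le; apply: le_trans le _.
  apply: (@le_trans _ _ ((kap * K * (2 * K * rho) + kap * (2 * K * rho) * K) * n)).
    rewrite [leRHS]mulrDl lerD //.
      rewrite -[leRHS]mulrA [2 * K * rho * n]mulrC mulrA ler_wpM2l ?zb //.
      by rewrite !mulr_ge0 // ltW.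
    rewrite -[leRHS]mulrA ler_wpM2l // mulr_ge0 // ?(ltW kap0) // -mulrA mulr_ge0 // ltW //.
  by rewrite ler_wpM2r.
have p00 : Lp (fun=> 0 : U) /\ N (fun=> 0 : U) <= 0 * N z0.
  apply: (@wnorm_le _ p a tau p1 _ _ _ z0 0) => //.
    have := @simple_limit_sf R U sf_zero => /(simple_limit_sm `]0, tau[).
    by apply: sm_ae; apply: aeW => t _; rewrite sf_zeroE.
  by apply: aeW => t _; rewrite nrm0 mul0r.
have {p00}[p00 N0] : Lp (fun=> 0 : U) /\ N (fun=> 0 : U) <= 0.
  by case: p00 => ? h; split => //; rewrite mul0r in h.
pose u_ n := iter n G (fun=> 0).
have u_P n : Lp (u_ n) /\ N (u_ n) <= rho.
  elim: n => [|n [pn Nn]]; first by split => //; exact: le_trans N0 (ltW rho0).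
  have [pG NG] := Gb _ pn Nn; split => //; exact: le_trans NG rho4.
have step n : N (fun t => u_ n.+1 t - u_ n t) <= rho / 4 * 4^-1 ^+ n.
  elim: n => [|n IH].
    rewrite expr0 mulr1; have [pG NG] := Gb _ p00 (le_trans N0 (ltW rho0)).
    have [] := @wnorm_le _ p a tau p1 _ _ (fun t => u_ 1%N t - u_ 0%N t) (G (fun=> 0)) 1 ler01 _ pG.
    - by apply: smB; [exact: Lpw_sm pG|exact: Lpw_sm p00].
    - by apply: aeW => t _; rewrite mul1r /u_ /= subr0.
    by move=> _; rewrite mul1r => h; exact: le_trans h NG.
  have [pn Nn] := u_P n; have [pn' Nn'] := u_P n.+1.
  apply: le_trans (Gd _ _ pn' Nn' pn Nn) _; rewrite exprS mulrCA ler_wpM2l //.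
have [u [pu _ uN]] := wnorm_complete p1 (fun n => (u_P n).1) step.
have Nu : N u <= rho.
  have [] := @wnorm_le _ p a tau p1 _ _ u (fun t => u t - u_ 0%N t) 1 ler01 (Lpw_sm pu)
    (LpwB p1 pu p00).
    by apply: aeW => t _; rewrite mul1r subr0.
  move=> _; rewrite mul1r => /le_trans; apply; apply: le_trans (uN 0%N) _.
  rewrite expr0; lra.
have [pG NG] := Gb u pu Nu.
(* The distance from G u to u is compared with u_ (n+1) = G (u_ n): the contraction bounds one part
   and the rate [uN] the other, so it is below every e > 0. *)
have fixu : {ae mu, forall t, `]0, tau[%classic t -> G u t - u t = 0}.
  apply: (@wnorm_eq0 _ p a tau p1 _ (fun t => G u t - u t) (LpwB p1 pG pu)).
  apply/ler_addgt0Pr => e e0; rewrite add0r.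
  have : (rho * 4^-1 ^+ n) @[n --> \oo] --> (0 : R).
    rewrite -(mulr0 rho); apply: cvgMr; apply: cvg_expr.
    by rewrite ger0_norm ?invr_ge0 // invf_lt1 // ltr1n.
  move=> /cvgr0Pnorm_lt/(_ e e0)[n _ hn].
  have {hn}hn : rho * 4^-1 ^+ n < e.
    by apply: le_lt_trans (ler_norm _) _; apply: hn => /=.
  have [pn Nn] := u_P n; have [pn' Nn'] := u_P n.+1.
  have [] := @wnorm_le2 _ p a tau p1 _ _ _ (fun t => G u t - u t)
    (fun t => G u t - u_ n.+1 t) (fun t => u t - u_ n.+1 t) 1 1 ler01 ler01.
  - by apply: smB; [exact: Lpw_sm pG|exact: Lpw_sm pu].
  - exact: LpwB.
  - exact: LpwB.
  - apply: aeW => t _; rewrite !mul1r [nrm (u t - _)]nrm_distC; exact: nrm_tri.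
  move=> _; rewrite !mul1r => /le_trans; apply.
  have h1 := Gd _ _ pu Nu pn Nn; have h2 := uN n; have h3 := uN n.+1.
  rewrite -/(u_ n.+1) in h1.
  have q0 : 0 <= 4^-1 ^+ n :> R by rewrite exprn_ge0.
  have rq : 0 <= rho * 4^-1 ^+ n by rewrite mulr_ge0 // ltW.
  rewrite exprS in h3.
  have e1 : 2 * (rho / 4) * 4^-1 ^+ n = rho * 4^-1 ^+ n / 2 by field.
  have e2 : 2 * (rho / 4) * (4^-1 * 4^-1 ^+ n) = rho * 4^-1 ^+ n / 8 by field.
  rewrite e1 in h2; rewrite e2 in h3; lra.
exists u, (xs u), (zs u); split; [by []|exact: pzs|exact: xsc|split].
- have [_ _ Wz] := hZf u pu; apply: aeS2 z0E Wz => t h1 h2 Dt.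
  by rewrite /xs /zs h1 // h2 // linearD.
- by move=> t; exact: xb.
- by move=> t tt; rewrite /xs addrC addKr; exact: hW.
apply: aeS fixu => t h Dt.
have ht : `]0, tau[%classic t.
  by move: Dt; rewrite /= !in_itv /= => /andP[-> h']; exact: lt_le_trans tau'_le.
rewrite -(subr0_eq (h ht)) /G cutoff_in //.
by move: Dt; rewrite /= !in_itv /= => /andP[h1 h2]; rewrite !ltW.
Qed.
End Existence.

(** * Local uniqueness and its propagation *)

Section Uniqueness.
Variables (t' : R) (t'0 : 0 <= t') (t'le : t' <= tau).

Definition solves (x : R -> X) (z : R -> Z) :=
  [/\ {within `[0, t'], continuous x}, in_Lpw p a `]0, t'[ z,
      {ae mu, forall t, `]0, t'[%classic t -> x t = iota (z t)} &
      forall t, 0 <= t <= t' -> conv (feedback x z) t (j (x t - T t x0))].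

Lemma continuous_bounded (x : R -> X) : {within `[0, t'], continuous x} ->
  exists2 M, 0 <= M & forall t, 0 <= t <= t' -> nrm (x t - x0) <= M.
Proof.
move=> /nrm_continuousP xc.
have [|c' _ hc'] := @EVT_max R (fun t => nrm (x t - x0)) 0 t' t'0.
  apply/subspace_continuousP => t Dt; apply/cvgrPdist_lt => e e0.
  have [d d0 hd] := xc t Dt e e0.
  rewrite near_withinE; apply/nbhs_ballP; exists d => // s /= st Ds.
  have h : nrm (x s - x t) < e by apply: hd => //; rewrite distrC.
  have h1 := nrm_tri (x t) (x s) x0; have h2 := nrm_tri (x s) (x t) x0.
  rewrite [nrm (x t - x s)]nrm_distC in h2.
  by rewrite ltr_distl; apply/andP; split; lra.
exists (nrm (x c' - x0)); first exact: nrm_ge0.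
by move=> t tt; apply: hc'; rewrite in_itv.
Qed.

(** A solution comes without any assumption on its input; since [x] is bounded on the compact
    interval, the input is dominated by a multiple of [z]. *)
Lemma feedback_Lpw x z : {within `[0, t'], continuous x} -> in_Lpw p a `]0, t'[ z ->
  Lp (cutoff `[0, t'] (feedback x z)).
Proof.
move=> xc pz; have [M M0 hM] := continuous_bounded xc.
have pz' := (in_Lpw_restr a p1 z t'le).1 pz.
have [] // := @wnorm_le _ p a tau p1 _ _ (cutoff `[0, t'] (feedback x z))
  (cutoff `[0, t'] z) (kap * M) _ _ pz'.
- by rewrite mulr_ge0 // ltW.
- apply: sm_restr; first exact: mcc.
  apply: (@sm_ae_dom _ _ _ `]0, t'[).
    by apply: aeS (ae_itv_cc 0 t') => t h [_ /h].
  by apply: feedback_sm => //; exact: Lpw_sm pz.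
- apply: aeW => t _; have [tt|tt] := boolP (0 <= t <= t').
    rewrite !cutoff_in /= ?in_itv //; apply: le_trans (feedback_le _ _ _) _.
    by rewrite -mulrA ler_wpM2l ?(ltW kap0) // ler_wpM2r ?nrm_ge0 ?hM.
  have nt : ~ `[0, t']%classic t by move/negP: tt; rewrite /= in_itv.
  by rewrite cutoff_out // nrm0 !mulr_ge0 ?nrm_ge0 // ltW.
Qed.

Variables (x x' : R -> X) (z z' : R -> Z) (r : R).
Hypotheses (sx : solves x z) (sx' : solves x' z').
Hypothesis xr : forall t, 0 <= t <= t' -> nrm (x t - x0) <= r.
Hypothesis r4 : kap * K * r <= 4^-1.

(** Let n be the norm of the difference of the inputs on [0, s']. There the states differ by at most
    K n, and so do their representatives in Z. The first summand of [feedback_diff] vanishes before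
    s, where the states agree, so each summand contributes at most n / 4, which forces n = 0. *)
Lemma unique_step s s' : 0 <= s -> s <= s' -> s' <= t' ->
  (forall t, 0 <= t < s -> x t = x' t) ->
  kap * K * N (cutoff `]s, s'] (cutoff `[0, t'] z')) <= 4^-1 ->
  forall t, 0 <= t <= s' -> x t = x' t.
Proof.
move=> s0 ss st xx' zs.
have half (q : R) : q <= q * 4^-1 + q * 4^-1 -> q <= 0 by lra.
have [xc pz xz cx] := sx; have [xc' pz' xz' cx'] := sx'.
have pu := feedback_Lpw xc pz; have pu' := feedback_Lpw xc' pz'.
set u := cutoff _ _ in pu; set u' := cutoff _ _ in pu'.
have pzc := (in_Lpw_restr a p1 z t'le).1 pz; have pzc' := (in_Lpw_restr a p1 z' t'le).1 pz'.
pose v t := u t - u' t; have pv : Lp v by exact: LpwB.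
pose ze t := cutoff `[0, t'] z t - cutoff `[0, t'] z' t.
have pze : Lp ze by exact: LpwB.
have s'0 : 0 <= s' := le_trans s0 ss.
have [pvc _] := Lpw_cutoff p1 (mcc 0 s') pv.
have [pzec _] := Lpw_cutoff p1 (mcc 0 s') pze.
have [pzs _] := Lpw_cutoff p1 (moc s s') pzc'.
set n := N (cutoff `[0, s'] v).
have n0 : 0 <= n by exact: wnorm_ge0.
have r0 : 0 <= r.
  by apply: le_trans (xr (t := 0) _); rewrite ?nrm_ge0 ?lexx.
have ct t : 0 <= t <= s' -> conv v t (j (x t - x' t)).
  move=> /andP[t0 ts]; have tt : t <= t' by exact: le_trans st.
  have t02 : 0 <= t <= t' by rewrite t0.
  have -> : j (x t - x' t) = j (x t - T t x0) - j (x' t - T t x0).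
    by rewrite -linearB opprB addrA subrK.
  apply: convB; apply/conv_cutoff => //; [exact: cx|exact: cx'].
have dn t : 0 <= t <= s' -> nrm (x t - x' t) <= K * n.
  move=> /andP[t0 ts].
  have tt : 0 <= t <= tau by rewrite t0 (le_trans ts) // (le_trans st).
  apply: le_trans (conv_bound p1 j0 hK pv tt (ct t _)) _; first by rewrite t0.
  rewrite ler_wpM2l ?(ltW K0) //; apply: wnorm_cutoff_sub => //.
  by move=> q /=; rewrite !in_itv /= => /andP[-> /le_trans]; exact.
have zn : N (cutoff `[0, s'] ze) <= K * n.
  apply: (conv_dom_bound (d := fun t => x t - x' t)) => //.
    exact: le_trans st t'le.
  apply: aeS2 xz xz' => t h1 h2; rewrite /= in_itv /= => /andP[t0 ts].
  have Dt : `]0, t'[%classic t by rewrite /= in_itv /= t0 (lt_le_trans ts).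
  have Dt' : `[0, t']%classic t by rewrite /= in_itv /= (ltW t0) ltW // (lt_le_trans ts).
  by rewrite /ze (cutoff_in z Dt') (cutoff_in z' Dt') linearB h1 // h2.
have [||||] := @wnorm_le2 _ p a tau p1 _ _ _ (cutoff `[0, s'] v)
  (cutoff `]s, s'] (cutoff `[0, t'] z')) (cutoff `[0, s'] ze) (kap * K * n) (kap * r) _ _ _
  pzs pzec.
- by rewrite !mulr_ge0 // ltW.
- by rewrite mulr_ge0 // ltW.
- exact: Lpw_sm pvc.
- apply: aeS (ae_neq s) => t /eqP ts; rewrite /= in_itv /= => /andP[t0 ttau].
  have [ts'|ts'] := leP t s'; last first.
    rewrite [cutoff `[0, s'] v t]cutoff_out; last by rewrite /= in_itv /= [_ <= s']leNgt ts' andbF.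
    by rewrite nrm0 addr_ge0 // mulr_ge0 ?nrm_ge0 // ?mulr_ge0 // ltW.
  have It : `[0, s']%classic t by rewrite /= in_itv /= (ltW t0).
  have It' : `[0, t']%classic t by rewrite /= in_itv /= (ltW t0) (le_trans ts').
  rewrite (cutoff_in v It) (cutoff_in ze It) /v /u /u' !(cutoff_in _ It').
  rewrite /ze (cutoff_in z It') (cutoff_in z' It').
  apply: le_trans (feedback_diff _ _ _ _ _) _; rewrite mulrDr; apply: lerD.
    have [lts|lts] := ltP t s.
      by rewrite xx' ?(ltW t0) // subrr nrm0 mul0r mulr0 mulr_ge0 ?nrm_ge0 // !mulr_ge0 // ltW.
    rewrite [cutoff `]s, s'] _ t]cutoff_in; last by rewrite /= in_itv /= lt_neqAle eq_sym ts lts.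
    rewrite (cutoff_in z' It') [kap * K * n]mulrAC.
    have -> q : kap * n * K * q = kap * (K * n * q) by ring.
    rewrite ler_wpM2l ?(ltW kap0) // ler_wpM2r ?nrm_ge0 //; exact: dn.
  rewrite -[leRHS]mulrA ler_wpM2l ?(ltW kap0) // ler_wpM2r ?nrm_ge0 //; exact: xr.
move=> _ le t tt; apply/subr0_eq/nrm_eq0/eqP; rewrite eq_le nrm_ge0 andbT.
apply: le_trans (dn t tt) _; suff n00 : n <= 0 by rewrite pmulr_rle0.
have h1 : kap * K * n * N (cutoff `]s, s'] (cutoff `[0, t'] z')) <= n * 4^-1.
  by rewrite mulrAC mulrC ler_wpM2l.
have h2 : kap * r * N (cutoff `[0, s'] ze) <= n * 4^-1.
  apply: (@le_trans _ _ (kap * r * (K * n))).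
    by rewrite ler_wpM2l // mulr_ge0 // ltW.
  have -> : kap * r * (K * n) = n * (kap * K * r) by ring.
  by rewrite ler_wpM2l.
exact: half (le_trans le (lerD h1 h2)).
Qed.

(* The solutions agree up to a supremum m; the norm of z' is small on a short
   interval after m, so that unique_step applies there. *)
Lemma solution_unique t : 0 <= t <= t' -> x t = x' t.
Proof.
(* The strict inequality puts 0 in [S] vacuously, and agreement strictly below the supremum is what
   [unique_step] asks for. *)
pose S : set R := [set s | 0 <= s <= t' /\ forall t, 0 <= t < s -> x t = x' t].
have S0 : S 0.
  split; first by rewrite lexx.
  by move=> q /andP[q0 /lt_geF]; rewrite q0.
have hS : has_sup S by split; [exists 0|exists t' => q [/andP[]]].
pose m := sup S.
have m0 : 0 <= m by apply: ub_le_sup => //; case: hS.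
have mt : m <= t' by apply: ge_sup; [exists 0|move=> q [/andP[]]].
have xm q : 0 <= q < m -> x q = x' q.
  move=> /andP[q0 qm]; have [y [_ hy] qy] := sup_gt hS.1 qm.
  by apply: hy; rewrite q0.
have [_ pz' _ _] := sx'; have pzc' := (in_Lpw_restr a p1 z' t'le).1 pz'.
(* The threshold at which kap K times the norm of z' becomes 1/4. *)
have e0 : 0 < (4 * (kap * K))^-1 by rewrite invr_gt0 !mulr_gt0.
have [||k _ hk] := @wnorm_small _ p a tau p1 _ _ (fun n => `]m, m + n.+1%:R^-1]%classic) _ pzc' e0.
- by move=> n; exact: moc.
- apply: aeW => q _; apply/cvgr0Pnorm_lt => e e1; have [qm|mq] := leP q m.
    apply: nearW => n; rewrite indicE memNset ?normr0 //= in_itv /= [m < q]ltNge qm //.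
  have := @cvg_harmonic R => /cvgr0Pnorm_lt/(_ (q - m)); rewrite subr_gt0 => /(_ mq).
  apply: filterS => n /=; rewrite ger0_norm ?invr_ge0 // => hn.
  by rewrite indicE memNset ?normr0 //= in_itv /= -lerBlDl [_ <= n.+1%:R^-1]leNgt hn andbF.
have {}hk : N (cutoff `]m, m + k.+1%:R^-1] (cutoff `[0, t'] z')) < (4 * (kap * K))^-1.
  exact: hk (leqnn k).
have k0 : 0 < k.+1%:R^-1 :> R by rewrite invr_gt0.
pose s' := Num.min t' (m + k.+1%:R^-1).
have ms : m <= s' by rewrite le_min mt lerDl ltW.
have s't : s' <= t' by rewrite ge_min lexx.
have eqs : forall q, 0 <= q <= s' -> x q = x' q.
  apply: (unique_step m0 ms s't xm).
  apply: (@le_trans _ _ (kap * K * (4 * (kap * K))^-1)).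
    apply: ler_wpM2l; first by rewrite mulr_ge0 // ltW.
    apply: le_trans (ltW hk).
    apply: wnorm_cutoff_sub => // q; rewrite /= !in_itv /= => /andP[-> qs].
    by rewrite (le_trans qs) // ge_min lexx orbT.
  rewrite le_eqVlt; apply/orP; left; apply/eqP; have := mulr_gt0 kap0 K0.
  by move: (kap * K) => w w0; field; rewrite gt_eqF.
(* Either the short interval reaches t' and agreement is complete, or s' > m lies in [S], against
   the choice of m. *)
have [t's|st'] := leP t' (m + k.+1%:R^-1).
  by move=> tt; apply: eqs; rewrite /s' min_l.
have Ss : S s'.
  split; first by rewrite (le_trans m0).
  by move=> q /andP[q0 /ltW qs]; apply: eqs; rewrite q0.
have : s' <= m by apply: ub_le_sup Ss; case: hS.
by rewrite /s' min_r ?(ltW st') // gerDl leNgt k0.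
Qed.
End Uniqueness.
End Solution.

(** * Orbits of arbitrary initial states in the weighted space over Z *)

Section Orbits.
Context {R : realType} {X Z : completeNormedModType R[i]}.
Local Notation mu := (@lebesgue_measure R).

(** Admissibility makes the orbits of the smoothed states T (s n) x Cauchy in the weighted space
    over Z; boundedness of [iota] and of T t identifies the pointwise limit with T t x. *)
Lemma orbit_in_subspace (p a tau : R) (p1 : 1 <= p) (tau0 : 0 < tau)
    (A : unbounded_op X X) (l0 : R[i]) (T : R -> {linear X -> X})
    (iota : {linear Z -> X}) (iota_inj : injective iota) x :
  analytic_semigroup T -> neg_generates A T -> bounded_op iota ->
  obs_admissible p a A l0 T (id_op iota_inj) ->
  exists2 z : R -> Z, in_Lpw p a `]0, tau[ z &
    {ae mu, forall t, `]0, tau[%classic t -> T t x = iota (z t)}.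
Proof.
move=> TA AT ib [k [_ [sub _] /(_ tau tau0)[M hM]]].
have [TC0 _] := TA; have [Tb _ TD _] := TC0.
(* 4^-n is the rate that [wnorm_complete] takes; consecutive smoothed states are then within 2 *
   4^-n of each other. *)
have /choice[s /all_and2[s0 sx]] : forall n : nat, exists s : R,
    0 < s /\ nrm (T s x - x) <= 4^-1 ^+ n.
  move=> n; have e0 : 0 < 4^-1 ^+ n :> R by rewrite exprn_gt0.
  have [d d0 hd] := semigroup_right_cvg TC0 x e0.
  exists (d / 2); split; first by rewrite divr_gt0.
  by apply/ltW/hd; rewrite divr_ge0 ?ltW //= ltr_pdivrMr // ltr_pMr // ltr1n.
pose y n := T (s n) x; pose O : unbounded_op X Z := id_op iota_inj.
have py n : pow_dom A k (y n) by have [] := analytic_pow_dom TA AT k x (s0 n).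
have dy n t : 0 <= t -> op_dom O (T t (y n)).
  move=> t0; apply: sub; rewrite /y -TD ?(ltW (s0 n)) //.
  by have [] := @analytic_pow_dom _ _ _ _ TA AT k (t + s n) x _; rewrite // ltr_wpDl.
pose f n t := O (T t (y n)).
have pf n : in_Lpw p a `]0, tau[ (f n).
  by apply/(in_Lpw_cc a p1); have [] := hM _ (py n).
have fn n : wnorm p a tau (fun t => f n.+1 t - f n t) <= `|M| * 2 * 4^-1 ^+ n.
  have [pd _] := pow_dom_lin (-1) (py n) (py n.+1).
  rewrite scaleN1r addrC in pd; have [] := hM _ pd.
  rewrite in_Lpw_cc // Lpw_norm_cc // => pg; rewrite wnormE // lee_fin => gM.
  have [] := @wnorm_le _ p a tau p1 _ _ (fun t => f n.+1 t - f n t)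
    (fun t => O (T t (y n.+1 - y n))) 1 ler01 _ pg.
  - exact: Lpw_sm (LpwB p1 (pf n.+1) (pf n)).
  - apply: aeW => t; rewrite /= in_itv /= mul1r => /andP[/ltW t0 _].
    have [_ <-] := opB (dy n.+1 t t0) (dy n t t0).
    by rewrite linearB.
  move=> _; rewrite mul1r => /le_trans; apply; apply: le_trans gM _.
  apply: (@le_trans _ _ (`|M| * nrm (y n.+1 - y n))).
    by rewrite ler_wpM2r ?nrm_ge0 ?ler_norm.
  rewrite -mulrA ler_wpM2l //; apply: le_trans (nrm_tri x _ _) _.
  rewrite mulr_natl mulr2n lerD //.
    apply: le_trans (sx n.+1) _.
    by rewrite exprS ler_piMl ?exprn_ge0 // invf_le1 // ler1n.
  by rewrite nrm_distC; exact: sx.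
have [z [pz cz _]] := wnorm_complete p1 pf fn; exists z => //.
apply: aeS cz => t h Dt.
have t0 : 0 <= t by move: Dt; rewrite /= in_itv /= => /andP[/ltW].
have fE n : iota (f n t) = T t (y n).
  by have [w _ wE] := dy n t t0; rewrite /f /= -wE id_funK.
have h1 := bounded_op_cvg ib (h Dt).
have yx : y n @[n --> \oo] --> x.
  apply/nrm_cvgP => e e0.
  have : (4^-1 ^+ n) @[n --> \oo] --> (0 : R).
    by apply: cvg_expr; rewrite ger0_norm ?invr_ge0 // invf_lt1 // ltr1n.
  move=> /cvgr0Pnorm_lt/(_ e e0); apply: filterS => n hn.
  apply: le_lt_trans (sx n) _; exact: le_lt_trans (ler_norm _) hn.
apply: (cvg_unique (@norm_hausdorff _ X) (bounded_op_cvg (Tb t t0) yx)).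
rewrite (_ : (fun n => T t (y n)) = (fun n => iota (f n t))); first exact: h1.
by apply/funext => n; rewrite fE.
Qed.
End Orbits.

Local Close Scope complex_scope.
Unset Implicit Arguments.
Set Strict Implicit.
Set Printing Implicit Defensive.

Theorem theorem1p16 (R : realType) (p p' a : R)
  (hp : 1 < p) (hpp' : p^-1 + p'^-1 = 1) (ha : - p^-1 < a < p'^-1)
  (X U Y : completeNormedModType R[i]) (x0 : X)
  (F : X -> {linear Y -> U}) (F_bounded : forall x, bounded_op (F x))
  (F_lipschitz : exists L : R, forall x x' : X,
     opnorm (fun y => F x y - F x' y) <= L * nrm (x - x'))
  (A0 : unbounded_op X X) (T : R -> {linear X -> X})
  (T_analytic : analytic_semigroup T) (A0_generates : neg_generates A0 T)
  (l0 : R[i]) (hl0 : resolvent_set A0 (- l0))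
  (k : nat) (hk : (0 < k)%N)
  (* Xmk = X_{-k}, with embedding j and extended semigroup Tmk = T_{-k} *)
  (Xmk : completeNormedModType R[i]) (j : {linear X -> Xmk})
  (Xmk_completion : extrapolation_space A0 l0 k j)
  (Tmk : R -> {linear Xmk -> Xmk}) (Tmk_C0 : C0_semigroup Tmk)
  (Tmk_extends : extends_semigroup j T Tmk)
  (A : unbounded_op X Xmk) (B : {linear U -> Xmk}) (C : unbounded_op X Y)
  (A0_def : is_closed_loop_op j A B (F x0) C A0)
  (B_admissible : ctrl_admissible p a j Tmk B)
  (C_admissible : obs_admissible p a A0 l0 T C)
  (Z : completeNormedModType R[i]) (iota : {linear Z -> X})
  (iota_inj : injective iota) (iota_bounded : bounded_op iota)
  (Z_wellposed : wellposed p a A0 l0 T j Tmk B (id_op iota_inj))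
  (Z_dom_C : range iota `<=` op_dom C)
  (C_bounded : bounded_op (fun z : Z => C (iota z))) :
  exists tau : R, 0 < tau /\
    exists x : R -> X,
      [/\ in_solution_space p a iota tau x,
          mild_solution T j Tmk B F C x0 tau x
        & forall x' : R -> X, in_solution_space p a iota tau x' ->
            mild_solution T j Tmk B F C x0 tau x' ->
            forall t, 0 <= t <= tau -> x' t = x t].
Proof.
have p1 : 1 <= p by exact: ltW.
have [TC0 _] := T_analytic.
have [jb j0] := extrapolation_bounded hl0 Xmk_completion.
have [Bb _] := B_admissible.
have jinj x y : j x = j y -> x = y.
  by move=> h; apply/subr0_eq/j0; rewrite linearB h subrr.
have [_ Zobs [tau [tau0 [K2 hK2]]]] := Z_wellposed.
have [z0 pz0 z0E] := orbit_in_subspace p1 tau0 x0 T_analytic A0_generates iota_bounded Zobs.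
have [K1 K10 hK1] := conv_value Tmk_C0 Bb p1 TC0 jb j0 Tmk_extends B_admissible tau0.
(* One positive constant for the bound in X and the bound in Z. *)
pose K := K1 + `|K2| + 1.
have K0 : 0 < K by rewrite ltr_wpDl // addr_ge0.
have hK u t : in_Lpw p a `]0, tau[ u -> 0 <= t <= tau ->
    exists2 w, conv_at Tmk B u t (j w) & nrm w <= K * wnorm p a tau u.
  move=> pu tt; have [w cw wK] := hK1 u t pu tt; exists w => //.
  apply: le_trans wK _; rewrite ler_wpM2r ?wnorm_ge0 // /K -addrA lerDl addr_ge0 //.
have hZ u w : in_Lpw p a `]0, tau[ u ->
    (forall t, 0 <= t <= tau -> conv_at Tmk B u t (j (w t))) ->
    exists z : R -> Z, [/\ in_Lpw p a `]0, tau[ z,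
      wnorm p a tau z <= K * wnorm p a tau u &
      {ae lebesgue_measure, forall t, `]0, tau[%classic t -> w t = iota (z t)}].
  move=> pu cw; have [w' [cw' pz zK]] := hK2 u ((in_Lpw_cc a p1 tau u).2 pu).
  exists (fun t => id_op iota_inj (w' t)); rewrite in_Lpw_cc // in pz.
  rewrite !Lpw_norm_cc // !wnormE // -EFinM lee_fin in zK.
  split => //.
    apply: le_trans zK _; rewrite ler_wpM2r ?wnorm_ge0 // (le_trans (ler_norm _)) //.
    by rewrite /K addrAC lerDr addr_ge0.
  apply: aeS cw' => t h; rewrite /= in_itv /= => /andP[/ltW t0 /ltW tt].
  have [|c1 [z _ zE]] := h; first by rewrite /= in_itv /= t0.
  (* Well-posedness provides its own function [w']; uniqueness of the integral and injectivity of
     [j] identify it with [w] almost everywhere. *)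
  have -> : w t = w' t.
    by apply: jinj; apply: conv_uniq c1; apply: cw; rewrite t0.
  by rewrite -zE /= id_funK.
have [L L0 hL] := lipschitz_pointwise F_bounded F_lipschitz.
(* [C] is linear on its domain only; composed with [iota], whose range lies in that domain, it
   becomes a linear map on all of Z. *)
have CZ_lin : linear (fun z : Z => C (iota z)).
  move=> b z z'; rewrite linearP; apply: op_lin; apply: Z_dom_C; by [exists z|exists z'].
pose CZ : {linear Z -> Y} :=
  HB.pack (fun z : Z => C (iota z)) (GRing.isLinear.Build _ _ _ _ _ CZ_lin).
have [c0 hc0] := C_bounded; pose c := `|c0| + 1.
have cp : 0 < c by rewrite ltr_wpDl.
have hc z : nrm (CZ z) <= c * nrm z.
  apply: le_trans (hc0 z) _; rewrite ler_wpM2r ?nrm_ge0 //.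
  by rewrite (le_trans (ler_norm _)) // lerDl.
pose kap := L * c; have kap0 : 0 < kap by exact: mulr_gt0.
(* The largest radius allowed by [hrho]. *)
pose rho := (16 * (kap * K ^+ 2))^-1.
have kK : 0 < 16 * (kap * K ^+ 2) by rewrite !mulr_gt0 // exprn_gt0.
have rho0 : 0 < rho by rewrite invr_gt0.
have hrho : 16 * (kap * K ^+ 2 * rho) <= 1.
  by rewrite mulrA /rho divff ?gt_eqF.
have Kr : 0 < K * rho by exact: mulr_gt0.
have [d d0 hd] := semigroup_right_cvg TC0 x0 Kr.
have [||m1 _ hm1] := @wnorm_small _ p a tau p1 _ _ (fun n => `[0, n.+1%:R^-1]%classic) _ pz0 Kr.
- by move=> n; exact: measurable_itv.
- apply: aeW => q; rewrite /= in_itv /= => /andP[q0 _]; apply/cvgr0Pnorm_lt => e e1.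
  have := @cvg_harmonic R => /cvgr0Pnorm_lt/(_ q q0).
  apply: filterS => n /=; rewrite ger0_norm ?invr_ge0 // => hn.
  by rewrite indicE memNset ?normr0 //= in_itv /= [_ <= n.+1%:R^-1]leNgt hn andbF.
(* Below d the orbit stays within K rho of x0, and below 1 / (m1 + 1) its Z-norm is at most K rho; d
   / 2 is taken because [hd] asks for times strictly below d. *)
pose tau' := Num.min tau (Num.min (d / 2) m1.+1%:R^-1).
have tau'0 : 0 < tau' by rewrite !lt_min tau0 divr_gt0 //= invr_gt0.
have tau'le : tau' <= tau by rewrite ge_min lexx.
have hdelta t : 0 <= t <= tau' -> nrm (T t x0 - x0) <= K * rho.
  move=> /andP[t0 tt]; apply/ltW/hd; rewrite t0 (le_lt_trans tt) //.
  rewrite !gt_min; apply/orP; right; apply/orP; left.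
  by rewrite ltr_pdivrMr // ltr_pMr // ltr1n.
have heps : wnorm p a tau (cutoff `[0, tau'] z0) <= K * rho.
  apply: le_trans (ltW (hm1 m1 (leqnn m1))).
  apply: wnorm_cutoff_sub => // q.
  rewrite /= !in_itv /= => /andP[-> qt]; apply: (le_trans qt).
  by rewrite !ge_min lexx !orbT.
have [u [x [z [pu pz xc [xz xr xu uE]]]]] := local_solution Tmk_C0 p1 TC0 j0 Tmk_extends
  K0 hK iota_inj hZ F_bounded F_lipschitz L0 hL cp hc pz0 z0E tau'le rho0 hrho hdelta heps.
have sx : solves Tmk B p a T j iota F CZ x0 tau' x z.
  split.
  - apply: continuous_subspaceW xc => t /=; rewrite !in_itv /= => /andP[-> h].
    exact: le_trans tau'le.
  - apply/(in_Lpw_restr a p1 z tau'le).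
    by have [] := Lpw_cutoff p1 (measurable_itv `[0, tau']) pz.
  - apply: aeS xz => t h Dt; apply: h; move: Dt; rewrite /= !in_itv /= => /andP[-> h].
    exact: lt_le_trans tau'le.
  - move=> t /andP[t0 tt]; apply: (conv_ae (u := u)); last first.
      by apply: xu; rewrite t0 (le_trans tt).
    apply: aeS2 uE (ae_itv_cc 0 t) => s h1 h2 Ds; apply: h1; have := h2.1 Ds.
    by rewrite /= !in_itv /= => /andP[-> h]; exact: lt_le_trans tt.
exists tau'; split => //; exists x; split.
- have [xc' pz' xz' _] := sx; split => //; exists z; first exact/(in_Lpw_cc a p1).
  by apply: aeS2 xz' (ae_itv_cc 0 tau') => t h1 h2 /h2.
- have [_ _ xz' cx] := sx; split.
    apply: aeS2 xz' (ae_itv_cc 0 tau') => t h1 h2 Dt; rewrite h1; last exact/h2.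
    by apply: Z_dom_C; exists (z t).
  move=> t tt; apply: conv_ae (cx t tt).
  apply: aeS2 xz' (ae_itv_cc 0 tau') => s h1 h2; rewrite /= in_itv /= => /andP[s0 st].
  rewrite /feedback /= h1 //; apply/h2; rewrite /= in_itv /= s0 (le_trans st) //.
  by case/andP: tt.
move=> x' [xc' [z' pz' xz']] [_ cx'] t tt.
have xz'o : {ae lebesgue_measure, forall t, `]0, tau'[%classic t -> x' t = iota (z' t)}.
  by apply: aeS2 xz' (ae_itv_cc 0 tau') => s h1 h2 /h2.
have sx' : solves Tmk B p a T j iota F CZ x0 tau' x' z'.
  split => //; first exact/(in_Lpw_cc a p1).
  move=> s ss; apply: conv_ae (cx' s ss).
  apply: aeS xz' => q h; rewrite /= in_itv /= => /andP[q0 qs].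
  rewrite /feedback /= h //= in_itv /= q0 (le_trans qs) //; by case/andP: ss.
(* The constructed solution is put first because it is known to be within 2 K rho of x0; no
   smallness is available for the competitor. With r = 2 K rho, the quantity kap K r is at most
   1/8. *)
apply/esym; apply: (solution_unique p1 j0 K0 hK iota_inj hZ F_bounded F_lipschitz L0 hL cp hc
  (ltW tau'0) tau'le sx sx' xr) => //.
have -> : L * c * K * (2 * K * rho) = 16 * (kap * K ^+ 2 * rho) / 8 by rewrite /kap; field.
by rewrite ler_pdivrMr // (le_trans hrho) // mulrC ler_pdivlMr // mul1r ler_nat.
Qed.
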